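(* Let $D=[0,1]$ and let $u:[0,1]\to\mathbb R$ satisfy the standing assumptions on $u$ stated in the context. There exist constants $\varepsilon\in(0,1)$, $C\ge 1$ and $\kappa_0\in(0,1)$, depending only on $u$, such that the following holds: for every $\nu>0$ and every integer $k\neq 0$ with $$\nu|k|^{-1}\le \kappa_0,$$ one has, for all $t\ge 0$, $$\|S_\nu(t)P_k\|_{L^2\to L^2}\le C e^{-\varepsilon\lambda_{\nu,k}t}$$ and $$\|R_\nu(t)P_k\|_{L^2\to L^2}\le C e^{-\varepsilon\lambda_{\nu,k}t},$$ where $$\lambda_{\nu,k}=\frac{\nu^{\frac{n_c+1}{n_c+3}}|k|^{\frac{2}{n_c+3}}}{(1+\log|k|+\log\nu^{-1})^2},\qquad n_c=\max\{n_0,1\}.$$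
   Context: $\mathbb T=\mathbb R/2\pi\mathbb Z$. Standing assumptions on $u$: $u\in C^{n_0+2}([0,1])$ is real valued, has a finite number (possibly zero) of critical points $\bar y_1,\dots,\bar y_N\in[0,1]$, and $n_0$ is the maximal order of vanishing of $u'$ at the critical points. Here the order of vanishing of $u'$ at a critical point $\bar y$ is the integer $m\ge1$ such that $u^{(\ell)}(\bar y)=0$ for $1\le \ell\le m$ and $u^{(m+1)}(\bar y)\ne 0$; it is assumed to be finite at each critical point. If $u$ is strictly monotone (no critical points), then $n_0=0$. Moreover $\int_0^1u(y)\,dy=0$. $S_\nu(t):L^2(\mathbb T\times[0,1])\to L^2(\mathbb T\times[0,1])$ is the solution semigroup of $$\partial_t f+u(y)\partial_x f=\nu\Delta f,\qquad f(0)=f_{in},\qquad (x,y)\in\mathbb T\times[0,1],$$ and $R_\nu(t)$ is the solution semigroup on the same space of $$\partial_t f+u(y)\partial_x f=\nu\partial_{yy} f,\qquad f(0)=f_{in},$$ both with the no-flux boundary conditions $\partial_yf(t,x,0)=\partial_yf(t,x,1)=0$ for all $x\in\mathbb T$. $P_k$ denotes the projection to the $k$-th Fourier mode in $x$ (the component of the form $\hat f_k(y)e^{ikx}$). *)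

(* Defs.v *)
From HB Require Import structures.
From mathcomp Require Import all_boot all_order all_algebra.
From mathcomp Require Import complex.
From mathcomp Require Import all_classical all_reals all_analysis.

Set Implicit Arguments.
Unset Strict Implicit.
Unset Printing Implicit Defensive.
Import Order.TTheory GRing.Theory Num.Theory.
Import numFieldNormedType.Exports.
Local Open Scope classical_set_scope.
Local Open Scope ring_scope.

Section ShearProfile.
Context {R : realType}.
Implicit Types (f u : R -> R) (x y : R) (m n : nat).

Definition I01 : set R := `[0, 1].

(* Calculus on the closed interval: difference quotients only use points of
   [0, 1], so that derivatives at 0 and 1 are one-sided, and nothing depends on
   the values of the function outside [0, 1]. *)
Definition quot01 f x : R -> R := fun y => (y - x)^-1 * (f y - f x).

Definition derivable01 f x : Prop :=
  cvg (quot01 f x y @[y --> within I01 x^']).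

Definition deriv01 f x : R := lim (quot01 f x y @[y --> within I01 x^']).

Definition derivn01 n f : R -> R := iter n deriv01 f.

Definition C01 n f : Prop :=
  (forall i, (i < n)%N -> forall x, I01 x -> derivable01 (derivn01 i f) x) /\
  {within I01, continuous (derivn01 n f)}.

Definition critical u : set R := [set y | I01 y /\ deriv01 u y = 0].

(* m is the order of vanishing of u' at y *)
Definition vanishing_order u y m : Prop :=
  [/\ (1 <= m)%N,
      forall l, (1 <= l <= m)%N -> derivn01 l u y = 0 &
      derivn01 m.+1 u y <> 0].

Definition max_vanishing_order u n0 : Prop :=
  (forall y, critical u y -> exists2 m, (m <= n0)%N & vanishing_order u y m) /\
  ((exists2 y, critical u y & vanishing_order u y n0) \/
   (critical u = set0 /\ n0 = 0%N)).

Definition shear_profile u n0 : Prop :=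
  [/\ C01 n0.+2 u,
      finite_set (critical u),
      max_vanishing_order u n0 &
      \int[lebesgue_measure]_(y in I01) u y = 0].

End ShearProfile.

Section L2.
Context {R : realType}.
Implicit Types (f g : R * R -> R[i]).

(* R * R with its product Borel sigma-algebra *)
Definition plane := (measurableTypeR R * measurableTypeR R)%type.

Definition leb2 : {measure set plane -> \bar R} :=
  (@lebesgue_measure R \x @lebesgue_measure R)%E.

(* Fundamental domain of T x [0, 1], T = R / 2 pi Z.  Elements of
   L^2(T x [0, 1]; C) are represented by functions on R * R, of which only the
   restriction to this rectangle, up to null sets, matters. *)
Definition rect : set (R * R) := `[0, 2 * pi] `*` I01.

Definition L2norm f : \bar R :=
  'N[leb2]_2%:E[(fun z => (Normc.normc (f z))%:E) \_ rect].

Definition L2 f : Prop :=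
  [/\ measurable_fun (rect : set plane) (fun z => complex.Re (f z)),
      measurable_fun (rect : set plane) (fun z => complex.Im (f z)) &
      (L2norm f < +oo)%E].

Definition ae_rect f g : Prop := {ae leb2, forall z, rect z -> f z = g z}.

Definition opnorm (T : (R * R -> R[i]) -> R * R -> R[i]) : \bar R :=
  ereal_sup [set L2norm (T f) | f in [set f | L2 f /\ (L2norm f <= 1)%E]].

(* e^(i a) *)
Definition cis (a : R) : R[i] := Complex (cos a) (sin a).

Definition fourier (k : int) f (y : R) : R[i] :=
  let g x := f (x, y) * cis (- (k%:~R * x)) in
  Complex ((2 * pi)^-1 * \int[lebesgue_measure]_(x in `[0, 2 * pi]) complex.Re (g x))
          ((2 * pi)^-1 * \int[lebesgue_measure]_(x in `[0, 2 * pi]) complex.Im (g x)).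

Definition proj_mode (k : int) f : R * R -> R[i] :=
  fun z => fourier k f z.2 * cis (k%:~R * z.1).

End L2.

Section Semigroups.
Context {R : realType}.
Implicit Types (phi : R * R -> R) (u : R -> R) (nu : R) (h : R * R -> R)
  (f g : R * R -> R[i]).

Definition dx phi : R * R -> R := 'D_((1, 0) : R * R) phi.
Definition dy phi : R * R -> R := 'D_((0, 1) : R * R) phi.

Definition C1_plane phi : Prop :=
  [/\ continuous phi,
      forall z, derivable phi z ((1, 0) : R * R),
      forall z, derivable phi z ((0, 1) : R * R),
      continuous (dx phi) & continuous (dy phi)].

Definition C2_plane phi : Prop :=
  [/\ C1_plane phi, C1_plane (dx phi) & C1_plane (dy phi)].

(* C^2 functions on T x [0, 1] with d_y phi = 0 at y = 0 and y = 1 *)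
Definition test_fun phi : Prop :=
  [/\ C2_plane phi,
      forall x y, phi (x + 2 * pi, y) = phi (x, y),
      forall x, dy phi (x, 0) = 0 &
      forall x, dy phi (x, 1) = 0].

(* Formal adjoints of - u(y) d_x + nu (d_xx + d_yy) and of
   - u(y) d_x + nu d_yy, acting on test functions. *)
Definition adj_full u nu phi : R * R -> R :=
  fun z => u z.2 * dx phi z + nu * (dx (dx phi) z + dy (dy phi) z).

Definition adj_hypo u nu phi : R * R -> R :=
  fun z => u z.2 * dx phi z + nu * dy (dy phi) z.

Definition pairing h phi : R := \int[leb2]_(z in rect) (h z * phi z).

(* S is the strongly continuous semigroup on L^2(T x [0, 1]; C) whose
   trajectories t |-> S t f are the weak solutions, with datum f at t = 0, of
   d_t f = L f, where A is the formal adjoint of L.  The test functions being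
   2 pi-periodic in x and subject to the Neumann condition in y, the weak
   formulation encodes periodicity and the no-flux boundary condition: for
   smooth f, integrating by parts leaves the boundary term
   nu (d_y f) phi at y = 0, 1.  As A has real coefficients, real and imaginary
   parts are tested separately against real test functions. *)
Record solution_semigroup (A : (R * R -> R) -> R * R -> R)
    (S : R -> (R * R -> R[i]) -> R * R -> R[i]) : Prop := SolutionSemigroup {
  semigroup_L2 : forall (t : R) f, 0 <= t -> L2 f -> L2 (S t f);
  semigroup_linear : forall (t : R) (a : R[i]) f g, 0 <= t -> L2 f -> L2 g ->
    ae_rect (S t (fun z => a * f z + g z)) (fun z => a * S t f z + S t g z);
  semigroup_bounded : forall t : R, 0 <= t ->
    exists M : R, forall f, L2 f -> (L2norm (S t f) <= M%:E * L2norm f)%E;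
  semigroup_0 : forall f, L2 f -> ae_rect (S 0 f) f;
  semigroup_D : forall (s t : R) f, 0 <= s -> 0 <= t -> L2 f ->
    ae_rect (S (s + t) f) (S s (S t f));
  semigroup_continuous : forall f (t : R), L2 f -> 0 <= t ->
    L2norm (fun z => S s f z - S t f z)
      @[s --> within [set s : R | 0 <= s] (nbhs t)] --> 0%E;
  semigroup_weak : forall f phi (t : R), L2 f -> test_fun phi -> 0 < t ->
    is_derive t 1 (fun s : R => pairing (fun z => complex.Re (S s f z)) phi)
      (pairing (fun z => complex.Re (S t f z)) (A phi)) /\
    is_derive t 1 (fun s : R => pairing (fun z => complex.Im (S s f z)) phi)
      (pairing (fun z => complex.Im (S t f z)) (A phi))
}.

Definition decay_rate (n0 : nat) nu (k : int) : R :=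
  let nc := (maxn n0 1)%:R in
  let K : R := `|k|%N%:R in
  nu `^ ((nc + 1) / (nc + 3)) * K `^ (2 / (nc + 3))
    / (1 + ln K + ln nu^-1) ^+ 2.

End Semigroups.

(* Main.v *)
(** For the k-th Fourier mode put kappa = nu / |k|, n = max(n0, 1) and
  delta = kappa^(1/(n+3)); the rate obtained is |k| delta^(n+1), without any
  logarithmic loss.

  By Taylor expansion and compactness, [0, 1] is covered by finitely many segments
  on which |u(y) - u(z)| >= c |y - z|^(n+1). Hence for every real lam there is a
  multiplier chi with |chi| <= 1 and |chi'| <= C / delta such that chi (u + lam) is
  nonnegative, and at least c' delta^(n+1) away from finitely many points (one
  minimizer of |u + lam| on each segment). Testing the resolvent equation with the
  solution itself and with chi times the solution gives a lower bound
  th delta^(n+1) for the operator -kappa d^2/dy^2 + i (u + lam) + mu on all large cosine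
  Galerkin spaces, uniformly in lam and in mu >= 0.

  A resolvent bound Psi^(1/2) becomes a decay estimate by Plancherel in time: the
  tent-weighted solution on an interval of length T is sampled and transformed by a
  discrete Fourier transform, so that Psi T^2 |h(t0 + T)|^2 <= C |h(t0)|^2. The
  trigonometric functions being complete, the Galerkin coefficients of the weak
  solution satisfy the truncated system up to an error which tends to 0 uniformly
  on compact time intervals; the same argument shows that the energy of each Fourier
  mode is nonincreasing, so that the solution stays in the k-th mode. *)

Require Import Defs.
From mathcomp Require Import all_boot all_order all_algebra.
From mathcomp Require Import complex.
From mathcomp Require Import all_classical all_reals all_analysis.
From mathcomp Require Import measurable_realfun.
From mathcomp Require Import zify ring lra.
Set Implicit Arguments.
Unset Strict Implicit.
Unset Printing Implicit Defensive.
Import Order.TTheory GRing.Theory Num.Theory.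
Import numFieldNormedType.Exports.
Local Open Scope classical_set_scope.
Local Open Scope ring_scope.

(** The scale delta balances diffusion against shear: kappa / delta^2 = delta^(n+1) is the relation
    kappa = delta^(n+3). If the resolvent bound failed for a function of squared norm X, the energy
    identity would make its derivative at most (rho / delta) X^(1/2) with rho small, and the test
    with chi would leave at most X / 4 away from the finitely many bad points. The rest lies in
    intervals of total length of order delta, where a sup bound in terms of the function and its
    derivative leaves at most another X / 4: a contradiction. The obstacle is regularity: a weak
    solution has no known derivative in y, so neither test applies to it directly. Its coefficients
    against test functions are differentiable in time, which dictates the finite-dimensional
    setting. The price is that chi does not preserve the Galerkin space, and that truncation errors
    accompany every estimate. The parameter mu >= 0 serves twice: it contains the real part of a
    discrete time derivative, and it absorbs the extra damping nu k^2 of the full Laplacian, so that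
    one bound serves both equations. *)

Section Calculus.
Context {R : realType}.
Implicit Types (f g : R -> R) (x a b : R).

Lemma derD f g x a b : is_derive x 1 f a -> is_derive x 1 g b ->
  is_derive x 1 (fun y => f y + g y) (a + b).
Proof. by move=> *; exact: is_deriveD. Qed.

Lemma derN f x a : is_derive x 1 f a -> is_derive x 1 (fun y => - f y) (- a).
Proof. by move=> *; exact: is_deriveN. Qed.

Lemma derB f g x a b : is_derive x 1 f a -> is_derive x 1 g b ->
  is_derive x 1 (fun y => f y - g y) (a - b).
Proof. by move=> *; exact: is_deriveB. Qed.

Lemma derZ f x k a : is_derive x 1 f a -> is_derive x 1 (fun y => k * f y) (k * a).
Proof. by move=> fa; exact: is_deriveZ. Qed.

Lemma derM f g x a b : is_derive x 1 f a -> is_derive x 1 g b ->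
  is_derive x 1 (fun y => f y * g y) (a * g x + f x * b).
Proof.
move=> fa gb; rewrite addrC (mulrC a).
by have : is_derive x 1 (f * g) (f x *: b + g x *: a) by exact: is_deriveM.
Qed.

Lemma der_cst x a : is_derive x 1 (fun=> a) 0.
Proof. exact: is_derive_cst. Qed.

Lemma der_id x : is_derive x 1 (fun y => y) (1 : R).
Proof. exact: is_derive_id. Qed.

Lemma derX f n x a : is_derive x 1 f a ->
  is_derive x 1 (fun y => f y ^+ n.+1) (n.+1%:R * f x ^+ n * a).
Proof.
move=> fa; elim: n => [|n IH].
  by rewrite expr0 !mul1r; exact: fa.
under [X in is_derive _ _ X _]eq_fun do rewrite exprS.
apply: (is_derive_eq (derM fa IH)).
by rewrite -[n.+2%:R]natr1 exprS; ring.
Qed.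

Lemma der_comp f g x a b : is_derive (g x) 1 f a -> is_derive x 1 g b ->
  is_derive x 1 (fun y => f (g y)) (a * b).
Proof. by move=> *; exact: is_derive1_comp. Qed.

Lemma der_sum (I : Type) (s : seq I) (F : I -> R -> R) (a : I -> R) x :
  (forall i, is_derive x 1 (F i) (a i)) ->
  is_derive x 1 (fun y => \sum_(i <- s) F i y) (\sum_(i <- s) a i).
Proof.
move=> Fa; elim: s => [|i s IH].
  by under [X in is_derive _ _ X _]eq_fun do rewrite big_nil; rewrite big_nil; exact: der_cst.
by under [X in is_derive _ _ X _]eq_fun do rewrite big_cons; rewrite big_cons; exact: derD.
Qed.

Lemma der_continuous f f' : (forall x, is_derive x 1 f (f' x)) -> continuous f.
Proof.
move=> df x; apply: differentiable_continuous; apply/derivable1_diffP.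
exact: (@ex_derive _ _ _ _ _ _ _ (df x)).
Qed.

Lemma ctsD f g : continuous f -> continuous g -> continuous (fun y => f y + g y).
Proof. by move=> cf cg y; apply: cvgD; [exact: cf|exact: cg]. Qed.

Lemma ctsB f g : continuous f -> continuous g -> continuous (fun y => f y - g y).
Proof. by move=> cf cg y; apply: cvgB; [exact: cf|exact: cg]. Qed.

Lemma ctsN f : continuous f -> continuous (fun y => - f y).
Proof. by move=> cf y; apply: cvgN; exact: cf. Qed.

Lemma ctsM f g : continuous f -> continuous g -> continuous (fun y => f y * g y).
Proof. by move=> cf cg y; apply: cvgM; [exact: cf|exact: cg]. Qed.

Lemma ctsZ k f : continuous f -> continuous (fun y => k * f y).
Proof. by move=> cf y; apply: cvgM; [exact: cvg_cst|exact: cf]. Qed.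

Lemma cts_cst a : continuous (fun _ : R => a).
Proof. by move=> x; exact: cvg_cst. Qed.

Lemma ctsX n f : continuous f -> continuous (fun y => f y ^+ n).
Proof.
move=> cf; elim: n => [|n IH]; first by under eq_fun do rewrite expr0; exact: cts_cst.
by under eq_fun do rewrite exprS; exact: ctsM.
Qed.

Lemma cts_comp f g : continuous f -> continuous g -> continuous (fun y => f (g y)).
Proof. by move=> cf cg y; apply: (cvg_comp _ _ (cg y)); exact: cf. Qed.

Lemma cts_sum (I : Type) (s : seq I) (F : I -> R -> R) :
  (forall i, continuous (F i)) -> continuous (fun y => \sum_(i <- s) F i y).
Proof.
move=> cF; elim: s => [|i s IH].
  by under eq_fun do rewrite big_nil; exact: cts_cst.
by under eq_fun do rewrite big_cons; exact: ctsD.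
Qed.

Lemma cts_integrable f a b : continuous f ->
  (@lebesgue_measure R).-integrable `[a, b] (EFin \o f).
Proof.
move=> cf; apply: continuous_compact_integrable; first exact: segment_compact.
exact: continuous_subspaceT.
Qed.

Lemma cts_measurable f (D : set R) : continuous f -> measurable_fun D f.
Proof.
by move=> cf; apply: measurable_funTS; exact: continuous_measurable_fun.
Qed.

Lemma FTC2 f f' a b : a <= b -> (forall x, is_derive x 1 f (f' x)) ->
  continuous f' -> \int[lebesgue_measure]_(x in `[a, b]) f' x = f b - f a.
Proof.
rewrite le_eqVlt => /predU1P[<- _ _|ab df cf'].
  by rewrite set_itv1 Rintegral_set1 subrr.
have cf := der_continuous df.
rewrite /Rintegral (@continuous_FTC2 _ f' f a b)//.
- exact: continuous_subspaceT.
- split.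
  + by move=> x _; exact: (@ex_derive _ _ _ _ _ _ _ (df x)).
  + exact/cvg_at_right_filter/cf.
  + exact/cvg_at_left_filter/cf.
- by move=> x _; rewrite derive1E; exact: (@derive_val _ _ _ _ _ _ _ (df x)).
Qed.

End Calculus.

(** * Square integrable functions and finite orthonormal families *)

Section InnerProduct.
Context d (T : measurableType d) {R : realType}.
Variables (mu : {measure set T -> \bar R}) (D : set T).
Hypothesis mD : measurable D.
Implicit Types f g h : T -> R.

Definition sqi f :=
  measurable_fun D f /\ mu.-integrable D (EFin \o (fun x => f x ^+ 2)).

Definition ip f g : R := \int[mu]_(x in D) (f x * g x).

Lemma sqi_mul f g : sqi f -> sqi g ->
  mu.-integrable D (EFin \o (fun x => f x * g x)).
Proof.
move=> [mf f2] [mg g2].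
apply: (le_integrable mD _ _ (integrableD mD f2 g2)).
- by apply/measurable_EFinP; exact: measurable_funM.
- move=> x _ /=; rewrite lee_fin [leRHS]ger0_norm ?addr_ge0 ?sqr_ge0//.
  have := sqr_ge0 (`|f x| - `|g x|).
  have /= := sqr_ge0 (`|f x| + `|g x|).
  rewrite normrM -(real_normK (num_real (f x))) -(real_normK (num_real (g x))).
  nra.
Qed.

Lemma sqiD f g : sqi f -> sqi g -> sqi (fun x => f x + g x).
Proof.
move=> sf sg; have [mf f2] := sf; have [mg g2] := sg.
split; first exact: measurable_funD.
have /= i2 := integrableD mD (integrableD mD f2 g2)
  (integrableZl mD 2 (sqi_mul sf sg)).
apply: eq_integrable i2 => // x _ /=.
by congr EFin; ring.
Qed.

Lemma sqiZ a f : sqi f -> sqi (fun x => a * f x).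
Proof.
move=> [mf f2]; split; first by apply: measurable_funM.
have i2 := integrableZl mD (a ^+ 2) f2.
by apply: eq_integrable i2 => // x _ /=; rewrite exprMn.
Qed.

Lemma sqiN f : sqi f -> sqi (fun x => - f x).
Proof.
by move=> /(sqiZ (-1)); under [X in sqi X -> _]eq_fun do rewrite mulN1r.
Qed.

Lemma sqiB f g : sqi f -> sqi g -> sqi (fun x => f x - g x).
Proof. by move=> sf sg; apply: sqiD => //; exact: sqiN. Qed.

Lemma sqi0 : sqi (fun=> 0).
Proof.
split; first exact: measurable_cst.
by rewrite expr0n/=; exact: integrable0.
Qed.

Lemma sqi_sum (I : Type) (s : seq I) (F : I -> T -> R) :
  (forall i, sqi (F i)) -> sqi (fun x => \sum_(i <- s) F i x).
Proof.
move=> sF; elim: s => [|i s IH].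
  by under eq_fun do rewrite big_nil; exact: sqi0.
by under eq_fun do rewrite big_cons; exact: sqiD.
Qed.

Lemma sqi_bddM (b f : T -> R) (M : R) : measurable_fun D b ->
  (forall x, D x -> `|b x| <= M) -> sqi f -> sqi (fun x => b x * f x).
Proof.
move=> mb bM [mf f2]; split; first exact: measurable_funM.
apply: (le_integrable mD _ _ (integrableZl mD (M ^+ 2) f2)).
- apply/measurable_EFinP; apply: measurable_funX; exact: measurable_funM.
- move=> x Dx; rewrite /= lee_fin [leLHS]ger0_norm ?sqr_ge0//.
  rewrite [leRHS]ger0_norm; last by rewrite -exprMn sqr_ge0.
  rewrite exprMn ler_wpM2r ?sqr_ge0// -(real_normK (num_real (b x))).
  by apply: lerXn2r; rewrite ?nnegrE ?bM//; apply: le_trans (bM _ Dx).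
Qed.

Lemma ipC f g : ip f g = ip g f.
Proof. by apply: eq_Rintegral => x _; rewrite mulrC. Qed.

Lemma eq_ip f1 f2 g1 g2 : (forall x, D x -> f1 x = f2 x) ->
  (forall x, D x -> g1 x = g2 x) -> ip f1 g1 = ip f2 g2.
Proof.
by move=> e1 e2; apply: eq_Rintegral => x /[!inE] Dx; rewrite e1 ?e2.
Qed.

Lemma ipDl f g h : sqi f -> sqi g -> sqi h ->
  ip (fun x => f x + g x) h = ip f h + ip g h.
Proof.
move=> sf sg sh; rewrite /ip -RintegralD//; [|exact: sqi_mul..].
by apply: eq_Rintegral => x _; rewrite mulrDl.
Qed.

Lemma ipZl a f g : sqi f -> sqi g -> ip (fun x => a * f x) g = a * ip f g.
Proof.
move=> sf sg; rewrite /ip -RintegralZl//; last exact: sqi_mul.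
by apply: eq_Rintegral => x _; rewrite mulrA.
Qed.

Lemma ipDr f g h : sqi f -> sqi g -> sqi h ->
  ip h (fun x => f x + g x) = ip h f + ip h g.
Proof. by move=> *; rewrite ipC ipDl// !(ipC h). Qed.

Lemma ipZr a f g : sqi f -> sqi g -> ip g (fun x => a * f x) = a * ip g f.
Proof. by move=> *; rewrite ipC ipZl// ipC. Qed.

Lemma ipNl f g : sqi f -> sqi g -> ip (fun x => - f x) g = - ip f g.
Proof.
by move=> sf sg; under [X in ip X _]eq_fun do rewrite -mulN1r; rewrite ipZl// mulN1r.
Qed.

Lemma ipBl f g h : sqi f -> sqi g -> sqi h ->
  ip (fun x => f x - g x) h = ip f h - ip g h.
Proof. by move=> *; rewrite ipDl ?ipNl//; exact: sqiN. Qed.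

Lemma ipBr f g h : sqi f -> sqi g -> sqi h ->
  ip h (fun x => f x - g x) = ip h f - ip h g.
Proof. by move=> *; rewrite ipC ipBl// !(ipC h). Qed.

Lemma ip0l g : ip (fun=> 0) g = 0.
Proof.
rewrite /ip; under eq_Rintegral do rewrite mul0r.
by rewrite /Rintegral integral0.
Qed.

Lemma ip_suml (I : Type) (s : seq I) (F : I -> T -> R) g :
  (forall i, sqi (F i)) -> sqi g ->
  ip (fun x => \sum_(i <- s) F i x) g = \sum_(i <- s) ip (F i) g.
Proof.
move=> sF sg; elim: s => [|i s IH].
  by rewrite big_nil; under [X in ip X _]eq_fun do rewrite big_nil; exact: ip0l.
rewrite big_cons -IH -ipDl//; last exact: sqi_sum.
by under [X in ip X _]eq_fun do rewrite big_cons.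
Qed.

Lemma ip_sumr (I : Type) (s : seq I) (F : I -> T -> R) g :
  (forall i, sqi (F i)) -> sqi g ->
  ip g (fun x => \sum_(i <- s) F i x) = \sum_(i <- s) ip g (F i).
Proof.
by move=> *; rewrite ipC ip_suml//; apply: eq_bigr => i _; rewrite ipC.
Qed.

Lemma ip_ge0 f : 0 <= ip f f.
Proof. by apply: Rintegral_ge0 => x _; rewrite -expr2 sqr_ge0. Qed.

Lemma le_ip2 f g : sqi f -> sqi g -> (forall x, D x -> f x ^+ 2 <= g x ^+ 2) ->
  ip f f <= ip g g.
Proof.
move=> sf sg fg; apply: (le_Rintegral mD (sqi_mul sf sf) (sqi_mul sg sg)).
by move=> x /fg; rewrite !expr2.
Qed.

Lemma ip_sqrD f g : sqi f -> sqi g ->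
  ip (fun x => f x + g x) (fun x => f x + g x) = ip f f + 2 * ip f g + ip g g.
Proof.
move=> sf sg; have sfg := sqiD sf sg.
by rewrite ipDl// !ipDr// (ipC g f); ring.
Qed.

Lemma ip_sqrB f g : sqi f -> sqi g ->
  ip (fun x => f x - g x) (fun x => f x - g x) = ip f f - 2 * ip f g + ip g g.
Proof.
move=> sf sg; have sfg := sqiB sf sg.
by rewrite ipBl// !ipBr// (ipC g f); ring.
Qed.

Lemma ip_CS f g : sqi f -> sqi g -> ip f g ^+ 2 <= ip f f * ip g g.
Proof.
move=> sf sg.
have H a b : 0 <= a ^+ 2 * ip f f - 2 * a * b * ip f g + b ^+ 2 * ip g g.
  have := ip_ge0 (fun x => a * f x - b * g x).
  have sa := sqiZ a sf; have sb := sqiZ b sg.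
  rewrite ip_sqrB// !ipZl// !ipZr//.
  by congr (0 <= _); ring.
have := ip_ge0 f; rewrite le_eqVlt => /predU1P[f0|f0]; last first.
  have := H (ip f g) (ip f f).
  suff -> : ip f g ^+ 2 * ip f f - 2 * ip f g * ip f f * ip f g +
    ip f f ^+ 2 * ip g g = ip f f * (ip f f * ip g g - ip f g ^+ 2).
    by rewrite pmulr_rge0// subr_ge0.
  by ring.
(* When [ip f f = 0], a nonzero [ip f g] is excluded by coefficients for which the quadratic form
   [H] takes the value -1. *)
rewrite -f0 mul0r; have [->|i0] := eqVneq (ip f g) 0; first by rewrite expr0n.
have := H ((ip g g + 1) / (2 * ip f g)) 1; rewrite -f0 mulr0 add0r expr1n mul1r.
suff -> : 2 * ((ip g g + 1) / (2 * ip f g)) * 1 * ip f g = ip g g + 1 by lra.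
by field.
Qed.

Lemma ip_CSn f g : sqi f -> sqi g ->
  `|ip f g| <= Num.sqrt (ip f f) * Num.sqrt (ip g g).
Proof.
move=> sf sg; rewrite -sqrtrM ?ip_ge0// -sqrtr_sqr ler_wsqrtr//.
exact: ip_CS.
Qed.

Section Orthonormal.
(** The predicate [w] marks the unit vectors; the other members have norm 0. The sine families
    contain an identically zero member at frequency 0, and keeping it lets cosines and sines share
    one index type. *)
Variables (I : finType) (w : pred I) (e : I -> T -> R).
Hypothesis se : forall i, sqi (e i).
Hypothesis oe : forall i j, ip (e i) (e j) = ((i == j) && w i)%:R.

Lemma sqi_lincomb (a : I -> R) : sqi (fun x => \sum_i a i * e i x).
Proof. by apply: sqi_sum => i; exact: sqiZ. Qed.

Lemma ip_lincomb f (a : I -> R) : sqi f ->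
  ip f (fun x => \sum_i a i * e i x) = \sum_i a i * ip f (e i).
Proof.
move=> sf; rewrite ip_sumr//; last by move=> i; exact: sqiZ.
by apply: eq_bigr => i _; rewrite ipZr.
Qed.

Lemma ip_lincomb2 (a b : I -> R) :
  ip (fun x => \sum_i a i * e i x) (fun x => \sum_i b i * e i x) =
  \sum_(i | w i) a i * b i.
Proof.
rewrite ip_lincomb; last exact: sqi_lincomb.
rewrite [RHS]big_mkcond; apply: eq_bigr => i _.
rewrite ipC ip_lincomb// (bigD1 i)//= big1 ?addr0 => [|j ji].
  by rewrite oe eqxx/=; case: ifP => _; rewrite ?mulr1 ?mulr0// mulrC.
by rewrite oe eq_sym (negPf ji) mulr0.
Qed.

Lemma ip_coef0 f i : sqi f -> ~~ w i -> ip f (e i) = 0.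
Proof.
move=> sf wi; apply/eqP; rewrite -sqrf_eq0; apply/eqP/le_anti.
by rewrite sqr_ge0 (le_trans (ip_CS sf (se i)))// oe eqxx (negPf wi) mulr0.
Qed.

(** Pythagoras: the Fourier coefficients minimise the distance, and any other choice [a] costs its
    own squared error. *)
Lemma dist_lincomb f (a : I -> R) : sqi f ->
  ip (fun x => f x - \sum_i a i * e i x) (fun x => f x - \sum_i a i * e i x)
  = ip f f - \sum_i ip f (e i) ^+ 2 + \sum_(i | w i) (ip f (e i) - a i) ^+ 2.
Proof.
move=> sf; rewrite ip_sqrB//; last exact: sqi_lincomb.
rewrite ip_lincomb2 ip_lincomb// -!addrA; congr (_ + _).
rewrite [\sum_(i | w i) (_ - _) ^+ 2]big_mkcond/= [\sum_(i | w i) _]big_mkcond/=.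
rewrite mulr_sumr -!sumrN -!big_split/=; apply: eq_bigr => i _.
case: ifPn => wi; first by ring.
by rewrite ip_coef0//; ring.
Qed.

Lemma dist_proj f : sqi f ->
  ip (fun x => f x - \sum_i ip f (e i) * e i x)
     (fun x => f x - \sum_i ip f (e i) * e i x)
  = ip f f - \sum_i ip f (e i) ^+ 2.
Proof.
move=> sf; rewrite dist_lincomb// [X in _ + X]big1 ?addr0// => i _.
by rewrite subrr expr0n.
Qed.

Lemma bessel f : sqi f -> \sum_i ip f (e i) ^+ 2 <= ip f f.
Proof.
by move=> sf; rewrite -subr_ge0 -dist_proj//; exact: ip_ge0.
Qed.

Lemma proj_min f (a : I -> R) : sqi f ->
  ip f f - \sum_i ip f (e i) ^+ 2 <=
  ip (fun x => f x - \sum_i a i * e i x) (fun x => f x - \sum_i a i * e i x).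
Proof.
by move=> sf; rewrite dist_lincomb// lerDl sumr_ge0// => i _; exact: sqr_ge0.
Qed.

End Orthonormal.
End InnerProduct.

(** * Growth of the shear profile *)

Section Profile.
Context {R : realType}.
Implicit Types (f g u : R -> R) (x y t c e : R).

Lemma derivable01_expansion f x : derivable01 f x -> forall e, 0 < e ->
  exists2 d, 0 < d & forall y, I01 y -> `|y - x| < d ->
    `|f y - f x - deriv01 f x * (y - x)| <= e * `|y - x|.
Proof.
move=> /cvgrPdist_lt fx e e0; have := fx _ e0.
rewrite near_withinE near_withinE => /nbhs_ballP[d /= d0 H].
exists d => // y y01 yd; have [->|yx] := eqVneq y x.
  by rewrite !subrr mulr0 subrr normr0 mulr0.
have /(_ _ yx y01) := H y; rewrite /ball/= distrC => /(_ yd)/ltW.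
rewrite /quot01 -/(deriv01 f x) => {}H.
have yx0 : y - x != 0 by rewrite subr_eq0.
rewrite (_ : f y - _ - _ = (y - x) * ((y - x)^-1 * (f y - f x) - deriv01 f x)); last by field.
by rewrite normrM mulrC ler_wpM2r// distrC.
Qed.

Lemma is_derive_expansion g t l :
  (forall e, 0 < e -> exists2 d, 0 < d & forall s, `|s - t| < d ->
    `|g s - g t - l * (s - t)| <= e * `|s - t|) -> is_derive t 1 g l.
Proof.
move=> H.
have cl : (fun h => h^-1 *: (g (h *: 1 + t) - g t)) @ 0^' --> l.
  apply/cvgrPdist_le => e e0; have [d d0 {}H] := H _ e0.
  apply/nbhs_ballP; exists d => //= h; rewrite /ball/= sub0r normrN => hd h0.
  have := H (h *: 1 + t); rewrite addrK /GRing.scale/= mulr1 => /(_ hd) {}H.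
  rewrite (_ : l - _ = - ((g (h + t) - g t - l * h) / h)); last by field.
  by rewrite normrN normrM normfV ler_pdivrMr ?normr_gt0.
split; first by apply/cvg_ex; exists l.
exact/cvg_lim.
Qed.

Lemma continuous_expansion (A : set R) g : (forall t, A t -> exists c, exists2 d, 0 < d &
    forall s, A s -> `|s - t| < d -> `|g s - g t| <= c * `|s - t|) ->
  {within A, continuous g}.
Proof.
move=> H; apply/subspace_continuousP => t At.
have [c [d d0 {}H]] := H t At.
apply/cvgrPdist_le => e e0; rewrite near_withinE.
have c0 : 0 < `|c| + 1 by rewrite ltr_wpDl.
apply/nbhs_ballP; exists (Num.min d (e / (`|c| + 1))) => /=.
  by rewrite lt_min d0 divr_gt0.
move=> s; rewrite /ball/= distrC lt_min => /andP[sd se] As.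
rewrite distrC (le_trans (H _ As sd))//.
move: se; rewrite ltr_pdivlMr// => /ltW; apply: le_trans.
rewrite mulrC ler_wpM2l// (le_trans (ler_norm _))// lerDl//.
Qed.

(** [G i.+1] is the derivative of [G i]. Starting from the lower bound on the top one, each
    integration from 0, where the intermediate functions vanish, gains one power of t; the last
    integration, from s to t, compares values of [G 0]. *)
Lemma chain_growth (m : nat) (G : nat -> R -> R) c e : 0 < c ->
  (forall i, (i <= m)%N -> {within `[0, e], continuous (G i)}) ->
  (forall i t, (i <= m)%N -> 0 < t < e -> is_derive t 1 (G i) (G i.+1 t)) ->
  (forall i, (1 <= i <= m)%N -> G i 0 = 0) ->
  (forall t, 0 <= t <= e -> c <= G m.+1 t) ->
  exists2 c' : R, 0 < c' & forall s t : R, 0 <= s <= t -> t <= e ->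
    c' * (t - s) ^+ m.+1 <= G 0%N t - G 0%N s.
Proof.
move=> c0 cG dG G0 Gc.
have step (i j : nat) a : (i <= m)%N ->
    (forall t, 0 <= t <= e -> a * t ^+ j <= G i.+1 t) ->
    forall s t : R, 0 <= s <= t -> t <= e ->
    a / j.+1%:R * (t ^+ j.+1 - s ^+ j.+1) <= G i t - G i s.
  move=> im Ga s t /andP[s0]; rewrite le_eqVlt => /predU1P[->|st te].
    by rewrite !subrr mulr0.
  have [||x] := @MVT R (fun t => G i t - a / j.+1%:R * t ^+ j.+1)
      (fun t => G i.+1 t - a * t ^+ j) s t st.
  - move=> x; rewrite in_itv/= => /andP[sx xt].
    have dx := dG i x im; have {}dx : is_derive x 1 (G i) (G i.+1 x).
      by apply: dx; rewrite (le_lt_trans s0 sx) (lt_le_trans xt te).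
    apply: (is_derive_eq (derB dx (derZ _ (derX j (der_id x))))).
    by field; rewrite addrC natr1 pnatr_eq0.
  - apply: (@continuous_subspaceW _ _ _ `[0, e]).
      move=> y /=; rewrite !in_itv/= => /andP[sy yt].
      by rewrite (le_trans s0 sy) (le_trans yt te).
    move=> x; apply: cvgB; first exact: (cG i im).
    move: x; apply: continuous_subspaceT; apply: ctsZ; apply: ctsX => x.
    exact: cvg_id.
  rewrite in_itv/= => /andP[sx xt].
  have : 0 <= (G i.+1 x - a * x ^+ j) * (t - s).
    rewrite mulr_ge0// subr_ge0 ?Ga ?(ltW st)//.
    by rewrite (le_trans s0 (ltW sx)) (le_trans (ltW xt) te).
  by move=> + E; rewrite -E; move: (a / j.+1%:R) => q; lra.
have pos (j : nat) : (j <= m)%N -> exists2 a, 0 < a &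
    forall t, 0 <= t <= e -> a * t ^+ j <= G (m.+1 - j)%N t.
  elim: j => [_|j IH jm]; first by exists c => // t te; rewrite expr0 mulr1 subn0 Gc.
  have [a a0 Ga] := IH (ltnW jm).
  exists (a / j.+1%:R); first by rewrite divr_gt0.
  move=> t /andP[t0 te].
  have := @step (m - j)%N j a (leq_subr _ _); rewrite -subSn ?(ltnW jm)// => /(_ Ga 0 t).
  rewrite lexx t0 te subSS G0 ?leq_subr ?andbT ?subn_gt0// => /(_ isT isT).
  by rewrite expr0n/= !subr0.
have [a a0 Ga] := pos m (leqnn _).
exists (a / m.+1%:R); first by rewrite divr_gt0.
move=> s t st te; have := @step 0%N m a (leq0n _); rewrite subSnn in Ga.
move=> /(_ Ga s t st te); apply: le_trans.
rewrite ler_wpM2l ?divr_ge0 ?(ltW a0)//.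
have /andP[s0 {}st] := st.
have ts0 : 0 <= t - s by rewrite subr_ge0.
rewrite -[X in _ <= X ^+ _ - _](subrK s).
(* Superadditivity of powers, (t - s)^(m+1) + s^(m+1) <= t^(m+1) for 0 <= s <= t, by induction on
   [m]. *)
elim: m {cG dG G0 Gc step pos Ga} => [|m IH]; first by rewrite !expr1 addrK.
rewrite ![_ ^+ m.+2]exprS.
have h1 : (t - s) * (t - s) ^+ m.+1 <= (t - s) * ((t - s + s) ^+ m.+1 - s ^+ m.+1).
  by rewrite ler_wpM2l.
have h2 : s * s ^+ m.+1 <= s * (t - s + s) ^+ m.+1.
  by rewrite subrK ler_wpM2l// lerXn2r ?nnegrE// (le_trans s0).
have h3 : 0 <= (t - s) * s ^+ m.+1 by rewrite mulr_ge0 ?exprn_ge0.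
move: h1 h2 h3; move: (_ ^+ m.+1) (_ ^+ m.+1) (_ ^+ m.+1) => A B C; lra.
Qed.

(** The estimate is one-sided, [sg] giving the side of [x]: at a critical point u need not be
    injective across [x], but on each side u^(m+1) has a constant sign near [x] and the chain of
    derivatives can be integrated from [x]. *)
Lemma local_growth u n0 x (sg : R) m : C01 n0.+2 u -> I01 x ->
  sg = 1 \/ sg = -1 -> (m <= n0)%N ->
  (forall l, (1 <= l <= m)%N -> derivn01 l u x = 0) -> derivn01 m.+1 u x <> 0 ->
  exists2 c : R, 0 < c & exists2 e : R, 0 < e & forall y z, I01 y -> I01 z ->
    0 <= sg * (y - x) <= e -> 0 <= sg * (z - x) <= e ->
    c * `|y - z| ^+ m.+1 <= `|u y - u z|.
Proof.
move=> [Cu _] x01 sgE mn D0 /eqP Dm.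
have sg1 : `|sg| = 1 by case: sgE => ->; rewrite ?normrN normr1.
have sgsg : sg * sg = 1 by case: sgE => ->; rewrite ?mulrNN mulr1.
pose D i := derivn01 i u.
have DD i y : (i <= m.+1)%N -> I01 y -> derivable01 (D i) y.
  by move=> im; apply: Cu; rewrite (leq_ltn_trans im)// !ltnS.
pose a := D m.+1 x; have a0 : 0 < `|a| by rewrite normr_gt0.
have [d d0 Hd] := derivable01_expansion (DD _ _ (leqnn _) x01) ltr01.
pose L := deriv01 (D m.+1) x; have L0 : 0 < `|L| + 1 by rewrite ltr_wpDl.
(* For t <= e the derivative of order m+1 moves by at most (|L| + 1) t <= |a| / 2, so it keeps at
   least half of its size; [d / 2] keeps t strictly inside the expansion radius. *)
pose e := Num.min (d / 2) (`|a| / (2 * (`|L| + 1))).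
have e0 : 0 < e by rewrite lt_min !divr_gt0// mulr_gt0.
(* Room left in [0, 1] on the side [sg] of [x]; it is 0 at an endpoint when [sg] points outwards,
   and the estimate then only concerns [x] itself. *)
pose E : R := (1 - sg) / 2 * x + (1 + sg) / 2 * (1 - x).
have x0 : 0 <= x <= 1 by move: x01; rewrite /I01/= in_itv.
have room t : 0 <= t <= E -> I01 (x + sg * t).
  by rewrite /E /I01/= in_itv/=; case: sgE => ->; lra.
(* This sign makes the top function of the chain equal to |a| at t = 0, whatever the side and the
   parity of m. *)
pose b := Num.sg a * sg ^+ m.+1.
have b1 : `|b| = 1.
  by rewrite normrM normrX sg1 expr1n mulr1 normr_sg -normr_gt0 a0.
pose G i t := b * sg ^+ i * D i (x + sg * t).
pose e' := Num.min e E.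
have in01 t : 0 <= t <= e' -> I01 (x + sg * t).
  by rewrite le_min => /and3P[t0 _ tE]; apply: room; rewrite t0.
have bs i : `|b * sg ^+ i| = 1 by rewrite normrM b1 normrX sg1 expr1n mulr1.
have Gexp i t : (i <= m.+1)%N -> 0 <= t <= e' -> forall r, 0 < r ->
    exists2 d, 0 < d & forall s, 0 <= s <= e' -> `|s - t| < d ->
    `|G i s - G i t - G i.+1 t * (s - t)| <= r * `|s - t|.
  move=> im te r r0.
  have [d' d'0 H] := derivable01_expansion (DD _ _ im (in01 _ te)) r0.
  exists d' => // s se sd; have := H _ (in01 _ se).
  have -> : x + sg * s - (x + sg * t) = sg * (s - t) by ring.
  rewrite normrM sg1 mul1r => /(_ sd); apply: le_trans.
  have -> : G i s - G i t - G i.+1 t * (s - t) = (b * sg ^+ i) *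
    (D i (x + sg * s) - D i (x + sg * t) - D i.+1 (x + sg * t) * (sg * (s - t))).
    by rewrite /G exprS; ring.
  by rewrite normrM bs mul1r.
have Gm t : 0 <= t <= e' -> `|a| / 2 <= G m.+1 t.
  move=> te; have := in01 _ te; have := te.
  rewrite le_min => /and3P[t0 tle _] x't.
  move: tle; rewrite le_min => /andP[td ta].
  have E1 : x + sg * t - x = sg * t by ring.
  have := Hd _ x't; rewrite E1 normrM sg1 mul1r (ger0_norm t0) mul1r.
  have td' : t < d by lra.
  move=> /(_ td') H.
  have H2 : `|D m.+1 (x + sg * t) - a| <= (`|L| + 1) * t.
    have -> : D m.+1 (x + sg * t) - a =
      (D m.+1 (x + sg * t) - a - L * (sg * t)) + L * (sg * t) by ring.
    apply: (le_trans (ler_normD _ _)); rewrite mulrDl mul1r addrC lerD//.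
    by rewrite !normrM sg1 mul1r (ger0_norm t0).
  have H3 : (`|L| + 1) * t <= `|a| / 2.
    rewrite (le_trans (ler_wpM2l (ltW L0) ta))//.
    by rewrite le_eqVlt; apply/orP; left; apply/eqP; field; lra.
  have -> : G m.+1 t = Num.sg a * D m.+1 (x + sg * t).
    rewrite /G /b -!mulrA; congr (_ * _); rewrite mulrA -exprMn sgsg expr1n.
    by rewrite mul1r.
  have := le_trans H2 H3; case: (ltgtP a 0) a0 => [a1|a1|->]; last by rewrite normr0 ltxx.
    by rewrite ltr0_sg// ltr0_norm// ler_norml => _; lra.
  by rewrite gtr0_sg// gtr0_norm// ler_norml => _; lra.
have [||||c c0 Hc] := @chain_growth m G (`|a| / 2) e' _ _ _ _ Gm.
- by rewrite divr_gt0.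
- move=> i im; apply: continuous_expansion => t; rewrite /= in_itv/= => te.
  have [d1 d10 H] := Gexp i t (leqW im) te _ ltr01.
  exists (`|G i.+1 t| + 1); exists d1 => // s; rewrite /= in_itv/= => se sd.
  have {}H := H s se sd; rewrite -[_ - _](subrK (G i.+1 t * (s - t))).
  apply: (le_trans (ler_normD _ _)).
  by rewrite addrC mulrDl normrM lerD.
- move=> i t im /andP[t0 te]; apply: is_derive_expansion => r r0.
  have te' : 0 <= t <= e' by rewrite !ltW.
  have [d1 d10 H] := Gexp i t (leqW im) te' _ r0.
  exists (Num.min d1 (Num.min t (e' - t))).
    by rewrite !lt_min d10 t0 subr_gt0.
  move=> s; rewrite !lt_min => /and3P[sd st se]; apply: H => //.
  by move: st se; rewrite !ltr_norml; lra.
- by move=> i im; rewrite /G mulr0 addr0 [D i x]D0 ?mulr0.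
exists c => //; exists e => // y z.
have G0E y' : I01 y' -> 0 <= sg * (y' - x) <= e ->
    0 <= sg * (y' - x) <= e' /\ G 0%N (sg * (y' - x)) = b * u y'.
  move=> y01 /andP[y0 ye]; split.
    rewrite le_min y0 ye/= /E; move: y01; rewrite /I01/= in_itv/=.
    by case: sgE => ->; lra.
  by rewrite /G expr0 mulr1 mulrA sgsg mul1r addrC subrK.
wlog yz : y z / sg * (z - x) <= sg * (y - x).
  move=> H y01 z01 yd zd; have [h|/ltW h] := leP (sg * (z - x)) (sg * (y - x)).
    exact: H.
  by rewrite distrC [leRHS]distrC; exact: H.
move=> y01 z01 /(G0E _ y01)[/andP[y0 ye] Gy] /(G0E _ z01)[/andP[z0 ze] Gz].
have := Hc (sg * (z - x)) (sg * (y - x)); rewrite z0 yz => /(_ isT ye).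
rewrite Gy Gz -!mulrBr; have -> : y - x - (z - x) = y - z by ring.
move=> H; rewrite -[`|u y - u z|]mul1r -b1 -normrM; apply: le_trans (ler_norm _).
apply: le_trans H; rewrite -[`|y - z|]mul1r -{1}sg1 -normrM ger0_norm//.
by rewrite (_ : sg * (y - z) = sg * (y - x) - sg * (z - x)); [rewrite subr_ge0|ring].
Qed.

Lemma shear_profile_local u n0 n x : shear_profile u n0 -> (n0 <= n)%N -> I01 x ->
  exists2 c : R, 0 < c & exists2 e : R, 0 < e & forall y z, I01 y -> I01 z ->
    `|y - x| <= e -> `|z - x| <= e -> (y <= x /\ z <= x) \/ (x <= y /\ x <= z) ->
    c * `|y - z| ^+ n.+1 <= `|u y - u z|.
Proof.
move=> [Cu _ [crit _] _] n0n x01.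
(* A noncritical point is the case m = 0: there u' itself does not vanish. *)
have [m mn0 [m0 mD]] : exists2 m, (m <= n0)%N &
    (forall l, (1 <= l <= m)%N -> derivn01 l u x = 0) /\ derivn01 m.+1 u x <> 0.
  have [ux|ux] := pselect (deriv01 u x = 0).
    by have [m mn [_ ? ?]] := crit x (conj x01 ux); exists m.
  by exists 0%N => //; split => // -[|l].
have [c1 c10 [e1 e10 H1]] := local_growth Cu x01 (or_introl erefl) mn0 m0 mD.
have [c2 c20 [e2 e20 H2]] := local_growth Cu x01 (or_intror erefl) mn0 m0 mD.
exists (Num.min c1 c2); first by rewrite lt_min c10.
exists (Num.min e1 e2); first by rewrite lt_min e10.
move=> y z y01 z01; rewrite !le_min !ler_norml => yx zx side.
(* Distances are at most 1, so the exponent m + 1 of the point may be raised to the common exponent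
   n + 1. *)
have yz1 : `|y - z| <= 1.
  by move: y01 z01; rewrite /I01/= !in_itv/= ler_norml; lra.
have pw : `|y - z| ^+ n.+1 <= `|y - z| ^+ m.+1.
  by apply: ler_wiXn2l => //; rewrite ltnS (leq_trans mn0).
case: side => [] [yl zl].
  apply: le_trans (H2 y z y01 z01 _ _); [|lra|lra].
  by apply: ler_pM; rewrite ?le_min ?(ltW c10) ?(ltW c20) ?exprn_ge0// ge_min lexx orbT.
apply: le_trans (H1 y z y01 z01 _ _); [|lra|lra].
by apply: ler_pM; rewrite ?le_min ?(ltW c10) ?(ltW c20) ?exprn_ge0// ge_min lexx.
Qed.

(* A pair s stands for the segment [s.1, s.2], which is empty when s.2 < s.1. *)
Definition growth_cover u (n : nat) c (S : seq (R * R)) :=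
  (forall s, s \in S -> forall y z, s.1 <= y <= s.2 -> s.1 <= z <= s.2 ->
    I01 y /\ c * `|y - z| ^+ n.+1 <= `|u y - u z|) /\
  (forall y, I01 y -> exists2 s, s \in S & s.1 <= y <= s.2).

Lemma growth_coverP u n0 n : shear_profile u n0 -> (n0 <= n)%N ->
  exists2 c : R, 0 < c & exists S, growth_cover u n c S.
Proof.
move=> hu n0n.
pose P (k : nat) (x : R) := exists p : R, forall y z, I01 y -> I01 z ->
  `|y - x| <= k.+1%:R^-1 -> `|z - x| <= k.+1%:R^-1 ->
  (y <= p /\ z <= p) \/ (p <= y /\ p <= z) ->
  k.+1%:R^-1 * `|y - z| ^+ n.+1 <= `|u y - u z|.
have [k _ Pk] : \forall k \near \oo, I01 `<=` P k.
  have /compact_near_coveringP H := @segment_compact R 0 1.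
  apply: H => x /= x01.
  have [c c0 [e e0 Hx]] := shear_profile_local hu n0n x01.
  have ce0 : 0 < Num.min (e / 2) c by rewrite lt_min c0 divr_gt0.
  near=> x' k => /=; exists x => y z y01 z01 yx zx side.
  have kce : k.+1%:R^-1 < Num.min (e / 2) c.
    by near: k; exact: near_infty_natSinv_lt (PosNum ce0).
  have x'x : `|x' - x| <= e / 2.
    near: x'; apply/nbhs_ballP; exists (e / 2) => /=; first by rewrite divr_gt0.
    by move=> w; rewrite /ball/= distrC => /ltW.
  move: kce; rewrite lt_min => /andP[ke kc].
  have tri w : `|w - x'| <= k.+1%:R^-1 -> `|w - x| <= e.
    move=> wx; have -> : w - x = (w - x') + (x' - x) by ring.
    by rewrite (le_trans (ler_normD _ _))// [e]splitr lerD// (le_trans wx)// ltW.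
  apply: le_trans (Hx y z y01 z01 (tri _ yx) (tri _ zx) side).
  by rewrite ler_wpM2r ?exprn_ge0// ltW.
have {}Pk := Pk k (leqnn k); pose h : R := k.+1%:R^-1.
have h0 : 0 < h by rewrite invr_gt0.
have /choice[p Hp] : forall x, exists p, I01 x -> forall y z, I01 y -> I01 z ->
    `|y - x| <= h -> `|z - x| <= h -> (y <= p /\ z <= p) \/ (p <= y /\ p <= z) ->
    h * `|y - z| ^+ n.+1 <= `|u y - u z|.
  move=> x; have [/Pk[p Hp]|nx] := pselect (I01 x); first by exists p.
  by exists 0 => /nx.
pose X (i : nat) : R := i%:R * h.
exists h => //.
(* Windows of half-width h around a grid of mesh h, cut at their breakpoints and clipped to [0, 1]:
   the first list has the left pieces, the second the right ones. *)
exists ([seq (Num.max 0 (X i - h), Num.min (p (X i)) (Num.min 1 (X i + h))) |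
          i <- iota 0 k.+2] ++
        [seq (Num.max (p (X i)) (Num.max 0 (X i - h)), Num.min 1 (X i + h)) |
          i <- iota 0 k.+2]).
have X01 i : (i < k.+2)%N -> I01 (X i).
  move=> ik; rewrite /I01/= in_itv/= /X mulr_ge0 ?(ltW h0)//= /h.
  by rewrite ler_pdivrMr// mul1r ler_nat.
split.
  move=> s; rewrite mem_cat => /orP[] /mapP[j]; rewrite mem_iota add0n => /= /X01 Xi -> y z;
    rewrite /= !(le_min, ge_max) => Y Z.
    have [y01 z01] : I01 y /\ I01 z by rewrite /I01/= !in_itv/=; lra.
    split => //; apply: (Hp _ Xi) => //; rewrite ?ler_norml; try lra.
  have [y01 z01] : I01 y /\ I01 z by rewrite /I01/= !in_itv/=; lra.
  split => //; apply: (Hp _ Xi) => //; rewrite ?ler_norml; try lra.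
move=> y y01; have y0 : 0 <= y <= 1 by move: y01; rewrite /I01/= in_itv.
pose i := Num.truncn (y * k.+1%:R).
have /andP[i1 i2] : i%:R <= y * k.+1%:R < i.+1%:R.
  by apply: truncn_itv; rewrite mulr_ge0//; lra.
have ik : (i < k.+2)%N.
  rewrite ltnS -(ler_nat R) (le_trans i1)// -[leRHS]mul1r ler_wpM2r//; lra.
have Xy : X i <= y by rewrite /X /h ler_pdivrMr.
have yX : y < X i + h by rewrite /X /h -[X in _ + X]mul1r -mulrDl natr1 ltr_pdivlMr.
have iS : i \in iota 0 k.+2 by rewrite mem_iota add0n.
have [yp|/ltW py] := leP y (p (X i)).
  exists (Num.max 0 (X i - h), Num.min (p (X i)) (Num.min 1 (X i + h))).
    by rewrite mem_cat; apply/orP; left; apply/mapP; exists i.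
  by rewrite /= !(le_min, ge_max); lra.
exists (Num.max (p (X i)) (Num.max 0 (X i - h)), Num.min 1 (X i + h)).
  by rewrite mem_cat; apply/orP; right; apply/mapP; exists i.
by rewrite /= !(le_min, ge_max); lra.
Unshelve. all: end_near. Qed.

End Profile.

Lemma sin_natpi2 {R : realType} (d : nat) (x : R) : sin (2 * pi * d%:R + x) = sin x.
Proof.
elim: d => [|d IH]; first by rewrite mulr0 add0r.
rewrite -[d.+1%:R]natr1 mulrDr mulr1 -addrA (addrC (2 * pi)) addrA.
by rewrite [X in _ + X]mulr_natl mulr2n addrA !sinDpi opprK.
Qed.

Lemma cos_natpi2 {R : realType} (d : nat) (x : R) : cos (2 * pi * d%:R + x) = cos x.
Proof.
elim: d => [|d IH]; first by rewrite mulr0 add0r.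
rewrite -[d.+1%:R]natr1 mulrDr mulr1 -addrA (addrC (2 * pi)) addrA.
by rewrite [X in _ + X]mulr_natl mulr2n addrA !cosDpi opprK.
Qed.

(** * Discrete Fourier transform *)

Section DFT.
Context {R : realType}.
Variable (M : nat).
Hypothesis M_gt0 : (0 < M)%N.

Definition freq (m : nat) : R := 2 * pi * m%:R / M%:R.

Let MR_neq0 : M%:R != 0 :> R. Proof. by rewrite pnatr_eq0 -lt0n. Qed.

(** Multiplied by sin (a / 2), both sums telescope over a whole number of periods. This factor is
    nonzero because 0 < d < M places a / 2 = pi d / M strictly between 0 and pi. *)
Lemma sum_cos_sin_freq (d : nat) : (0 < d < M)%N ->
  \sum_(m < M) cos (d%:R * freq m) = 0 /\ \sum_(m < M) sin (d%:R * freq m) = 0.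
Proof.
move=> /andP[d0 dM]; pose a : R := 2 * pi * d%:R / M%:R.
have E m : d%:R * freq m = m%:R * a by rewrite /freq /a; field.
have s0 : sin (a / 2) != 0.
  rewrite gt_eqF// sin_gt0_pi// /a.
  have M0 : 0 < M%:R :> R by rewrite ltr0n.
  rewrite (_ : _ / 2 = pi * (d%:R / M%:R)); last by field.
  rewrite mulr_gt0 ?pi_gt0 ?divr_gt0 ?ltr0n//=.
  by rewrite gtr_pMr ?pi_gt0// ltr_pdivrMr// mul1r ltr_nat.
have eM : M%:R * a - a / 2 = 2 * pi * d%:R + - (a / 2) by rewrite /a; field.
split; apply/eqP; rewrite -(mulrI_eq0 _ (mulfI s0)); apply/eqP.
- pose f (m : nat) := sin (m%:R * a - a / 2) / 2.
  rewrite mulr_sumr (eq_bigr (fun m : 'I_M => f m.+1 - f m)) => [|m _].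
    rewrite -(big_mkord xpredT (fun m => f m.+1 - f m)) telescope_sumr// /f.
    by rewrite eM sin_natpi2 mul0r add0r subrr.
  rewrite /f E -[m.+1%:R]natr1 (_ : (m%:R + 1) * a - a / 2 = m%:R * a + a / 2); last by field.
  by rewrite sinD sinB; field.
- pose f (m : nat) := - cos (m%:R * a - a / 2) / 2.
  rewrite mulr_sumr (eq_bigr (fun m : 'I_M => f m.+1 - f m)) => [|m _].
    rewrite -(big_mkord xpredT (fun m => f m.+1 - f m)) telescope_sumr// /f.
    by rewrite eM cos_natpi2 mul0r add0r subrr.
  rewrite /f E -[m.+1%:R]natr1 (_ : (m%:R + 1) * a - a / 2 = m%:R * a + a / 2); last by field.
  by rewrite cosD cosB; field.
Qed.

Lemma sum_cos_freqB (i l : 'I_M) :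
  \sum_(m < M) cos (i%:R * freq m - l%:R * freq m) = (i == l)%:R * M%:R.
Proof.
have [->|il] := eqVneq i l.
  under eq_bigr do rewrite subrr cos0.
  by rewrite sumr_const card_ord mul1r.
rewrite mul0r; wlog li : i l il / (l < i)%N.
  move=> H; have [/H->//|] := ltnP l i; rewrite leq_eqVlt => /predU1P[/val_inj /esym/eqP|li].
    by rewrite eq_sym (negPf il).
  rewrite -[RHS](H l i) 1?eq_sym//; apply: eq_bigr => m _.
  by rewrite -cosN opprB.
have [|/esym h _] := @sum_cos_sin_freq (i - l).
  by rewrite subn_gt0 li/= (leq_ltn_trans (leq_subr _ _)).
by rewrite [RHS]h; apply: eq_bigr => m _; rewrite natrB ?mulrBl// ltnW.
Qed.

Lemma sum_sin_freqB (i l : 'I_M) :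
  \sum_(m < M) sin (i%:R * freq m - l%:R * freq m) = 0.
Proof.
have [->|il] := eqVneq i l.
  by under eq_bigr do rewrite subrr sin0; rewrite big1.
wlog li : i l il / (l < i)%N.
  move=> H; have [/H->//|] := ltnP l i; rewrite leq_eqVlt => /predU1P[/val_inj /esym/eqP|li].
    by rewrite eq_sym (negPf il).
  apply/eqP; rewrite -oppr_eq0 -sumrN -[X in _ == X](H l i) 1?eq_sym//.
  by apply/eqP; apply: eq_bigr => m _; rewrite -sinN opprB.
have [|_ /esym h] := @sum_cos_sin_freq (i - l).
  by rewrite subn_gt0 li/= (leq_ltn_trans (leq_subr _ _)).
by rewrite [RHS]h; apply: eq_bigr => m _; rewrite natrB ?mulrBl// ltnW.
Qed.

(** With [dfti], the real and imaginary parts of the transform of p + i q with kernel exp(- i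
    theta). *)
Definition dftr (p q : nat -> R) (m : nat) : R :=
  \sum_(i < M) (p i * cos (i%:R * freq m) + q i * sin (i%:R * freq m)).
Definition dfti (p q : nat -> R) (m : nat) : R :=
  \sum_(i < M) (q i * cos (i%:R * freq m) - p i * sin (i%:R * freq m)).

Lemma dft_parseval p q :
  \sum_(m < M) (dftr p q m ^+ 2 + dfti p q m ^+ 2) =
  M%:R * \sum_(i < M) (p i ^+ 2 + q i ^+ 2).
Proof.
transitivity (\sum_(m < M) \sum_(i < M) \sum_(l < M)
   ((p i * p l + q i * q l) * cos (i%:R * freq m - l%:R * freq m)
   + (q i * p l - p i * q l) * sin (i%:R * freq m - l%:R * freq m))).
  apply: eq_bigr => m _; rewrite !expr2 /dftr /dfti !mulr_suml -big_split/=.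
  apply: eq_bigr => i _; rewrite !mulr_sumr -big_split/=.
  by apply: eq_bigr => l _; rewrite cosB sinB; ring.
rewrite exchange_big/= mulr_sumr; apply: eq_bigr => i _.
rewrite exchange_big/= (bigD1 i)//= [X in _ + X]big1 => [|l li].
  rewrite addr0 big_split/= -!mulr_sumr sum_cos_freqB sum_sin_freqB eqxx.
  by rewrite mul1r mulr0 addr0 mulrC !expr2.
rewrite big_split/= -!mulr_sumr sum_cos_freqB sum_sin_freqB.
by rewrite eq_sym (negPf li) mul0r !mulr0 addr0.
Qed.

End DFT.
Arguments freq {R}.

Section PeriodicShift.
Context {R : realType}.
Variable (M : nat).
Implicit Types p q : nat -> R.

(** Predecessor modulo [M.+1], so that backward differences are periodic. *)
Definition cpred (i : nat) : nat := if i is i'.+1 then i' else M.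

Lemma sum_cpred p q (f : nat -> R) : f M.+1 = f 0 ->
  \sum_(i < M.+1) p (cpred i) * f i = \sum_(i < M.+1) p i * f i.+1.
Proof.
move=> f0; rewrite big_ord_recl/= addrC [RHS]big_ord_recr/=.
by rewrite -f0.
Qed.

(** A cyclic shift multiplies the m-th coefficient by exp(- i t); periodicity enters because [M.+1]
    steps of angle t make m full turns. *)
Lemma dft_shift p q m :
  let t := freq M.+1 m in
  dftr M.+1 (p \o cpred) (q \o cpred) m =
    cos t * dftr M.+1 p q m + sin t * dfti M.+1 p q m /\
  dfti M.+1 (p \o cpred) (q \o cpred) m =
    cos t * dfti M.+1 p q m - sin t * dftr M.+1 p q m.
Proof.
move=> t.
have per : M.+1%:R * t = 2 * pi * m%:R + 0 :> R.
  by rewrite /t /freq addr0 mulrC divfK// pnatr_eq0.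
have eS (i : nat) : i.+1%:R * t = i%:R * t + t by rewrite -[i.+1%:R]natr1 mulrDl mul1r.
have C (p' : nat -> R) := @sum_cpred p' p' (fun i => cos (i%:R * t)).
have S (p' : nat -> R) := @sum_cpred p' p' (fun i => sin (i%:R * t)).
have c0 : cos (M.+1%:R * t) = cos (0%:R * t).
  by rewrite per cos_natpi2 mul0r.
have s0 : sin (M.+1%:R * t) = sin (0%:R * t).
  by rewrite per sin_natpi2 mul0r.
split; rewrite /dftr /dfti/= -/t ?sumrB !big_split/= ?sumrN ?C ?S//.
  rewrite -[X in cos t * X]big_split -sumrB -big_split/= !mulr_sumr -big_split/=.
  by apply: eq_bigr => i _; rewrite eS cosD sinD; ring.
rewrite -!sumrB -!big_split/= !mulr_sumr -sumrB.
by apply: eq_bigr => i _; rewrite eS cosD sinD; ring.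
Qed.

End PeriodicShift.

Section DFTLinear.
Context {R : realType}.
Variable (M : nat).

Lemma dftD (p q p' q' : nat -> R) m :
  dftr M (fun i => p i + p' i) (fun i => q i + q' i) m =
    dftr M p q m + dftr M p' q' m /\
  dfti M (fun i => p i + p' i) (fun i => q i + q' i) m =
    dfti M p q m + dfti M p' q' m.
Proof.
by split; rewrite /dftr /dfti -big_split/=; apply: eq_bigr => i _; ring.
Qed.

Lemma dftZ a (p q : nat -> R) m :
  dftr M (fun i => a * p i) (fun i => a * q i) m = a * dftr M p q m /\
  dfti M (fun i => a * p i) (fun i => a * q i) m = a * dfti M p q m.
Proof.
by split; rewrite /dftr /dfti mulr_sumr; apply: eq_bigr => i _; ring.
Qed.

Lemma dft_mul_i (p q : nat -> R) m :
  dftr M (fun i => - q i) p m = - dfti M p q m /\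
  dfti M (fun i => - q i) p m = dftr M p q m.
Proof.
split; rewrite /dftr /dfti -?sumrN; apply: eq_bigr => i _; ring.
Qed.

Lemma dft_sum (J : finType) (c : J -> R) (p q : J -> nat -> R) m :
  dftr M (fun i => \sum_j c j * p j i) (fun i => \sum_j c j * q j i) m =
    \sum_j c j * dftr M (p j) (q j) m /\
  dfti M (fun i => \sum_j c j * p j i) (fun i => \sum_j c j * q j i) m =
    \sum_j c j * dfti M (p j) (q j) m.
Proof.
split; under [RHS]eq_bigr do rewrite mulr_sumr; rewrite exchange_big/=;
  apply: eq_bigr => i _; rewrite !mulr_suml -?big_split -?sumrB/=;
  apply: eq_bigr => j _; ring.
Qed.
End DFTLinear.

Section DiscreteResolvent.
Context {R : realType} (J : finType).
Variables (b : J -> R) (U : J -> J -> R) (Psi : R).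

(* Real and imaginary parts of (b + i U)(p + i q). *)
Definition galr (p q : J -> R) j : R := b j * p j - \sum_l U j l * q l.
Definition gali (p q : J -> R) j : R := b j * q j + \sum_l U j l * p l.

(** A lower bound for the squared norm of (b + i U + mu + i lam)(p + i q), so [Psi] is the square of
    the usual resolvent constant. Uniformity in [lam] is what the Plancherel argument in time
    consumes. *)
Definition resolvent_bound := forall (mu lam : R) (p q : J -> R), 0 <= mu ->
  Psi * \sum_j (p j ^+ 2 + q j ^+ 2) <=
  \sum_j ((galr p q j + mu * p j - lam * q j) ^+ 2 +
          (gali p q j + mu * q j + lam * p j) ^+ 2).

(* The backward difference with step tau acts on the m-th discrete Fourier
   coefficient as (1 - cos x + i sin x) / tau with x = 2 pi m / (M + 1): its real
   part is nonnegative, so the resolvent bound applies to each coefficient. *)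
Lemma discrete_resolvent (M : nat) (tau : R) (p q : J -> nat -> R) :
  0 < tau -> resolvent_bound ->
  Psi * \sum_(i < M.+1) \sum_j (p j i ^+ 2 + q j i ^+ 2) <=
  \sum_(i < M.+1) \sum_j
    (((p j i - p j (cpred M i)) / tau + galr (p^~ i) (q^~ i) j) ^+ 2 +
     ((q j i - q j (cpred M i)) / tau + gali (p^~ i) (q^~ i) j) ^+ 2).
Proof.
move=> tau0 H.
pose F j (i : nat) := (p j i - p j (cpred M i)) / tau + galr (p^~ i) (q^~ i) j.
pose G j (i : nat) := (q j i - q j (cpred M i)) / tau + gali (p^~ i) (q^~ i) j.
have M0 : (0 < M.+1)%N by [].
have P (f g : J -> nat -> R) :
    M.+1%:R * \sum_(i < M.+1) \sum_j (f j i ^+ 2 + g j i ^+ 2) =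
    \sum_(m < M.+1) \sum_j (dftr M.+1 (f j) (g j) m ^+ 2 +
                            dfti M.+1 (f j) (g j) m ^+ 2).
  rewrite exchange_big [RHS]exchange_big/= mulr_sumr.
  by apply: eq_bigr => j _; rewrite dft_parseval.
rewrite -(ler_pM2l (ltr0Sn R M)) mulrCA P (P F G) mulr_sumr.
apply: ler_sum => m _.
pose t : R := freq M.+1 m.
have /H : 0 <= (1 - cos t) / tau by rewrite divr_ge0 ?subr_ge0 ?cos_le1 ?(ltW tau0).
move=> /(_ (sin t / tau) (fun j => dftr M.+1 (p j) (q j) m)
  (fun j => dfti M.+1 (p j) (q j) m)).
move=> /le_trans; apply.
rewrite le_eqVlt; apply/orP; left; apply/eqP; apply: eq_bigr => j _.
have E1 : F j = fun i => (tau^-1 * p j i + (- tau^-1) * (p j \o cpred M) i) +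
    (b j * p j i + \sum_l U j l * (- q l i)).
  apply: funext => i; rewrite /F /galr/= -sumrN.
  rewrite mulrBl [_ / tau]mulrC [p j (cpred M i) / tau]mulrC mulNr.
  by congr (_ + (_ + _)); apply: eq_bigr => l _; rewrite mulrN.
have E2 : G j = fun i => (tau^-1 * q j i + (- tau^-1) * (q j \o cpred M) i) +
    (b j * q j i + \sum_l U j l * p l i).
  apply: funext => i; rewrite /G /gali/=.
  by rewrite mulrBl [_ / tau]mulrC [q j (cpred M i) / tau]mulrC mulNr.
rewrite E1 E2.
have [-> ->] := dftD M.+1 (fun i => tau^-1 * p j i + (- tau^-1) * (p j \o cpred M) i)
   (fun i => tau^-1 * q j i + (- tau^-1) * (q j \o cpred M) i)
   (fun i => b j * p j i + \sum_l U j l * (- q l i))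
   (fun i => b j * q j i + \sum_l U j l * p l i) m.
have [-> ->] := dftD M.+1 (fun i => tau^-1 * p j i)
   (fun i => tau^-1 * q j i) (fun i => (- tau^-1) * (p j \o cpred M) i)
   (fun i => (- tau^-1) * (q j \o cpred M) i) m.
have [-> ->] := dftD M.+1 (fun i => b j * p j i)
   (fun i => b j * q j i) (fun i => \sum_l U j l * (- q l i))
   (fun i => \sum_l U j l * p l i) m.
have [-> ->] := dft_sum M.+1 (U j) (fun l i => - q l i) p m.
rewrite !(fun a p q => (dftZ M.+1 a p q m).1) !(fun a p q => (dftZ M.+1 a p q m).2).
have [-> ->] := dft_shift M (p j) (q j) m.
rewrite /galr /gali -/t.
under [X in _ = (_ + (_ + X)) ^+ 2 + _]eq_bigr => l _.
  rewrite (dft_mul_i M.+1 (p l) (q l) m).1 mulrN; over.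
under [X in _ = _ + (_ + (_ + X)) ^+ 2]eq_bigr => l _.
  rewrite (dft_mul_i M.+1 (p l) (q l) m).2; over.
rewrite sumrN; congr (_ ^+ 2 + _ ^+ 2); field; lra.
Qed.
End DiscreteResolvent.

(** * Cosine expansions on [0, 1] *)

Section CosineBasis.
Context {R : realType}.
Implicit Types (f g : R -> R) (i j : nat) (y : R).

Definition ip1 f g : R := ip (@lebesgue_measure R) I01 f g.

Lemma measurable_I01 : measurable (@I01 R : set (measurableTypeR R)).
Proof. exact: measurable_itv. Qed.
Hint Resolve measurable_I01 : core.

Lemma cts_sqi f : continuous f -> sqi (@lebesgue_measure R) I01 f.
Proof.
move=> cf; split; first exact: cts_measurable.
by apply: cts_integrable; exact: ctsX.
Qed.

Lemma ip1_FTC f f' : (forall y, is_derive y 1 f (f' y)) -> continuous f' ->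
  ip1 f' (fun=> 1) = f 1 - f 0.
Proof.
move=> df cf'; rewrite /ip1 /ip -(FTC2 ler01 df cf').
by apply: eq_Rintegral => x _; rewrite mulr1.
Qed.

Lemma ip1_one f g : ip1 f g = ip1 (fun y => f y * g y) (fun=> 1).
Proof. by apply: eq_Rintegral => x _; rewrite mulr1. Qed.

Lemma le_ip1 f g (h k : R -> R) : continuous f -> continuous g -> continuous h -> continuous k ->
  (forall y, 0 <= y <= 1 -> f y * g y <= h y * k y) -> ip1 f g <= ip1 h k.
Proof.
move=> cf cg ch ck H; apply: le_Rintegral => //.
- by apply: sqi_mul => //; exact: cts_sqi.
- by apply: sqi_mul => //; exact: cts_sqi.
Qed.

Lemma ip1_swap f g (h k : R -> R) : (forall y, f y * g y = h y * k y) ->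
  ip1 f g = ip1 h k.
Proof. by move=> H; apply: eq_Rintegral => y _; rewrite H. Qed.

Lemma ip1C f g : ip1 f g = ip1 g f.
Proof. exact: ipC. Qed.

Lemma ip1Dl f g (h : R -> R) : continuous f -> continuous g -> continuous h ->
  ip1 (fun y => f y + g y) h = ip1 f h + ip1 g h.
Proof. by move=> *; apply: ipDl => //; exact: cts_sqi. Qed.

Lemma ip1Bl f g (h : R -> R) : continuous f -> continuous g -> continuous h ->
  ip1 (fun y => f y - g y) h = ip1 f h - ip1 g h.
Proof. by move=> *; apply: ipBl => //; exact: cts_sqi. Qed.

Lemma ip1Zl a f g : continuous f -> continuous g ->
  ip1 (fun y => a * f y) g = a * ip1 f g.
Proof. by move=> *; apply: ipZl => //; exact: cts_sqi. Qed.

Lemma ip1Nl f g : continuous f -> continuous g ->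
  ip1 (fun y => - f y) g = - ip1 f g.
Proof. by move=> *; apply: ipNl => //; exact: cts_sqi. Qed.

Lemma ip1_sum (I : finType) (a : I -> R) (F : I -> R -> R) (f : R -> R) :
  (forall i : I, continuous (F i)) -> continuous f ->
  ip1 f (fun y => \sum_(i : I) a i * F i y) = \sum_(i : I) a i * ip1 f (F i).
Proof. by move=> cF cf; apply: ip_lincomb => // [i|]; exact: cts_sqi. Qed.

(** Normalisation of the Neumann eigenfunctions of - d^2/dy^2 on [0, 1]; the square of [wav j] is
    the eigenvalue, and [sinb] are the normalised derivatives up to sign. *)
Definition cosw j : R := if j is 0 then 1 else Num.sqrt 2.
Definition wav j : R := j%:R * pi.
Definition cosb j y : R := cosw j * cos (wav j * y).
Definition sinb j y : R := Num.sqrt 2 * sin (wav j * y).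

Lemma wav_ge0 j : 0 <= wav j.
Proof. by rewrite mulr_ge0// pi_ge0. Qed.

Lemma der_cos_lin (k x : R) : is_derive x 1 (fun y => cos (k * y)) (- (k * sin (k * x))).
Proof.
apply: (is_derive_eq (der_comp (is_derive_cos _) (derZ k (der_id x)))).
by ring.
Qed.

Lemma der_sin_lin (k x : R) : is_derive x 1 (fun y => sin (k * y)) (k * cos (k * x)).
Proof.
apply: (is_derive_eq (der_comp (is_derive_sin _) (derZ k (der_id x)))).
by ring.
Qed.

Lemma cts_cos_lin (k : R) : continuous (fun y => cos (k * y)).
Proof. exact: (der_continuous (@der_cos_lin k)). Qed.

Lemma cts_sin_lin (k : R) : continuous (fun y => sin (k * y)).
Proof. exact: (der_continuous (@der_sin_lin k)). Qed.

Lemma der_cosb j y : is_derive y 1 (cosb j) (- (wav j * sinb j y)).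
Proof.
apply: (is_derive_eq (derZ _ (der_cos_lin _ _))); rewrite /sinb /cosw.
by case: j => [|j]; [rewrite /wav !mul0r; ring|ring].
Qed.

Lemma der_sinb j y : is_derive y 1 (sinb j) (wav j * cosb j y).
Proof.
apply: (is_derive_eq (derZ _ (der_sin_lin _ _))); rewrite /cosb /cosw.
by case: j => [|j]; [rewrite /wav !mul0r; ring|ring].
Qed.

Lemma cts_cosb j : continuous (cosb j).
Proof. exact: (der_continuous (der_cosb j)). Qed.

Lemma cts_sinb j : continuous (sinb j).
Proof. exact: (der_continuous (der_sinb j)). Qed.

Lemma sin_wav j : sin (wav j) = 0.
Proof.
rewrite /wav; elim: j => [|j IH]; first by rewrite mul0r sin0.
by rewrite -[j.+1%:R]natr1 mulrDl mul1r sinDpi IH oppr0.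
Qed.

Lemma sinb0 j : sinb j 0 = 0.
Proof. by rewrite /sinb mulr0 sin0 mulr0. Qed.

Lemma sinb1 j : sinb j 1 = 0.
Proof. by rewrite /sinb mulr1 sin_wav mulr0. Qed.

Lemma ip1_cos j : ip1 (fun y => cos (wav j * y)) (fun=> 1) = (j == 0)%:R.
Proof.
case: j => [|j].
  have d0 y : is_derive y 1 (fun y => y) (cos (wav 0 * y)).
    by rewrite /wav !mul0r cos0; exact: der_id.
  by rewrite (ip1_FTC d0) ?subr0//; exact: cts_cos_lin.
have w0 : wav j.+1 != 0 by rewrite mulf_neq0// gt_eqF// pi_gt0.
have dj y : is_derive y 1 (fun y => (wav j.+1)^-1 * sin (wav j.+1 * y))
    (cos (wav j.+1 * y)).
  by apply: (is_derive_eq (derZ _ (der_sin_lin _ _))); rewrite mulKf.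
rewrite (ip1_FTC dj); last exact: cts_cos_lin.
by rewrite mulr1 sin_wav !mulr0 sin0 mulr0 subr0.
Qed.

Lemma ip1_cos_cos i j : ip1 (fun y => cos (wav i * y)) (fun y => cos (wav j * y)) =
  ((i == j)%:R + (i + j == 0)%N%:R) / 2.
Proof.
wlog ji : i j / (j <= i)%N.
  move=> H; have [/H//|/ltnW/H E] := leqP j i.
  by rewrite /ip1 ipC -/(ip1 _ _) E eq_sym addnC.
have -> : (i == j) = (i - j == 0)%N by rewrite subn_eq0 eqn_leq ji andbT.
rewrite -!ip1_cos -/(ip1 _ _) ip1_one.
rewrite -ipDl//; try by apply: cts_sqi; first [exact: cts_cos_lin|exact: cts_cst].
rewrite mulrC -ipZl//; try by apply: cts_sqi; first [exact: cts_cst|apply: ctsD; exact: cts_cos_lin].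
apply: eq_ip => // y _; rewrite /wav natrB// natrD !mulrDl !mulNr cosB cosD.
by field.
Qed.

Lemma ip1_sin_sin i j : ip1 (fun y => sin (wav i * y)) (fun y => sin (wav j * y)) =
  ((i == j)%:R - (i + j == 0)%N%:R) / 2.
Proof.
wlog ji : i j / (j <= i)%N.
  move=> H; have [/H//|/ltnW/H E] := leqP j i.
  by rewrite /ip1 ipC -/(ip1 _ _) E eq_sym addnC.
have -> : (i == j) = (i - j == 0)%N by rewrite subn_eq0 eqn_leq ji andbT.
rewrite -!ip1_cos -/(ip1 _ _) ip1_one.
rewrite -ipBl//; try by apply: cts_sqi; first [exact: cts_cos_lin|exact: cts_cst].
rewrite mulrC -ipZl//; try by apply: cts_sqi; first [exact: cts_cst|apply: ctsB; exact: cts_cos_lin].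
apply: eq_ip => // y _; rewrite /wav natrB// natrD !mulrDl !mulNr cosB cosD.
by field.
Qed.

Let sqr2 : Num.sqrt 2 * Num.sqrt 2 = 2 :> R.
Proof. by rewrite -expr2 sqr_sqrtr. Qed.

Lemma cosb_orthonormal i j : ip1 (cosb i) (cosb j) = (i == j)%:R.
Proof.
have sc k : sqi (@lebesgue_measure R) I01 (fun y => cos (wav k * y)).
  by apply: cts_sqi; exact: cts_cos_lin.
rewrite /ip1 /cosb ipZl//; last exact: sqiZ.
rewrite ipZr// -/(ip1 _ _) ip1_cos_cos /cosw.
case: i j => [|i] [|j]; rewrite ?addn0 ?addr0 ?mul0r ?mulr0 //=; first by field.
have [ij|ij] := eqVneq i.+1 j.+1; last by rewrite mul0r !mulr0.
by rewrite mulrA sqr2; field.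
Qed.

Lemma sinb_orthonormal i j : ip1 (sinb i) (sinb j) = ((i == j) && (0 < i)%N)%:R.
Proof.
have sc k : sqi (@lebesgue_measure R) I01 (fun y => sin (wav k * y)).
  by apply: cts_sqi; exact: cts_sin_lin.
rewrite /ip1 /sinb ipZl//; last exact: sqiZ.
rewrite ipZr// -/(ip1 _ _) ip1_sin_sin mulrA sqr2 addn_eq0.
case: i => [|i]; rewrite ?andbT ?andbF /=; last by rewrite subr0; field.
by rewrite eq_sym subrr; field.
Qed.

Lemma ip1_IBP f f' g g' : (forall y, is_derive y 1 f (f' y)) ->
  (forall y, is_derive y 1 g (g' y)) -> continuous f' -> continuous g' ->
  ip1 f' g = f 1 * g 1 - f 0 * g 0 - ip1 f g'.
Proof.
move=> df dg cf' cg'.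
have cf := der_continuous df; have cg := der_continuous dg.
rewrite -(ip1_FTC (fun y => derM (df y) (dg y))); last first.
  by apply: ctsD; apply: ctsM.
rewrite [ip1 f' g]ip1_one [ip1 f g']ip1_one.
rewrite /ip1 ipDl ?addrK//; apply: cts_sqi; try exact: cts_cst; exact: ctsM.
Qed.

Section CosPoly.
Variables (J : nat) (p : 'I_J -> R).
Definition cosp y := \sum_j p j * cosb j y.
Definition dcosp y := \sum_(j < J) (- (wav j * p j)) * sinb j y.
Definition ddcosp y := \sum_(j < J) (- (wav j ^+ 2 * p j)) * cosb j y.

Lemma der_cosp y : is_derive y 1 cosp (dcosp y).
Proof.
apply: der_sum => j; apply: (is_derive_eq (derZ _ (der_cosb _ _))).
by ring.
Qed.

Lemma der_dcosp y : is_derive y 1 dcosp (ddcosp y).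
Proof.
apply: der_sum => j; apply: (is_derive_eq (derZ _ (der_sinb _ _))).
by ring.
Qed.

Lemma cts_cosp : continuous cosp.
Proof. exact: der_continuous der_cosp. Qed.
Lemma cts_dcosp : continuous dcosp.
Proof. exact: der_continuous der_dcosp. Qed.
Lemma cts_ddcosp : continuous ddcosp.
Proof. by apply: cts_sum => j; apply: ctsZ; exact: cts_cosb. Qed.

Lemma dcosp0 : dcosp 0 = 0.
Proof. by apply: big1 => j _; rewrite sinb0 mulr0. Qed.
Lemma dcosp1 : dcosp 1 = 0.
Proof. by apply: big1 => j _; rewrite sinb1 mulr0. Qed.

Lemma ip1_cosp f : continuous f -> ip1 cosp f = \sum_j p j * ip1 f (cosb j).
Proof.
move=> cf; rewrite /ip1 ipC ip_lincomb//; first by move=> j; apply: cts_sqi; exact: cts_cosb.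
exact: cts_sqi.
Qed.

Lemma ip1_cospb (j : 'I_J) : ip1 cosp (cosb j) = p j.
Proof.
rewrite ip1_cosp; last exact: cts_cosb.
rewrite (bigD1 j)//= cosb_orthonormal eqxx mulr1 big1 ?addr0// => i ij.
by rewrite cosb_orthonormal eq_sym (negPf (_ : i != j :> nat)) ?mulr0.
Qed.

Lemma ip1_cosp_sqr : ip1 cosp cosp = \sum_j p j ^+ 2.
Proof.
rewrite ip1_cosp; last exact: cts_cosp.
by apply: eq_bigr => j _; rewrite ip1_cospb expr2.
Qed.

Lemma ip1_dcosp_sqr : ip1 dcosp dcosp = \sum_(j < J) (wav j * p j) ^+ 2.
Proof.
rewrite /ip1 (@ip_lincomb2 _ _ _ _ _ _ _ (fun j : 'I_J => (0 < j)%N))//.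
- rewrite [LHS]big_mkcond; apply: eq_bigr => j _; case: ifPn => [_|]; first by ring.
  by rewrite lt0n negbK => /eqP ->; rewrite /wav !mul0r expr0n.
- by move=> j; apply: cts_sqi; exact: cts_sinb.
- by move=> i j; have := sinb_orthonormal i j.
Qed.

End CosPoly.

(** Integration by parts puts a factor [sinb j] in the boundary terms, and it vanishes at 0 and 1:
    decay of cosine coefficients thus holds for every C^1 function. *)
Lemma ip1_cosb_der f f' j : (forall y, is_derive y 1 f (f' y)) -> continuous f' ->
  wav j * ip1 f (cosb j) = - ip1 f' (sinb j).
Proof.
move=> df cf'; have cf := der_continuous df.
have := ip1_IBP (der_sinb j) df (ctsZ (@cts_cosb j)) cf'.
rewrite sinb0 sinb1 !mul0r subr0 add0r /ip1 ipZl//; try exact: cts_sqi; last first.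
  by apply: cts_sqi; exact: cts_cosb.
by rewrite ipC => ->; rewrite ipC.
Qed.

Lemma bessel_cosb (J : nat) f : sqi (@lebesgue_measure R) I01 f ->
  \sum_(j < J) ip1 f (cosb j) ^+ 2 <= ip1 f f.
Proof.
move=> sf; apply: (@bessel _ _ _ _ _ _ _ xpredT) => //.
- by move=> j; apply: cts_sqi; exact: cts_cosb.
- by move=> i j; rewrite andbT; exact: cosb_orthonormal.
Qed.

Lemma bessel_sinb (J : nat) f : sqi (@lebesgue_measure R) I01 f ->
  \sum_(j < J) ip1 f (sinb j) ^+ 2 <= ip1 f f.
Proof.
move=> sf; apply: (@bessel _ _ _ _ _ _ _ (fun j : 'I_J => (0 < j)%N)) => //.
- by move=> j; apply: cts_sqi; exact: cts_sinb.
- by move=> i j; exact: sinb_orthonormal.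
Qed.

(** At a minimum point z of f^2 the value is at most the mean of f^2; from z to y, f^2 changes by
    the integral of 2 f f', which Cauchy-Schwarz bounds. *)
Lemma sup_bound f f' y : (forall y, is_derive y 1 f (f' y)) -> continuous f' ->
  0 <= y <= 1 -> f y ^+ 2 <= ip1 f f + 2 * Num.sqrt (ip1 f f) * Num.sqrt (ip1 f' f').
Proof.
move=> df cf' y01; have cf := der_continuous df.
have [z] := @EVT_min R (fun z => f z ^+ 2) 0 1 ler01
  (continuous_subspaceT (ctsX (n := 2) cf)).
rewrite in_itv/= => z01 zmin.
have fz : f z ^+ 2 <= ip1 f f.
  have -> : f z ^+ 2 = ip1 (fun=> f z) (fun=> f z).
    rewrite /ip1 /ip Rintegral_cst//= /I01 lebesgue_measure_itv/= lte_fin ltr01.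
    by rewrite sube0/= mulr1 expr2.
  apply: le_ip1 => //; try exact: cts_cst.
pose h x := 2 * (f x * f' x).
have ch : continuous h by apply: ctsZ; apply: ctsM.
have dh (x : R) : is_derive x 1 (fun x => f x ^+ 2) (h x).
  by apply: (is_derive_eq (derX 1 (df x))); rewrite /h expr1 mulrA.
have key (s t : R) : 0 <= s -> s <= t -> t <= 1 -> `|f t ^+ 2 - f s ^+ 2| <=
    2 * Num.sqrt (ip1 f f) * Num.sqrt (ip1 f' f').
  move=> s0 st t1; rewrite -(FTC2 st dh ch).
  have ih := @cts_integrable _ h _ _ ch.
  apply: (le_trans (le_normr_Rintegral _ (ih s t))) => //.
  have sub : `[s, t] `<=` (@I01 R).
    move=> x; rewrite /I01/= !in_itv/= => /andP[sx xt].
    by rewrite (le_trans s0 sx) (le_trans xt t1).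
  have cnh : continuous (fun x => `|h x|).
    by move=> x; apply: (cvg_comp _ _ (ch x)); exact: norm_continuous.
  have -> : \int[lebesgue_measure]_(x in `[s, t]) `|h x| =
      fine (\int[lebesgue_measure]_(x in `[s, t]) (`|h x|)%:E) by [].
  apply: (@le_trans _ _ (\int[lebesgue_measure]_(x in I01) `|h x|)).
    apply: fine_le.
    - by apply: integrable_fin_num => //; exact: cts_integrable.
    - by apply: integrable_fin_num => //; exact: cts_integrable.
    apply: ge0_subset_integral => //.
    by apply/measurable_EFinP; exact: cts_measurable.
  have nn g : continuous g -> ip1 (fun x => `|g x|) (fun x => `|g x|) = ip1 g g.
    move=> _; apply: eq_Rintegral => x _.
    by rewrite -normrM ger0_norm// -expr2 sqr_ge0.
  have cn (g : R -> R) : continuous g -> continuous (fun x => `|g x|).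
    by move=> cg x; apply: (cvg_comp _ _ (cg x)); exact: norm_continuous.
  have -> : \int[lebesgue_measure]_(x in I01) `|h x| =
      2 * ip1 (fun x => `|f x|) (fun x => `|f' x|).
    rewrite /ip1 -ipZl//; try by apply: cts_sqi; exact: cn.
    by apply: eq_Rintegral => x _; rewrite /h normrM normrM mulrA ger0_norm.
  rewrite -mulrA ler_wpM2l// -(nn f)// -(nn f')//.
  apply: le_trans (ler_norm _) _.
  by apply: ip_CSn => //; apply: cts_sqi; exact: cn.
have zy : `|f y ^+ 2 - f z ^+ 2| <= 2 * Num.sqrt (ip1 f f) * Num.sqrt (ip1 f' f').
  have [zy|/ltW yz] := leP z y; first by apply: key => //; lra.
  by rewrite distrC; apply: key => //; lra.
by move: zy fz; rewrite ler_norml; lra.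
Qed.

End CosineBasis.

(** * The multiplier *)

Section Multiplier.
Context {R : realType}.
Implicit Types (r y z t : R) (Z : seq R).

(** Used with [g] a cut-off vanishing to second order where the sign factor in [f] jumps. *)
Lemma der_squeeze0 (f g : R -> R) y : is_derive y 1 g 0 ->
  (forall s, `|f s - f y| <= `|g s - g y|) -> is_derive y 1 f 0.
Proof.
move=> dg fg; have /cvg_ex[l gl] : derivable g y 1 by exact: ex_derive.
have l0 : l = 0.
  by rewrite -(cvg_lim _ gl)//; exact: (@derive_val _ _ _ _ _ _ _ dg).
have fl : h^-1 *: (f (h *: 1 + y) - f y) @[h --> 0^'] --> (0 : R).
  move: gl; rewrite l0 => /cvgrPdist_le gl; apply/cvgrPdist_le => e /gl.
  apply: filterS => h; rewrite !sub0r !normrN /GRing.scale/= !normrM.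
  by apply: le_trans; rewrite ler_wpM2l.
by split; [apply/cvg_ex; exists 0|exact/cvg_lim].
Qed.

(** The rational function t^2 / (1 + t^2): it vanishes to second order at 0, is at least 1/2 for |t|
    >= 1, and its derivative is bounded by 1, which is all that the cut-off must provide. *)
Definition bump t : R := 1 - (1 + t ^+ 2)^-1.
Definition dbump t : R := 2 * t * ((1 + t ^+ 2)^-1) ^+ 2.

Let den t : 1 <= 1 + t ^+ 2. Proof. by rewrite lerDl sqr_ge0. Qed.
Let den0 t : 0 < 1 + t ^+ 2. Proof. exact: lt_le_trans (den t). Qed.

Lemma der_inv1sqr t : is_derive t 1 (fun t => (1 + t ^+ 2)^-1) (- dbump t).
Proof.
have d : is_derive t 1 (fun t => 1 + t ^+ 2) (2 * t).
  by apply: (is_derive_eq (derD (der_cst _ _) (derX 1 (der_id t)))); ring.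
have n0 : 1 + t ^+ 2 != 0 by rewrite gt_eqF.
apply: (is_derive_eq (@is_deriveV _ (fun t => 1 + t ^+ 2) t (2 * t) 1 n0 d)); rewrite /dbump /GRing.scale/=.
by rewrite exprVn; ring.
Qed.

Lemma der_bump t : is_derive t 1 bump (dbump t).
Proof.
by apply: (is_derive_eq (derB (der_cst _ _) (der_inv1sqr t))); rewrite sub0r opprK.
Qed.

Lemma cts_dbump : continuous dbump.
Proof.
apply: ctsM; first by apply: ctsZ => t; exact: cvg_id.
by apply: ctsX; exact: (der_continuous der_inv1sqr).
Qed.

Lemma bump_itv t : 0 <= bump t <= 1.
Proof.
rewrite /bump subr_ge0 invf_le1// den/= gerBl invr_ge0 ltW//.
Qed.

Lemma bump_far t : 1 <= `|t| -> 2^-1 <= bump t.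
Proof.
move=> t1; have : 2 <= 1 + t ^+ 2.
  rewrite -(real_normK (num_real t)); have := t1; nra.
move=> h; have : (1 + t ^+ 2)^-1 <= 2^-1 by rewrite lef_pV2 ?posrE.
by rewrite /bump; lra.
Qed.

Lemma dbump_le1 t : `|dbump t| <= 1.
Proof.
rewrite /dbump exprVn normrM normfV (ger0_norm (exprn_ge0 _ (ltW (den0 t)))).
rewrite ler_pdivrMr ?exprn_gt0// mul1r normrM (ger0_norm (ler0n _ 2)).
rewrite -(real_normK (num_real t)).
have := sqr_ge0 (`|t| - 1); have := sqr_ge0 (`|t| ^+ 2); have := normr_ge0 t; nra.
Qed.

Fixpoint cut r Z y : R := if Z is z :: Z' then bump ((y - z) / r) * cut r Z' y else 1.
Fixpoint dcut r Z y : R := if Z is z :: Z' then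
  dbump ((y - z) / r) / r * cut r Z' y + bump ((y - z) / r) * dcut r Z' y else 0.

Lemma der_cut r Z y : is_derive y 1 (cut r Z) (dcut r Z y).
Proof.
elim: Z => [|z Z IH] /=; first exact: der_cst.
apply: derM => //; apply: der_comp; first exact: der_bump.
under [X in is_derive _ _ X _]eq_fun do rewrite mulrC.
apply: (is_derive_eq (derZ _ (derB (der_id y) (der_cst y z)))).
by rewrite subr0 mulr1.
Qed.

Lemma cts_cut r Z : continuous (cut r Z).
Proof. exact: (der_continuous (der_cut r Z)). Qed.

Lemma cts_dcut r Z : continuous (dcut r Z).
Proof.
have cl z : continuous (fun y => (y - z) / r).
  apply: ctsM; last exact: cts_cst.
  by apply: ctsB; [move=> ?; exact: cvg_id|exact: cts_cst].
elim: Z => [|z Z IH] /=; first exact: cts_cst.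
apply: ctsD; apply: ctsM => //; [|exact: cts_cut|].
  apply: ctsM; last exact: cts_cst.
  by apply: (cts_comp cts_dbump); exact: cl.
by apply: (cts_comp (der_continuous der_bump)); exact: cl.
Qed.

Lemma cut_itv r Z y : 0 <= cut r Z y <= 1.
Proof.
elim: Z => [|z Z] /=; first by rewrite ler01 lexx.
have := bump_itv ((y - z) / r); move: (bump _) (cut _ _ _) => a b; nra.
Qed.

Lemma dcut_le r Z y : 0 < r -> `|dcut r Z y| <= (size Z)%:R / r.
Proof.
move=> r0; elim: Z => [|z Z IH] /=; first by rewrite normr0 mul0r.
rewrite -[(size Z).+1%:R]natr1 [leRHS]mulrDl (le_trans (ler_normD _ _))//.
rewrite addrC lerD//.
  rewrite normrM (le_trans _ IH)// ler_piMl//.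
  by have := bump_itv ((y - z) / r); rewrite ler_norml; lra.
rewrite normrM normrM normfV (gtr0_norm r0) mul1r mulrAC ler_piMl ?invr_ge0 ?(ltW r0)//.
rewrite mulr_ile1// ?dbump_le1//.
by have := cut_itv r Z y; rewrite ler_norml; lra.
Qed.

Lemma cut_root r Z y : y \in Z -> cut r Z y = 0 /\ dcut r Z y = 0.
Proof.
elim: Z => //= z Z IH; rewrite in_cons => /predU1P[->|/IH[-> ->]]; last first.
  by rewrite !mulr0 addr0.
by rewrite subrr mul0r /bump /dbump expr0n/= addr0 invr1 subrr !mulr0 !mul0r addr0.
Qed.

Lemma cut_far r Z y : 0 < r -> (forall z, z \in Z -> r <= `|y - z|) ->
  2^-1 ^+ size Z <= cut r Z y.
Proof.
move=> r0; elim: Z => [|z Z IH] H /=; first by rewrite expr0.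
rewrite exprS; apply: ler_pM; rewrite ?exprn_ge0 ?invr_ge0//.
  rewrite bump_far// normrM normfV (gtr0_norm r0) ler_pdivlMr// mul1r.
  by apply: H; rewrite in_cons eqxx.
by apply: IH => z' z'Z; apply: H; rewrite in_cons z'Z orbT.
Qed.

Section SignCut.
Variables (w : R -> R) (r : R) (Z : seq R).
Hypothesis cw : continuous w.
Hypothesis w0 : forall y, w y = 0 -> y \in Z \/ \forall y' \near y, w y' = 0.

(* The sign of w is smoothed by a factor vanishing to second order at the points
   of Z: it is C^1 provided that w changes sign only there. *)
Definition scut y : R := Num.sg (w y) * cut r Z y.
Definition dscut y : R := Num.sg (w y) * dcut r Z y.

Lemma scut_cases y : (cut r Z y = 0 /\ dcut r Z y = 0) \/
  (\forall y' \near y, Num.sg (w y') = Num.sg (w y)).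
Proof.
have [wy|wy|wy] := ltgtP (w y) 0.
- right; have h : nbhs y (fun y' => w y' < 0) := @cw y _ (lt_nbhsl wy).
  by apply: filterS h => y' /= wy'; rewrite !ltr0_sg.
- right; have h : nbhs y (fun y' => 0 < w y') := @cw y _ (lt_nbhsr wy).
  by apply: filterS h => y' /= wy'; rewrite !gtr0_sg.
- have [yZ|Hy] := w0 wy; first by left; exact: cut_root.
  by right; apply: filterS Hy => y' ->; rewrite wy.
Qed.

Lemma sg_norm_le1 (x : R) : `|Num.sg x| <= 1.
Proof. by rewrite normr_sg; case: (x == 0). Qed.

Lemma der_scut y : is_derive y 1 scut (dscut y).
Proof.
have [[c0 d0]|near_sg] := scut_cases y.
  rewrite /dscut d0 mulr0; apply: (@der_squeeze0 _ (cut r Z)).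
    by rewrite -d0; exact: der_cut.
  move=> s; rewrite /scut c0 mulr0 !subr0 normrM.
  by rewrite ler_piMl// sg_norm_le1.
apply: (@near_eq_is_derive _ _ _ (fun y' => Num.sg (w y) * cut r Z y')) => //.
  by apply: filterS near_sg => y' sy; rewrite /scut sy.
by apply: derZ; exact: der_cut.
Qed.

Lemma cts_dscut : continuous dscut.
Proof.
move=> y; have [[c0 d0]|near_sg] := scut_cases y.
  apply/cvgrPdist_le => e e0; rewrite /dscut d0 mulr0.
  have /cvgrPdist_le/(_ _ e0) := @cts_dcut r Z y; rewrite d0.
  apply: filterS => y'; rewrite !sub0r !normrN normrM; apply: le_trans.
  by rewrite ler_piMl// sg_norm_le1.
apply: cvg_trans (@ctsZ _ (Num.sg (w y)) _ (@cts_dcut r Z) y).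
apply: near_eq_cvg; apply: filterS near_sg => y' sy.
by rewrite /dscut sy.
Qed.

End SignCut.

(** With w = v + lam, let z minimise |w| on a segment of the cover. There c |y - z|^(n+1) <= |w(y)|
    + |w(z)| <= 2 |w(y)|, so |w| is large at distance r from z. The multiplier is the sign of w
    times the cut-off around these minimisers. *)
Lemma multiplier (v : R -> R) n (c lam r : R) (S : seq (R * R)) :
  continuous v -> (forall y, y <= 0 -> v y = v 0) -> (forall y, 1 <= y -> v y = v 1) ->
  0 < c -> 0 < r -> growth_cover v n c S ->
  exists chi dchi : R -> R, exists Z : seq R,
   [/\ size Z = size S,
      forall y, is_derive y 1 chi (dchi y), continuous dchi &
    [/\ forall y, `|chi y| <= 1,
      forall y, `|dchi y| <= (size S)%:R / r,
      forall y, 0 <= chi y * (v y + lam) &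
      forall y, 0 <= y <= 1 -> (forall z, z \in Z -> r <= `|y - z|) ->
        2^-1 ^+ size S * (c / 2 * r ^+ n.+1) <= chi y * (v y + lam)]].
Proof.
move=> cv v0 v1 c0 r0 [Sg Sc]; pose w y := v y + lam.
have cw : continuous w by apply: ctsD; [exact: cv|exact: cts_cst].
have cnw : continuous (fun y => `|w y|).
  by move=> x; apply: (cvg_comp _ _ (@cw x)); exact: norm_continuous.
have /choice[zf Hz] : forall s : R * R, exists z, s.1 <= s.2 -> s.1 <= z <= s.2 /\
    forall y, s.1 <= y <= s.2 -> `|w z| <= `|w y|.
  move=> s; have [s12|s12] := leP s.1 s.2; last by exists 0.
  have [z] := @EVT_min R (fun y => `|w y|) s.1 s.2 s12 (continuous_subspaceT cnw).
  rewrite in_itv/= => sz zmin; by exists z => _; split.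
pose Z := [seq zf s | s <- S].
(* Zeros of w inside [0, 1] are minimisers of |w| on their segment, unique there by the growth
   estimate; outside [0, 1] w is locally constant and its sign cannot jump. *)
have near0 : forall y, w y = 0 -> y \in Z \/ \forall y' \near y, w y' = 0.
  move=> y wy; have [y0|y0] := ltP y 0.
    right; near=> y'; have y'0 : y' < 0 by near: y'; exact: lt_nbhsl.
    by move: wy; rewrite /w (v0 _ (ltW y0)) (v0 _ (ltW y'0)).
  have [y1|y1] := ltP 1 y.
    right; near=> y'; have y'1 : 1 < y' by near: y'; exact: lt_nbhsr.
    by move: wy; rewrite /w (v1 _ (ltW y1)) (v1 _ (ltW y'1)).
  have [|s sS sy] := Sc y; first by rewrite /I01/= in_itv/= y0.
  left; have [sz zmin] : s.1 <= zf s <= s.2 /\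
      forall y, s.1 <= y <= s.2 -> `|w (zf s)| <= `|w y|.
    by apply: Hz; move: sy => /andP[? ?]; apply: le_trans; eassumption.
  have wz : w (zf s) = 0.
    by apply/eqP; rewrite -normr_le0 (le_trans (zmin _ sy))// wy normr0.
  have [_] := Sg s sS y (zf s) sy sz.
  have -> : v y - v (zf s) = w y - w (zf s) by rewrite /w; ring.
  rewrite wy wz subrr normr0 pmulr_rle0//.
  move=> h; have : `|y - zf s| ^+ n.+1 == 0 by rewrite eq_le h exprn_ge0.
  rewrite expf_eq0/= normr_eq0 subr_eq0 => /eqP ->.
  by apply/mapP; exists s.
exists (scut w r Z), (dscut w r Z), Z; split => //.
- by rewrite size_map.
- by move=> y; exact: der_scut.
- exact: cts_dscut.
split.
- move=> y; rewrite /scut normrM mulr_ile1// ?sg_norm_le1//.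
  by have := cut_itv r Z y; rewrite ler_norml; lra.
- move=> y; rewrite /dscut normrM -(size_map zf S) (le_trans _ (dcut_le Z y r0))//.
  by rewrite ler_piMl// sg_norm_le1.
- move=> y; rewrite /scut -/(w y) mulrAC -normrEsg mulr_ge0//.
  by case/andP: (cut_itv r Z y).
move=> y y01 far; rewrite /scut -/(w y) [in leRHS]mulrAC -normrEsg [leRHS]mulrC.
have [|s sS sy] := Sc y; first by rewrite /I01/= in_itv.
have [sz zmin] : s.1 <= zf s <= s.2 /\
    forall y, s.1 <= y <= s.2 -> `|w (zf s)| <= `|w y|.
  by apply: Hz; move: sy => /andP[? ?]; apply: le_trans; eassumption.
apply: ler_pM; rewrite ?mulr_ge0 ?exprn_ge0 ?invr_ge0 ?(ltW r0) ?(ltW c0)//.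
  by rewrite -(size_map zf S) cut_far.
have [_ H] := Sg s sS y (zf s) sy sz.
have ryz : r <= `|y - zf s| by apply: far; apply/mapP; exists s.
have h1 : c * r ^+ n.+1 <= `|v y - v (zf s)|.
  apply: le_trans H; rewrite ler_wpM2l ?(ltW c0)// lerXn2r ?nnegrE ?(ltW r0)//.
have -> : c / 2 * r ^+ n.+1 = (c * r ^+ n.+1) / 2 by ring.
have : `|v y - v (zf s)| <= `|w y| + `|w (zf s)|.
  have -> : v y - v (zf s) = w y - w (zf s) by rewrite /w; ring.
  exact: ler_normB.
have := zmin _ sy; move: h1; move: (c * _) => A; lra.
Unshelve. all: end_near. Qed.

End Multiplier.

#[local] Hint Resolve measurable_I01 : core.

Ltac cts_atom := first [ assumption | exact: cts_cosb | exact: cts_sinb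
  | exact: cts_cosp | exact: cts_dcosp | exact: cts_ddcosp ].
Ltac cts := lazymatch goal with
  | |- continuous (fun _ => ?c) => exact: cts_cst
  | |- continuous (fun y => @?f y + @?g y) => refine (@ctsD _ f g _ _); cts
  | |- continuous (fun y => - @?f y) => refine (@ctsN _ f _); cts
  | |- continuous (fun y => @?f y * @?g y) => refine (@ctsM _ f g _ _); cts
  | |- continuous (fun y => @?f y ^+ ?n) => refine (@ctsX _ n f _); cts
  | |- continuous (fun y => ?f y) => change (continuous f); cts_atom
  | |- continuous _ => cts_atom
  end.
Ltac sqi := apply: cts_sqi; cts.

(** Kept as a hypothesis of the resolvent estimates; it is derived later from completeness on the
    rectangle, see [cosb_complete]. *)
Definition cos_complete (R : realType) := forall g : R -> R, continuous g ->
  forall e, 0 < e ->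
    exists J, ip1 g g - \sum_(j < J) ip1 g (cosb j) ^+ 2 <= e.

Section Tail.
Context {R : realType}.
Hypothesis complete : cos_complete R.
Implicit Types (f g : R -> R).

Lemma le_wav j : j%:R <= wav j :> R.
Proof. by rewrite /wav ler_peMr// (le_trans _ (pi_ge2 R))// ler1n. Qed.

(** Beyond rank J a cosine coefficient of g is at most 1 / J times the sine coefficient of g' in
    absolute value; Bessel for the sines sums them, and completeness turns the tail sum into the
    defect of norm. *)
Lemma cos_tail (J : nat) g g' : (0 < J)%N ->
  (forall y : R, is_derive y 1 g (g' y)) -> continuous g' ->
  ip1 g g - \sum_(j < J) ip1 g (cosb j) ^+ 2 <= ip1 g' g' / J%:R ^+ 2.
Proof.
move=> J0 dg cg'; have cg := der_continuous dg.
apply/ler_addgt0Pr => e e0; have [J' HJ'] := complete cg e0.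
have J20 : 0 < J%:R ^+ 2 :> R by rewrite exprn_gt0// ltr0n.
have mono : \sum_(j < J') ip1 g (cosb j) ^+ 2 - \sum_(j < J) ip1 g (cosb j) ^+ 2 <=
    ip1 g' g' / J%:R ^+ 2.
  have [J'J|JJ'] := leqP J' J.
    have : \sum_(j < J') ip1 g (cosb j) ^+ 2 <= \sum_(j < J) ip1 g (cosb j) ^+ 2.
      rewrite -!(big_mkord xpredT (fun j => ip1 g (cosb j) ^+ 2)).
      rewrite [leRHS](big_cat_nat (n := J'))//= lerDl sumr_ge0// => j _.
      exact: sqr_ge0.
    move=> h; apply: (@le_trans _ _ 0); first by rewrite subr_le0.
    by rewrite divr_ge0 ?(ltW J20)//; exact: ip_ge0.
  rewrite -!(big_mkord xpredT (fun j => ip1 g (cosb j) ^+ 2)).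
  rewrite (@big_cat_nat _ _ _ J 0 J')//= ?(ltnW JJ')// addrAC subrr add0r.
  rewrite ler_pdivlMr//; apply: le_trans (@bessel_sinb _ J' g' (cts_sqi cg')).
  rewrite -(big_mkord xpredT (fun j => ip1 g' (sinb j) ^+ 2)).
  rewrite (@big_cat_nat _ _ _ J 0 J')//= ?(ltnW JJ')//.
  rewrite -[leLHS]add0r lerD// ?sumr_ge0// => [j _|]; first exact: sqr_ge0.
  rewrite mulr_suml [leLHS]big_nat [leRHS]big_nat; apply: ler_sum => j /andP[Jj _].
  rewrite -[leRHS]sqrrN -(ip1_cosb_der j dg cg') exprMn mulrC.
  rewrite ler_wpM2r ?sqr_ge0// lerXn2r ?nnegrE ?wav_ge0//.
  by rewrite (le_trans _ (le_wav _))// ler_nat.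
lra.
Qed.
End Tail.

(** * Resolvent bound on Galerkin spaces *)

Section Identities.
Context {R : realType}.
Variables (J : nat) (v : R -> R) (kap : R) (p q : 'I_J -> R).
Hypothesis cv : continuous v.

Definition Umat (j l : 'I_J) : R := ip1 (fun y => v y * cosb j y) (cosb l).

Let P := cosp p.
Let Q := cosp q.
Let b (j : 'I_J) := kap * wav j ^+ 2.
Let A mu lam j := galr b Umat p q j + mu * p j - lam * q j.
Let B mu lam j := gali b Umat p q j + mu * q j + lam * p j.

Lemma Umat_cosp (s : 'I_J -> R) j :
  \sum_l Umat j l * s l = ip1 (fun y => v y * cosp s y) (cosb j).
Proof.
transitivity (ip1 (cosp s) (fun y => v y * cosb j y)).
  rewrite ip1_cosp; last by cts.
  by apply: eq_bigr => l _; rewrite mulrC /Umat.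
rewrite ip1_one [RHS]ip1_one; congr (ip1 _ _).
by apply: funext => y; ring.
Qed.

(** Real part of the pairing with p + i q: the terms in [lam] cancel, and those in [v] too since its
    matrix is symmetric. *)
Lemma energy_identity mu lam :
  \sum_j (A mu lam j * p j + B mu lam j * q j) =
  kap * (ip1 (dcosp p) (dcosp p) + ip1 (dcosp q) (dcosp q)) +
  mu * \sum_j (p j ^+ 2 + q j ^+ 2).
Proof.
have sym : \sum_(j < J) ip1 (fun y => v y * Q y) (cosb j) * p j =
           \sum_(j < J) ip1 (fun y => v y * P y) (cosb j) * q j.
  transitivity (ip1 P (fun y => v y * Q y)).
    by rewrite ip1_cosp; [apply: eq_bigr => j _; rewrite mulrC|cts].
  transitivity (ip1 Q (fun y => v y * P y)); last first.
    by rewrite ip1_cosp; [apply: eq_bigr => j _; rewrite mulrC|cts].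
  rewrite ip1_one [RHS]ip1_one; congr (ip1 _ _).
  by apply: funext => y; ring.
rewrite !ip1_dcosp_sqr mulr_sumr -big_split/= mulr_sumr -big_split/=.
apply/eqP; rewrite -subr_eq0 -sumrB; apply/eqP.
transitivity (\sum_(j < J) (ip1 (fun y => v y * P y) (cosb j) * q j -
    ip1 (fun y => v y * Q y) (cosb j) * p j)).
  apply: eq_bigr => j _; rewrite /A /B /galr /gali !Umat_cosp /b -/P -/Q.
  by ring.
by rewrite sumrB sym subrr.
Qed.

Variables (chi dchi : R -> R).
Hypothesis dchiP : forall y : R, is_derive y 1 chi (dchi y).
Hypothesis cdchi : continuous dchi.
Let cchi : continuous chi := der_continuous dchiP.

Let gp j := ip1 (fun y => chi y * P y) (cosb j).
Let gq j := ip1 (fun y => chi y * Q y) (cosb j).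
Definition remainder (s : R -> R) y : R := s y - \sum_(j < J) ip1 s (cosb j) * cosb j y.

Lemma ip1_coef (s f : R -> R) : continuous s -> continuous f ->
  \sum_(j < J) ip1 f (cosb j) * ip1 s (cosb j) = ip1 f s - ip1 f (remainder s).
Proof.
move=> cs cf; rewrite /remainder [ip1 f s]ip1C [X in _ = _ - X]ip1C ip1Bl//; last first.
  by apply: cts_sum => j; cts.
rewrite opprB addrC subrK [RHS]ip1C ip1_sum//; last by move=> j; cts.
by apply: eq_bigr => j _; rewrite mulrC.
Qed.

(** The left side is minus the integral of chi W' for the Wronskian W = Q' P - P' Q. The Neumann
    condition kills W at both ends, so one integration by parts leaves W chi' and first derivatives
    only. *)
Lemma ip1_second_order :
  \sum_(j < J) (wav j ^+ 2 * q j * gp j - wav j ^+ 2 * p j * gq j) =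
  ip1 (fun y => dcosp q y * P y - dcosp p y * Q y) dchi.
Proof.
have dd (s : 'I_J -> R) f : continuous f ->
    ip1 (ddcosp s) f = - \sum_(j < J) wav j ^+ 2 * s j * ip1 f (cosb j).
  move=> cf; rewrite ip1C ip1_sum//; last by move=> j; cts.
  by rewrite -sumrN; apply: eq_bigr => j _; rewrite mulNr.
have dW (y : R) : is_derive y 1 (fun y => dcosp q y * P y - dcosp p y * Q y)
    (ddcosp q y * P y - ddcosp p y * Q y).
  apply: (is_derive_eq (derB (derM (der_dcosp q y) (der_cosp p y))
    (derM (der_dcosp p y) (der_cosp q y)))).
  by rewrite /P /Q; ring.
have cdW : continuous (fun y => ddcosp q y * P y - ddcosp p y * Q y).
  by rewrite /P /Q; cts.
have := ip1_IBP dW dchiP cdW cdchi.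
rewrite !dcosp0 !dcosp1 !(mul0r, subrr, subr0, sub0r, oppr0) => /esym/eqP.
rewrite eqr_oppLR => /eqP ->.
transitivity (ip1 (ddcosp p) (fun y => chi y * Q y) - ip1 (ddcosp q) (fun y => chi y * P y)).
  rewrite !dd; [|by rewrite /P; cts|by rewrite /Q; cts].
  by rewrite opprK addrC -sumrB; apply: eq_bigr.
rewrite [X in X - _]ip1_one [X in _ - X]ip1_one [in RHS]ip1_one.
rewrite -ip1Bl; [|by rewrite /Q; cts|by rewrite /P; cts|by cts].
rewrite -ip1Nl; [|by rewrite /P /Q; cts|by cts].
by apply: ip1_swap => y; ring.
Qed.

(* Testing the imaginary part against chi P and the real part against chi Q kills
   mu; the multiplier chi only sees the projection on the first J cosines, whence
   the remainders. *)
Lemma test_identity mu lam :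
  \sum_j (B mu lam j * gp j - A mu lam j * gq j) =
  kap * ip1 (fun y => dcosp q y * P y - dcosp p y * Q y) dchi +
  (ip1 (fun y => chi y * (v y + lam)) (fun y => P y ^+ 2 + Q y ^+ 2)
   - ip1 (fun y => v y * P y) (remainder (fun y => chi y * P y))
   - ip1 (fun y => v y * Q y) (remainder (fun y => chi y * Q y))).
Proof.
have cP : continuous P by exact: cts_cosp.
have cQ : continuous Q by exact: cts_cosp.
have EU (s : 'I_J -> R) (f : R -> R) : continuous f ->
    \sum_(j < J) ip1 (fun y => v y * cosp s y) (cosb j) * ip1 f (cosb j) =
    ip1 (fun y => v y * cosp s y) f -
    ip1 (fun y => v y * cosp s y) (remainder f).
  by move=> cf; rewrite ip1_coef//; apply: ctsM => //; exact: cts_cosp.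
have EP : \sum_(j < J) p j * gp j = ip1 P (fun y => chi y * P y).
  by rewrite ip1_cosp//; cts.
have EQ : \sum_(j < J) q j * gq j = ip1 Q (fun y => chi y * Q y).
  by rewrite ip1_cosp//; cts.
have Emu : \sum_(j < J) q j * gp j = \sum_(j < J) p j * gq j.
  rewrite -[LHS]ip1_cosp; last by cts.
  rewrite -[RHS]ip1_cosp; last by cts.
  by rewrite ip1_one [RHS]ip1_one; congr (ip1 _ _); apply: funext => y; rewrite -/P -/Q; ring.
have Eup : \sum_(j < J) ip1 (fun y => v y * P y) (cosb j) * gp j =
    ip1 (fun y => v y * P y) (fun y => chi y * P y) -
    ip1 (fun y => v y * P y) (remainder (fun y => chi y * P y)).
  exact: (EU p (fun y => chi y * P y) (ctsM cchi cP)).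
have Euq : \sum_(j < J) ip1 (fun y => v y * Q y) (cosb j) * gq j =
    ip1 (fun y => v y * Q y) (fun y => chi y * Q y) -
    ip1 (fun y => v y * Q y) (remainder (fun y => chi y * Q y)).
  exact: (EU q (fun y => chi y * Q y) (ctsM cchi cQ)).
rewrite -ip1_second_order.
have -> : ip1 (fun y => chi y * (v y + lam)) (fun y => P y ^+ 2 + Q y ^+ 2) =
   lam * (\sum_(j < J) p j * gp j) + lam * (\sum_(j < J) q j * gq j) +
   ip1 (fun y => v y * P y) (fun y => chi y * P y) +
   ip1 (fun y => v y * Q y) (fun y => chi y * Q y).
  rewrite EP EQ -!ip1Zl; try by cts.
  rewrite [LHS]ip1_one [X in _ = X + _ + _ + _]ip1_one.
  rewrite [X in _ = _ + X + _ + _]ip1_one [X in _ = _ + _ + X + _]ip1_one.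
  rewrite [X in _ = _ + _ + _ + X]ip1_one.
  rewrite -!ip1Dl; try by cts.
  by apply: ip1_swap => y; ring.
transitivity (kap * (\sum_(j < J) (wav j ^+ 2 * q j * gp j - wav j ^+ 2 * p j * gq j)) +
  mu * (\sum_(j < J) q j * gp j - \sum_(j < J) p j * gq j) +
  lam * (\sum_(j < J) p j * gp j + \sum_(j < J) q j * gq j) +
  (\sum_(j < J) ip1 (fun y => v y * P y) (cosb j) * gp j +
   \sum_(j < J) ip1 (fun y => v y * Q y) (cosb j) * gq j)).
  rewrite -[X in mu * X]sumrB -!big_split/= !mulr_sumr -!big_split/=.
  by apply: eq_bigr => j _; rewrite /A /B /galr /gali !Umat_cosp /b -/P -/Q; ring.
rewrite Emu Eup Euq subrr mulr0 addr0 -addrA; congr (_ + _).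
by rewrite mulrDr -!addrA; congr (_ + (_ + (_ + _))); rewrite addrCA.
Qed.

End Identities.

Section Estimates.
Context {R : realType}.
Implicit Types (f g : R -> R).

Lemma amgm (t x y k K : R) : 0 < t -> `|k| <= K ->
  x * y * k <= K * ((t * x ^+ 2 + y ^+ 2 / t) / 2).
Proof.
move=> t0 kK; have K0 : 0 <= K by apply: le_trans kK.
have xy : `|x * y| <= (t * x ^+ 2 + y ^+ 2 / t) / 2.
  rewrite ler_pdivlMr// -subr_ge0.
  have -> : t * x ^+ 2 + y ^+ 2 / t - `|x * y| * 2 = (t * `|x| - `|y|) ^+ 2 / t.
    rewrite normrM -(real_normK (num_real x)) -(real_normK (num_real y)).
    by field; rewrite gt_eqF.
  by rewrite divr_ge0 ?sqr_ge0// ltW.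
apply: (le_trans (ler_norm _)); rewrite normrM mulrC.
by apply: ler_pM.
Qed.

Lemma sum_amgm (I : finType) (t : R) (A B p q : I -> R) : 0 < t ->
  \sum_i (A i * p i + B i * q i) <=
  ((\sum_i (A i ^+ 2 + B i ^+ 2)) / t + t * \sum_i (p i ^+ 2 + q i ^+ 2)) / 2.
Proof.
move=> t0; rewrite mulr_suml mulr_sumr -big_split/= mulr_suml.
apply: ler_sum => i _.
have n1 : `|1 : R| <= 1 by rewrite normr1.
have := amgm (p i) (A i) t0 n1; have := amgm (q i) (B i) t0 n1; lra.
Qed.

Lemma ip1_amgm t f g : 0 < t -> continuous f -> continuous g ->
  ip1 f g <= (t * ip1 f f + ip1 g g / t) / 2.
Proof.
move=> t0 cf cg.
have : 0 <= ip1 (fun y => t * f y - g y) (fun y => t * f y - g y) by exact: ip_ge0.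
have sg := cts_sqi cg; have sf := cts_sqi cf.
have mI := @measurable_I01 R; have sZ := sqiZ mI t sf.
rewrite [X in 0 <= X](ip_sqrB mI sZ sg) (ipZl mI t sf sZ) (ipZr mI t sf sf).
rewrite (ipZl mI t sf sg) -/(ip1 f f) -/(ip1 f g) -/(ip1 g g) => h.
rewrite ler_pdivlMr// -subr_ge0.
have -> : t * ip1 f f + ip1 g g / t - ip1 f g * 2 =
  (t * (t * ip1 f f) - 2 * (t * ip1 f g) + ip1 g g) / t.
  by field; rewrite gt_eqF.
by rewrite divr_ge0// ltW.
Qed.

Lemma ip1_quad (a b : R) (f g h k : R -> R) :
  continuous f -> continuous g -> continuous h -> continuous k ->
  ip1 (fun y => a * (f y ^+ 2 + g y ^+ 2) + b * (h y ^+ 2 + k y ^+ 2)) (fun=> 1) =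
  a * (ip1 f f + ip1 g g) + b * (ip1 h h + ip1 k k).
Proof.
move=> cf cg ch ck.
rewrite ip1Dl; try by cts.
rewrite !ip1Zl; try by cts.
rewrite !ip1Dl; try by cts.
by congr (_ * (_ + _) + _ * (_ + _)); apply: ip1_swap => y; rewrite mulr1 expr2.
Qed.

Lemma ip1_remainder (J : nat) (s : R -> R) : continuous s ->
  ip1 (remainder J s) (remainder J s) = ip1 s s - \sum_(j < J) ip1 s (cosb j) ^+ 2.
Proof.
move=> cs; have ss := cts_sqi cs.
have se (j : 'I_J) : sqi (@lebesgue_measure R) I01 (cosb j) by sqi.
have oe (i j : 'I_J) : ip (@lebesgue_measure R) I01 (cosb i) (cosb j) =
    ((i == j) && xpredT i)%:R.
  by rewrite andbT; exact: cosb_orthonormal.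
exact: (dist_proj (@measurable_I01 R) se oe ss).
Qed.

Lemma ip1_tail (J : nat) (chi dchi P dP : R -> R) (K : R) : cos_complete R ->
  (0 < J)%N -> (forall y : R, is_derive y 1 chi (dchi y)) ->
  (forall y : R, is_derive y 1 P (dP y)) -> continuous dchi -> continuous dP ->
  (forall y, `|chi y| <= 1) -> (forall y, `|dchi y| <= K) ->
  ip1 (remainder J (fun y => chi y * P y)) (remainder J (fun y => chi y * P y)) <=
  2 * (ip1 dP dP + K ^+ 2 * ip1 P P) / J%:R ^+ 2.
Proof.
move=> complete J0 dchiP dPP cdchi cdP chi1 dchiK.
have cchi := der_continuous dchiP; have cP := der_continuous dPP.
have K0 : 0 <= K by apply: le_trans (dchiK 0).
rewrite ip1_remainder; last by cts.
have ds (y : R) : is_derive y 1 (fun y => chi y * P y) (dchi y * P y + chi y * dP y).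
  exact: derM.
apply: (le_trans (@cos_tail _ complete J _ _ J0 ds _)); first by cts.
rewrite ler_wpM2r ?invr_ge0 ?exprn_ge0//.
apply: (@le_trans _ _ (ip1 (fun y => 2 * (dP y ^+ 2 + 0 ^+ 2) +
  2 * K ^+ 2 * (P y ^+ 2 + 0 ^+ 2)) (fun=> 1))); last first.
  rewrite (ip1_quad 2 (2 * K ^+ 2) (g := fun=> 0) (k := fun=> 0)); try by cts.
  by rewrite /ip1 !ip0l; lra.
apply: le_ip1; try by cts.
move=> y _; have h1 : chi y ^+ 2 <= 1.
  by rewrite -(real_normK (num_real _)) expr_le1.
have h2 : dchi y ^+ 2 <= K ^+ 2.
  by rewrite -(real_normK (num_real _)) lerXn2r.
rewrite expr0n/= !addr0 mulr1.
have h3 : (chi y * dP y) ^+ 2 <= dP y ^+ 2.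
  by rewrite exprMn ler_piMl ?sqr_ge0.
have h4 : (dchi y * P y) ^+ 2 <= K ^+ 2 * P y ^+ 2.
  by rewrite exprMn ler_wpM2r ?sqr_ge0.
have h5 := sqr_ge0 (dchi y * P y - chi y * dP y).
by rewrite -expr2; move: h3 h4 h5; rewrite !expr2; nra.
Qed.

Lemma ip1_indic_le (z r : R) : 0 <= r ->
  sqi (@lebesgue_measure R) I01 (\1_(`[z - r, z + r]) : R -> R) /\
  ip1 (\1_(`[z - r, z + r]) : R -> R) (fun=> 1) <= 2 * r.
Proof.
move=> r0; have mB : measurable `[z - r, z + r] by exact: measurable_itv.
split.
  have -> : \1_(`[z - r, z + r]) = (fun x => \1_(`[z - r, z + r]) x * 1) :> (R -> R).
    by apply: funext => x; rewrite mulr1.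
  apply: (@sqi_bddM _ _ _ _ _ (@measurable_I01 R) _ _ 1).
  - exact: measurable_indic.
  - by move=> x _; rewrite indicE ger0_norm// lern1 leq_b1.
  - by apply: cts_sqi; exact: cts_cst.
rewrite /ip1 /ip; under eq_Rintegral do rewrite mulr1.
rewrite /Rintegral integral_indic//.
pose B : set (measurableTypeR R) := `[z - r, z + r]%classic.
have mle : (lebesgue_measure (B `&` @I01 R) <= (2 * r)%:E)%E.
  apply: (@le_trans _ _ (lebesgue_measure B)).
    by apply: le_measure; rewrite ?inE//; exact: measurableI.
  rewrite lebesgue_measure_itv/= lte_fin.
  case: ifPn => _; last by rewrite lee_fin mulr_ge0.
  by rewrite -EFinB lee_fin; lra.
rewrite -lee_fin fineK//; apply/fin_numPlt; rewrite (lt_le_trans _ (measure_ge0 _ _))//=.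
exact: le_lt_trans mle (ltry _).
Qed.

Lemma ip1_indics_le (Z : seq R) r : 0 <= r ->
  sqi (@lebesgue_measure R) I01 (fun y => \sum_(z <- Z) \1_(`[z - r, z + r]) y) /\
  ip1 (fun y => \sum_(z <- Z) \1_(`[z - r, z + r]) y) (fun=> 1) <= (size Z)%:R * (2 * r).
Proof.
move=> r0; split.
  by apply: (sqi_sum (@measurable_I01 R)) => z; have [] := ip1_indic_le z r0.
rewrite /ip1 (ip_suml (@measurable_I01 R)); last 2 first.
- by move=> z; have [] := ip1_indic_le z r0.
- by sqi.
elim: Z => [|z Z IH]; first by rewrite big_nil mul0r.
rewrite big_cons /= -[(size Z).+1%:R]natr1 mulrDl mul1r addrC lerD//.
by have [] := ip1_indic_le z r0.
Qed.
End Estimates.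

Section Resolvent.
Context {R : realType}.
Hypothesis complete : cos_complete R.

Let test_arith (W I T1 T2 SP SQ PP QQ X F t B kap : R) :
  kap * W + (I - T1 - T2) <= (F / t + t * (SP + SQ)) / 2 ->
  T1 + T2 <= t * X -> F / t <= t * X -> kap * - W <= kap * B ->
  t * SP <= t * PP -> t * SQ <= t * QQ -> X = PP + QQ -> I <= 2 * t * X + kap * B.
Proof. by clear complete; move=> *; subst; lra. Qed.

(* The bound is uniform in J only beyond a J0 depending on d: the tails of
   chi P and chi Q are controlled by their derivatives, of size 1 / d. *)
Lemma galerkin_resolvent (v : R -> R) n (c M : R) (S : seq (R * R)) :
  continuous v -> (forall y, y <= 0 -> v y = v 0) -> (forall y, 1 <= y -> v y = v 1) ->
  (forall y, `|v y| <= M) -> 0 < c -> growth_cover v n c S ->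
  exists2 th : R, 0 < th & forall d : R, 0 < d <= 1 -> exists J0, forall J, (J0 <= J)%N ->
    resolvent_bound (fun j : 'I_J => d ^+ n.+3 * wav j ^+ 2) (@Umat R J v)
      ((th * d ^+ n.+1) ^+ 2).
Proof.
move=> cv v0 v1 vM c0 Sg.
have M0 : 0 <= M by apply: le_trans (vM 0).
(* Order of the choices: [eta] is small enough that intervals of radius [eta d] around at most N
   points carry a quarter of the mass; [c1] and [D] then give the lower bound [D E] of chi (v + lam)
   elsewhere; [rho] is last, so that the test with chi stays below [D / 4]. *)
pose N : R := (size S)%:R + 1; have N1 : 1 <= N by rewrite lerDr.
have N0 : 0 < N by lra.
pose c1 := 2^-1 ^+ size S * (c / 2).
have c10 : 0 < c1 by rewrite mulr_gt0 ?exprn_gt0 ?invr_gt0 ?divr_gt0.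
pose eta := (24 * N)^-1; have eta0 : 0 < eta by rewrite invr_gt0 mulr_gt0.
pose D := c1 * eta ^+ n.+1; have D0 : 0 < D by rewrite mulr_gt0 ?exprn_gt0.
pose L := 2 + N / eta; have L0 : 0 < L by rewrite addr_gt0 ?divr_gt0.
pose rho := Num.min 1 (D / (4 * L)).
have rho0 : 0 < rho by rewrite lt_min ltr01/= divr_gt0// mulr_gt0.
have rho1 : rho <= 1 by rewrite ge_min lexx.
have rhoD : rho * L <= D / 4.
  have : rho <= D / (4 * L) by rewrite ge_min lexx orbT.
  rewrite ler_pdivlMr ?mulr_gt0// => h; rewrite ler_pdivlMr//.
  by apply: le_trans h; rewrite le_eqVlt; apply/orP; left; apply/eqP; ring.
exists (rho ^+ 2); first by rewrite exprn_gt0.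
move=> d /andP[d0 d1].
pose E := d ^+ n.+1; have E0 : 0 < E by rewrite exprn_gt0.
have dE : d ^+ n.+3 = E * d ^+ 2 by rewrite /E -exprD addn2.
pose r := eta * d; have r0 : 0 < r by rewrite mulr_gt0.
pose t := rho ^+ 2 * E; have t0 : 0 < t by rewrite mulr_gt0 ?exprn_gt0.
(* [w] is the weight splitting the products v P times remainder: the factor v P then costs at most t
   / 2. The threshold [T] on J^2 makes the remainders cost another t / 2. *)
pose w := t / (M ^+ 2 + 1); have w0 : 0 < w.
  by rewrite divr_gt0// ltr_wpDl ?sqr_ge0.
pose K := N / r; have K0 : 0 < K by rewrite divr_gt0.
pose T := 2 * (rho ^+ 2 / d ^+ 2 + K ^+ 2) / (w * t).
exists (Num.truncn T).+1 => J J0 mu lam p q mu0; rewrite leNgt; apply/negP => H.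
have T0 : 0 <= T.
  apply: divr_ge0; last by apply: mulr_ge0; exact: ltW.
  by apply: mulr_ge0 => //; apply: addr_ge0; rewrite ?divr_ge0// sqr_ge0.
have JT : T <= J%:R ^+ 2.
  have /andP[_ TJ] := truncn_itv T0.
  have TJ' : T <= J%:R by rewrite (le_trans (ltW TJ))// ler_nat.
  rewrite (le_trans TJ')// expr2 ler_peMr// ler1n.
  by rewrite (leq_trans _ J0).
have Jgt0 : (0 < J)%N by rewrite (leq_trans _ J0).
pose A j := galr (fun j : 'I_J => d ^+ n.+3 * wav j ^+ 2) (Umat v) p q j + mu * p j - lam * q j.
pose B j := gali (fun j : 'I_J => d ^+ n.+3 * wav j ^+ 2) (Umat v) p q j + mu * q j + lam * p j.
pose X := \sum_j (p j ^+ 2 + q j ^+ 2).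
pose F := \sum_j (A j ^+ 2 + B j ^+ 2).
have {}H : F < t ^+ 2 * X by exact: H.
have F0 : 0 <= F by apply: sumr_ge0 => j _; rewrite addr_ge0 ?sqr_ge0.
have X0 : 0 < X by rewrite -(pmulr_rgt0 _ (exprn_gt0 2 t0)); exact: le_lt_trans H.
have Ft : F / t <= t * X.
  by rewrite ler_pdivrMr// mulrAC -expr2 ltW.
pose P := cosp p; pose Q := cosp q; pose dP := dcosp p; pose dQ := dcosp q.
pose PP := ip1 P P; pose QQ := ip1 Q Q.
have XE : X = PP + QQ by rewrite /PP /QQ /P /Q !ip1_cosp_sqr -big_split.
pose G := ip1 dP dP + ip1 dQ dQ.
have PP0 : 0 <= PP by exact: ip_ge0.
have QQ0 : 0 <= QQ by exact: ip_ge0.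
have dPP0 : 0 <= ip1 dP dP by exact: ip_ge0.
have dQQ0 : 0 <= ip1 dQ dQ by exact: ip_ge0.
have cP : continuous P by exact: cts_cosp.
have cQ : continuous Q by exact: cts_cosp.
have cdP : continuous dP by exact: cts_dcosp.
have cdQ : continuous dQ by exact: cts_dcosp.
(* Testing with the solution itself: kappa G <= t X, where kappa = E d^2 and t = rho^2 E. *)
have dG : d ^+ 2 * G <= rho ^+ 2 * X.
  have := sum_amgm A B p q t0; rewrite -/F -/X.
  rewrite (energy_identity _ _ _ cv mu lam) -/dP -/dQ -/G -/X => h.
  have h2 : d ^+ n.+3 * G <= t * X.
    by have := mulr_ge0 mu0 (ltW X0); lra.
  rewrite -(ler_pM2l E0) mulrA -dE (le_trans h2)//.
  by rewrite /t le_eqVlt; apply/orP; left; apply/eqP; ring.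
have tG : d / rho * G <= rho / d * X.
  rewrite -(ler_pM2l (mulr_gt0 rho0 d0)).
  have -> : rho * d * (d / rho * G) = d ^+ 2 * G by field; rewrite gt_eqF.
  by have -> : rho * d * (rho / d * X) = rho ^+ 2 * X by field; rewrite gt_eqF.
have [chi [dchi [Z [sZ dchiP cdchi [chi1 dchiK chi_ge0 chi_far]]]]] :=
  multiplier lam cv v0 v1 c0 r0 Sg.
have cchi := der_continuous dchiP.
have {}dchiK y : `|dchi y| <= K.
  by rewrite (le_trans (dchiK y))// ler_wpM2r ?invr_ge0 ?(ltW r0)// lerDl.
pose I := ip1 (fun y => chi y * (v y + lam)) (fun y => P y ^+ 2 + Q y ^+ 2).
have chiPP (s : R -> R) : continuous s ->
    \sum_(j < J) ip1 (fun y => chi y * s y) (cosb j) ^+ 2 <= ip1 s s.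
  move=> cs; have csm : continuous (fun y => chi y * s y) by exact: ctsM.
  apply: (le_trans (bessel_cosb J (cts_sqi csm))).
  apply: le_ip1 => // y _.
  have h1 : chi y ^+ 2 <= 1 by rewrite -(real_normK (num_real _)) expr_le1.
  by have := ler_wpM2r (sqr_ge0 (s y)) h1; rewrite mul1r -!expr2 exprMn.
(* Cost of replacing chi s by its projection on the Galerkin space. *)
have tailb (s ds : R -> R) : (forall y : R, is_derive y 1 s (ds y)) -> continuous ds ->
    ip1 (fun y => v y * s y) (remainder J (fun y => chi y * s y)) <=
    t / 2 * ip1 s s + (ip1 ds ds + K ^+ 2 * ip1 s s) / (w * J%:R ^+ 2).
  move=> dsP cds; have cs := der_continuous dsP.
  have cr : continuous (remainder J (fun y => chi y * s y)).
    apply: (@ctsB _ (fun y => chi y * s y)); first exact: ctsM.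
    apply: cts_sum => j; apply: ctsZ; exact: cts_cosb.
  have cvs : continuous (fun y => v y * s y) by exact: ctsM.
  apply: (le_trans (ip1_amgm w0 cvs cr)).
  have h1 : ip1 (fun y => v y * s y) (fun y => v y * s y) <= M ^+ 2 * ip1 s s.
    rewrite -ip1Zl//; apply: le_ip1 => //; first exact: ctsZ.
    move=> y _; have h1 : v y ^+ 2 <= M ^+ 2.
      by rewrite -(real_normK (num_real _)) lerXn2r ?nnegrE.
    by have := ler_wpM2r (sqr_ge0 (s y)) h1; lra.
  have h2 := ip1_tail complete Jgt0 dchiP dsP cdchi cds chi1 dchiK.
  have h3 : w * ip1 (fun y => v y * s y) (fun y => v y * s y) <= t * ip1 s s.
    apply: (@le_trans _ _ (w * (M ^+ 2 * ip1 s s))); first by rewrite ler_wpM2l ?(ltW w0).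
    rewrite mulrA ler_wpM2r//; first exact: ip_ge0.
    rewrite /w mulrAC ler_pdivrMr ?ltr_wpDl ?sqr_ge0//.
    by rewrite ler_wpM2l ?(ltW t0)// lerDl.
  have h4 : ip1 (remainder J (fun y => chi y * s y)) (remainder J (fun y => chi y * s y)) / w
     <= 2 * ((ip1 ds ds + K ^+ 2 * ip1 s s) / (w * J%:R ^+ 2)).
    have -> : 2 * ((ip1 ds ds + K ^+ 2 * ip1 s s) / (w * J%:R ^+ 2)) =
      2 * (ip1 ds ds + K ^+ 2 * ip1 s s) / J%:R ^+ 2 / w.
      by field; rewrite gt_eqF//= pnatr_eq0 -lt0n.
    by rewrite ler_wpM2r ?invr_ge0 ?(ltW w0).
  by move: h3 h4; clear; lra.
have tails : ip1 (fun y => v y * P y) (remainder J (fun y => chi y * P y)) +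
    ip1 (fun y => v y * Q y) (remainder J (fun y => chi y * Q y)) <= t * X.
  have := tailb P dP (der_cosp p) cdP; have := tailb Q dQ (der_cosp q) cdQ.
  rewrite -/PP -/QQ.
  have : (G + K ^+ 2 * X) / (w * J%:R ^+ 2) <= t / 2 * X.
    have wJ : 0 < w * J%:R ^+ 2 by rewrite mulr_gt0// exprn_gt0// ltr0n.
    rewrite ler_pdivrMr//.
    have : G + K ^+ 2 * X <= (rho ^+ 2 / d ^+ 2 + K ^+ 2) * X.
      rewrite mulrDl lerD2r mulrAC ler_pdivlMr ?exprn_gt0// mulrC.
      exact: dG.
    move/le_trans; apply.
    have -> : t / 2 * X * (w * J%:R ^+ 2) = (w * t) / 2 * J%:R ^+ 2 * X by ring.
    rewrite ler_wpM2r ?(ltW X0)//.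
    have wt : 0 < w * t by rewrite mulr_gt0.
    have -> : rho ^+ 2 / d ^+ 2 + K ^+ 2 = (w * t) / 2 * T.
      by rewrite /T; field; rewrite !gt_eqF.
    by rewrite ler_wpM2l// divr_ge0// ltW.
  rewrite /G XE; move: (w * _) => wJ.
  have -> : (ip1 dP dP + ip1 dQ dQ + K ^+ 2 * (PP + QQ)) / wJ =
    (ip1 dP dP + K ^+ 2 * PP) / wJ + (ip1 dQ dQ + K ^+ 2 * QQ) / wJ.
    by rewrite -mulrDl; congr (_ * _); rewrite mulrDr addrACA.
  move=> h hQ hP; apply: (le_trans (lerD hP hQ)); rewrite addrACA -mulrDr.
  have -> : t * (PP + QQ) = t / 2 * (PP + QQ) + t / 2 * (PP + QQ) by field.
  by rewrite lerD2l.
(* Testing with chi times the solution. The commutator with the diffusion is at most kappa |chi'|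
   |W|, where |chi'| <= K of order 1 / d and the integral of |W| is at most (rho / d) X. *)
have test : I <= 2 * t * X + d ^+ n.+3 * (K * (rho / d * X)).
  have := sum_amgm B (fun j => - A j) (fun j => ip1 (fun y => chi y * P y) (cosb j))
    (fun j => ip1 (fun y => chi y * Q y) (cosb j)) t0.
  have -> : \sum_i (B i ^+ 2 + (- A i) ^+ 2) = F.
    by apply: eq_bigr => i _; rewrite sqrrN addrC.
  under eq_bigr do rewrite mulNr.
  rewrite (test_identity _ _ _ cv dchiP cdchi mu lam) -/P -/Q -/I -/dP -/dQ.
  rewrite big_split/=; have := chiPP P cP; have := chiPP Q cQ; rewrite -/PP -/QQ.
  move=> hQ hP h.
  have hW : - ip1 (fun y => dQ y * P y - dP y * Q y) dchi <= K * (rho / d * X).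
    rewrite -ip1Nl; [|by cts|by []].
    have rd : 0 < d / rho by rewrite divr_gt0.
    apply: (@le_trans _ _ (ip1 (fun y => K * (d / rho) / 2 * (dP y ^+ 2 + dQ y ^+ 2) +
        K * (rho / d) / 2 * (P y ^+ 2 + Q y ^+ 2)) (fun=> 1))).
      apply: le_ip1; try by cts.
      move=> y _; rewrite mulr1.
      have a1 := amgm (dP y) (Q y) rd (dchiK y).
      have nK : `|- dchi y| <= K by rewrite normrN.
      have a2 := amgm (dQ y) (P y) rd nK.
      rewrite invf_div in a1 a2; move: a1 a2; clear; lra.
    rewrite ip1_quad// -/G -/PP -/QQ -XE.
    by have := ler_wpM2l (ltW K0) tG; clear; lra.
  have {}hW := ler_wpM2l (ltW (exprn_gt0 n.+3 d0)) hW.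
  have {}hQ := ler_wpM2l (ltW t0) hQ; have {}hP := ler_wpM2l (ltW t0) hP.
  exact: (test_arith h tails Ft hW hP hQ XE).
have sup y : 0 <= y <= 1 -> P y ^+ 2 + Q y ^+ 2 <= (1 + 2 * (rho / d)) * X.
  move=> y01; have := sup_bound (der_cosp p) cdP y01; have := sup_bound (der_cosp q) cdQ y01.
  rewrite -/P -/Q -/dP -/dQ -/PP -/QQ.
  have am (a b : R) : 0 <= a -> 0 <= b ->
      2 * Num.sqrt a * Num.sqrt b <= d / rho * b + rho / d * a.
    move=> a0 b0; have n1 : `|1 : R| <= 1 by rewrite normr1.
    have := amgm (Num.sqrt b) (Num.sqrt a) (divr_gt0 d0 rho0) n1.
    by rewrite !sqr_sqrtr// invf_div; clear; lra.
  have := am _ _ PP0 dPP0; have := am _ _ QQ0 dQQ0.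
  by move: tG; rewrite /G XE; clear; lra.
have DE0 : 0 < D * E by rewrite mulr_gt0.
(* Pointwise alternative: near some z in Z the sup bound is paired with an indicator at least 1;
   elsewhere chi (v + lam) >= D E. *)
have lower : X <= (D * E)^-1 * I + (1 + 2 * (rho / d)) * X * (N * (2 * r)).
  have [sh h1] := ip1_indics_le Z (ltW r0).
  pose h y : R := \sum_(z <- Z) \1_(`[z - r, z + r]) y.
  pose g y : R := chi y * (v y + lam) * (P y ^+ 2 + Q y ^+ 2).
  have cg : continuous g by rewrite /g; cts.
  have s1 : sqi (@lebesgue_measure R) I01 (fun=> 1 : R) by sqi.
  have sg := cts_sqi cg.
  pose SU := (1 + 2 * (rho / d)) * X.
  have SU0 : 0 <= SU.
    by rewrite mulr_ge0 ?(ltW X0)// addr_ge0// mulr_ge0// divr_ge0// ltW.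
  have mI := @measurable_I01 R.
  rewrite [leLHS](_ : _ = ip1 (fun y => P y ^+ 2 + Q y ^+ 2) (fun=> 1)); last first.
    rewrite XE ip1Dl; try by cts.
    by congr (_ + _); apply: ip1_swap => y; rewrite mulr1 expr2.
  apply: (@le_trans _ _ (ip1 (fun y => (D * E)^-1 * g y + SU * h y) (fun=> 1))).
    apply: le_Rintegral => //.
    - by apply: sqi_mul => //; sqi.
    - by apply: sqi_mul => //; apply: sqiD => //; exact: sqiZ.
    move=> y; rewrite /I01/= in_itv/= => y01; rewrite !mulr1.
    have h0 : 0 <= h y by apply: sumr_ge0.
    have PQ0 : 0 <= P y ^+ 2 + Q y ^+ 2 by rewrite addr_ge0 ?sqr_ge0.
    have g0 : 0 <= g y by rewrite mulr_ge0.
    have [/hasP[z zZ zy]|/hasPn far] := boolP (has (fun z => `|y - z| < r) Z).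
      have h1y : 1 <= h y.
        rewrite /h (perm_big _ (perm_to_rem zZ)) big_cons.
        rewrite indicE mem_set/=; last first.
          by move: zy; rewrite /= in_itv/= ltr_norml; clear; lra.
        by rewrite lerDl sumr_ge0.
      apply: (le_trans (sup y y01)); rewrite -/SU.
      have : 0 <= (D * E)^-1 * g y by rewrite mulr_ge0// invr_ge0 ltW.
      by have := ler_wpM2l SU0 h1y; clear; lra.
    have := chi_far y y01.
    have far' z : z \in Z -> r <= `|y - z| by move=> /far; rewrite -leNgt.
    move=> /(_ far').
    have -> : 2^-1 ^+ size S * (c / 2 * r ^+ n.+1) = D * E.
      by rewrite /D /E /c1 /r exprMn; ring.
    move=> /(ler_wpM2r PQ0); rewrite -/(g y) => h2.
    have : P y ^+ 2 + Q y ^+ 2 <= (D * E)^-1 * g y.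
      by rewrite mulrC ler_pdivlMr// mulrC.
    by have := mulr_ge0 SU0 h0; clear; lra.
  rewrite /ip1 ipDl//; [|exact: sqiZ|exact: sqiZ].
  rewrite !ipZl// lerD//.
    rewrite le_eqVlt; apply/orP; left; apply/eqP; congr (_ * _).
    by apply: ip1_swap => y; rewrite mulr1.
  rewrite ler_wpM2l//; apply: (le_trans h1).
  by rewrite sZ; apply: ler_wpM2r; [rewrite mulr_ge0// ltW|rewrite lerDl].
have I1 : (D * E)^-1 * I <= X / 4.
  rewrite mulrC ler_pdivrMr//.
  apply: (le_trans test).
  have -> : 2 * t * X + d ^+ n.+3 * (K * (rho / d * X)) = E * (rho * (2 * rho + N / eta)) * X.
    by rewrite /t /K /r dE; field; rewrite !gt_eqF.
  have -> : X / 4 * (D * E) = E * (D / 4) * X by ring.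
  rewrite ler_wpM2r ?(ltW X0)// ler_wpM2l ?(ltW E0)//.
  apply: le_trans rhoD; rewrite ler_wpM2l ?(ltW rho0)// /L lerD2r.
  by move: rho1; clear; lra.
have I2 : (1 + 2 * (rho / d)) * X * (N * (2 * r)) <= X / 4.
  have -> : (1 + 2 * (rho / d)) * X * (N * (2 * r)) = (d + 2 * rho) / 12 * X.
    by rewrite /r /eta; field; rewrite gt_eqF//= gt_eqF.
  have h : (d + 2 * rho) / 12 <= 1 / 4 by move: d1 rho1; clear; lra.
  by have := ler_wpM2r (ltW X0) h; clear; lra.
by move: lower I1 I2 X0; clear; lra.
Qed.

End Resolvent.

(** * Density of trigonometric polynomials *)

Section Approximation.
Import HBNNSimple.
Context d (T : measurableType d) {R : realType}.
Variables (mu : {measure set T -> \bar R}) (D : set T).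
Hypothesis mD : measurable D.
Hypothesis muD : (mu D < +oo)%E.
Variable V : (T -> R) -> Prop.
Hypothesis V_sqi : forall f, V f -> sqi mu D f.
Hypothesis V_0 : V (fun=> 0).
Hypothesis V_D : forall f g, V f -> V g -> V (fun x => f x + g x).
Hypothesis V_Z : forall a f, V f -> V (fun x => a * f x).
Implicit Types f g : T -> R.

Definition approximable f := sqi mu D f /\
  forall e, 0 < e -> exists2 g, V g & ip mu D (fun x => f x - g x) (fun x => f x - g x) <= e.

Lemma integrable_const (a : R) : mu.-integrable D (EFin \o (fun=> a)).
Proof.
apply: (measurable_bounded_integrable mD muD); first exact: measurable_cst.
by exists `|a|; split; rewrite ?num_real// => M aM x _ /=; exact: ltW.
Qed.

Lemma sqi_cst (a : R) : sqi mu D (fun=> a).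
Proof.
split; first exact: measurable_cst.
exact: (integrable_const (a ^+ 2)).
Qed.

Lemma sqi_bounded f (M : R) : measurable_fun D f -> (forall x, D x -> `|f x| <= M) ->
  sqi mu D f.
Proof.
move=> mf fM; have := sqi_bddM mD mf fM (sqi_cst 1).
by under [X in sqi _ _ X -> _]eq_fun do rewrite mulr1.
Qed.

Lemma approximable_V f : V f -> approximable f.
Proof.
move=> Vf; split; first exact: V_sqi.
move=> e e0; exists f => //; under [X in ip _ _ X]eq_fun do rewrite subrr.
by rewrite ip0l ltW.
Qed.

Lemma ip_sqrD_le f g : sqi mu D f -> sqi mu D g ->
  ip mu D (fun x => f x + g x) (fun x => f x + g x) <= 2 * ip mu D f f + 2 * ip mu D g g.
Proof.
move=> sf sg; have := ip_ge0 mu D (fun x => f x - g x).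
by rewrite ip_sqrB// ip_sqrD//; lra.
Qed.

Lemma approximable_lim f : sqi mu D f ->
  (forall e, 0 < e -> exists2 g, approximable g &
    ip mu D (fun x => f x - g x) (fun x => f x - g x) <= e) -> approximable f.
Proof.
move=> sf H; split => // e e0.
have [g [sg Hg] fg] := H _ (divr_gt0 e0 (ltr0n _ 4 : 0 < 4)).
have [h Vh gh] := Hg _ (divr_gt0 e0 (ltr0n _ 4 : 0 < 4)).
exists h => //.
have -> : (fun x => f x - h x) = (fun x => (f x - g x) + (g x - h x)).
  by apply: funext => x; ring.
apply: (le_trans (ip_sqrD_le (sqiB mD sf sg) (sqiB mD sg (V_sqi Vh)))).
by move: fg gh; lra.
Qed.

Lemma approximableD f g : approximable f -> approximable g ->
  approximable (fun x => f x + g x).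
Proof.
move=> [sf Hf] [sg Hg]; split; first exact: sqiD.
move=> e e0; have [f' Vf ff'] := Hf _ (divr_gt0 e0 (ltr0n _ 4 : 0 < 4)).
have [g' Vg gg'] := Hg _ (divr_gt0 e0 (ltr0n _ 4 : 0 < 4)).
exists (fun x => f' x + g' x); first exact: V_D.
have -> : (fun x => f x + g x - (f' x + g' x)) =
    (fun x => (f x - f' x) + (g x - g' x)) by apply: funext => x; ring.
apply: (le_trans (ip_sqrD_le (sqiB mD sf (V_sqi Vf)) (sqiB mD sg (V_sqi Vg)))).
by move: ff' gg'; lra.
Qed.

Lemma approximableZ a f : approximable f -> approximable (fun x => a * f x).
Proof.
move=> [sf Hf]; split; first exact: sqiZ.
move=> e e0; have a0 : 0 < a ^+ 2 + 1 by rewrite ltr_wpDl ?sqr_ge0.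
have [g Vg fg] := Hf _ (divr_gt0 e0 a0).
exists (fun x => a * g x); first exact: V_Z.
have -> : (fun x => a * f x - a * g x) = (fun x => a * (f x - g x)).
  by apply: funext => x; ring.
have sfg := sqiB mD sf (V_sqi Vg).
rewrite ipZl// ?ipZr//; last exact: sqiZ.
have := ip_ge0 mu D (fun x => f x - g x).
move: fg; rewrite ler_pdivlMr//.
move: (ip _ _ _ _) => i; rewrite mulrA -expr2; lra.
Qed.

Lemma approximableB f g : approximable f -> approximable g ->
  approximable (fun x => f x - g x).
Proof.
move=> af ag; have := approximableD af (approximableZ (-1) ag).
by under [X in approximable X -> _]eq_fun do rewrite mulN1r.
Qed.

Lemma approximable_sum (I : Type) (s : seq I) (F : I -> T -> R) :
  (forall i, approximable (F i)) -> approximable (fun x => \sum_(i <- s) F i x).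
Proof.
move=> aF; elim: s => [|i s IH].
  by under eq_fun do rewrite big_nil; exact: approximable_V.
by under eq_fun do rewrite big_cons; exact: approximableD.
Qed.

Lemma approximable_ae f g : sqi mu D f -> approximable g ->
  {ae mu, forall x, D x -> f x = g x} -> approximable f.
Proof.
move=> sf ag fg; apply: approximable_lim => // e e0; exists g => //.
have [sg _] := ag.
suff -> : ip mu D (fun x => f x - g x) (fun x => f x - g x) = 0 by exact: ltW.
have -> : 0 = ip mu D (fun=> 0) (fun=> 0) :> R by rewrite ip0l.
rewrite /ip /Rintegral; congr fine; apply: ae_eq_integral => //.
- by apply/measurable_EFinP; have [mfg _] := sqiB mD sf sg; exact: measurable_funM.
- by apply: filterS fg => x H Dx; rewrite H// subrr.
Qed.

Lemma approximable_dom (F : nat -> T -> R) f g : sqi mu D f ->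
  (forall n, approximable (F n)) ->
  (forall x, D x -> F n x @[n --> \oo] --> f x) ->
  mu.-integrable D (EFin \o g) ->
  (forall n x, D x -> (f x - F n x) ^+ 2 <= g x) -> approximable f.
Proof.
move=> sf aF Ff ig Fg; apply: approximable_lim => // e e0.
have sF n : sqi mu D (F n) by case: (aF n).
pose h n x := ((f x - F n x) ^+ 2)%:E.
have mh n : measurable_fun D (h n).
  by apply/measurable_EFinP; apply: measurable_funX; have [] := sqiB mD sf (sF n).
have hc x : D x -> (h n x @[n --> \oo] --> 0%E)%classic.
  move=> Dx; apply: cvg_EFin; first exact: nearW.
  rewrite /h /comp/=.
  have : (f x - F n x) ^+ 2 @[n --> \oo] --> (f x - f x) ^+ 2.
    rewrite expr2; under eq_fun do rewrite expr2.
    by apply: cvgM; apply: cvgB; first [exact: cvg_cst|exact: Ff].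
  by rewrite subrr expr0n.
have [||||_ _] := @dominated_convergence _ _ _ mu D mD h (cst 0%E) (EFin \o g) mh.
- exact: measurable_cst.
- by apply: aeW => x; exact: hc.
- exact: ig.
- apply: aeW => x n Dx; rewrite /h/= lee_fin ger0_norm ?sqr_ge0//.
  exact: Fg.
rewrite integral0 => /fine_cvgP[_ /cvgrPdist_le/(_ _ e0)[n _ /(_ n (leqnn n))]].
rewrite /= sub0r normrN => H; exists (F n) => //.
apply: le_trans H; apply: le_trans (ler_norm _).
by rewrite /ip /Rintegral /h; under eq_integral do rewrite -expr2.
Qed.

(** Sets whose indicator, pulled back by [pi] and weighted by [b], lies in the closure of [V] form a
    Dynkin system: countable disjoint unions pass to the limit by dominated convergence. It
    therefore suffices to treat a generating class stable under intersection. *)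
Lemma approximable_dynkin d' (T' : measurableType d') (pi : T -> T') (b : T -> R)
    (G : set (set T')) (P := fun A : set T' => approximable (fun x => \1_A (pi x) * b x)) :
  measurable_fun D pi -> @measurable _ T' = <<s G >> -> setI_closed G ->
  measurable_fun D b -> (forall x, D x -> `|b x| <= 1) ->
  approximable b -> G `<=` P -> forall A, measurable A -> P A.
Proof.
move=> mpi mG GI mb b1 ab GP A mA.
have si (B : set T') : measurable B -> sqi mu D (fun x => \1_B (pi x) * b x).
  move=> mB; apply: (@sqi_bounded _ 1).
    apply: measurable_funM => //.
    by apply: (measurableT_comp _ mpi); exact: measurable_indic.
  move=> x Dx; rewrite normrM mulr_ile1 ?b1// indicE.
  by rewrite ger0_norm// lern1 leq_b1.
apply: (@dynkin_induction _ T' G P) => //.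
- by rewrite /P; under eq_fun do rewrite indicT mul1r.
- move=> B mB PB; rewrite /P.
  have -> : (fun x => \1_(~` B) (pi x) * b x) = (fun x => b x - \1_B (pi x) * b x).
    apply: funext => x; rewrite !indicE in_setC.
    by case: (_ \in _); rewrite /= ?mul0r ?mul1r ?subrr ?subr0.
  exact: approximableB.
- move=> F mF tF PF.
  have aS n : approximable (fun x => \sum_(k < n) \1_(F k) (pi x) * b x).
    by apply: approximable_sum => k; exact: PF.
  apply: (@approximable_dom (fun n x => \sum_(k < n) \1_(F k) (pi x) * b x) _ (fun=> 4)).
  + by apply: si; exact: bigcup_measurable.
  + exact: aS.
  + move=> x Dx; have [[k _ Fk]|nF] := pselect ((\bigcup_k F k) (pi x)).
      apply: cvg_near_cst; exists k.+1 => // n /= kn.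
      rewrite (bigD1 (Ordinal kn))//= big1 ?addr0 => [|j jk].
        by rewrite !indicE !mem_set//; exists k.
      rewrite indicE memNset ?mul0r// => Fj; move/eqP: jk; apply.
      by apply: val_inj => /=; apply: (tF _ _ I I); exists (pi x).
    apply: cvg_near_cst; apply: nearW => n.
    rewrite indicE memNset// mul0r big1// => j _.
    by rewrite indicE memNset ?mul0r// => Fj; apply: nF; exists j.
  + exact: integrable_const.
  + move=> n x Dx; rewrite -mulr_suml -mulrBl exprMn.
    have b2 : b x ^+ 2 <= 1 by rewrite -(real_normK (num_real _)) expr_le1 ?b1.
    have i1 (B : set T') : 0 <= (\1_B (pi x) : R) <= 1.
      by rewrite indicE ler0n lern1 leq_b1.
    have s1 : 0 <= (\sum_(k < n) \1_(F k) (pi x) : R) <= 1.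
      apply/andP; split; first by apply: sumr_ge0 => k _; case/andP: (i1 (F k)).
      have [[k Fk]|nF] := pselect (exists k : 'I_n, F k (pi x)).
        rewrite (bigD1 k)//= big1 ?addr0 => [|j jk]; first by case/andP: (i1 (F k)).
        rewrite indicE memNset// => Fj; move/eqP: jk; apply.
        by apply: val_inj => /=; apply: (tF _ _ I I); exists (pi x).
      rewrite big1// => j _; rewrite indicE memNset// => Fj; apply: nF.
      by exists j.
    have := i1 (\bigcup_k F k); have := sqr_ge0 (b x).
    move: s1 b2; move: (\sum_(_ < _) _) (\1_ _ _) (b x ^+ 2) => s t c.
    move=> /andP[s0 s1] c1 c0 /andP[t0 t1].
    have h : (t - s) ^+ 2 <= 1 by nra.
    by apply: le_trans (ler_pM (sqr_ge0 _) c0 h c1) _; rewrite mulr1 ler1n.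
- by rewrite -mG.
Qed.

Hypothesis indic_approx : forall A, measurable A -> approximable (\1_A : T -> R).

Lemma approximable_ge0 f : sqi mu D f -> (forall x, 0 <= f x) -> approximable f.
Proof.
move=> sf f0; have [mf f2] := sf.
have mEf : measurable_fun D (EFin \o f) by exact/measurable_EFinP.
have f0' : forall x, D x -> (0 <= (EFin \o f) x)%E.
  by move=> x _; rewrite /= lee_fin.
pose F n x : R := nnsfun_approx mD mEf n x.
have H := @approximable_dom F f (fun x => f x ^+ 2) sf.
apply: H => //.
- move=> n.
  pose A := nnsfun_approx mD mEf n.
  have -> : F n = A by apply: funext.
  rewrite (funext (fimfunEord A)).
  apply: approximable_sum => i; apply: approximableZ; exact: indic_approx.
- move=> x Dx; have /fine_cvgP[_] := cvg_nnsfun_approx mD mEf f0' Dx.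
  by [].
- move=> n x Dx; have h1 : (F n) x <= f x.
    rewrite /F nnsfun_approxE -lee_fin.
    exact: (le_approx n f0' Dx).
  have h2 : 0 <= F n x by exact: fun_ge0.
  have := f0 x; nra.
Qed.

Lemma approximable_all f : sqi mu D f -> approximable f.
Proof.
move=> sf; have [mf f2] := sf.
have sn : sqi mu D (fun x => `|f x|).
  split; first exact: measurableT_comp.
  by under [X in integrable _ _ (_ \o X)]eq_fun do rewrite real_normK ?num_real//.
have sp : sqi mu D (fun x => 2^-1 * (`|f x| + f x)) by apply: sqiZ => //; exact: sqiD.
have sm : sqi mu D (fun x => 2^-1 * (`|f x| - f x)) by apply: sqiZ => //; exact: sqiB.
have ap := approximable_ge0 sp; have am := approximable_ge0 sm.
have -> : f = (fun x => 2^-1 * (`|f x| + f x) - 2^-1 * (`|f x| - f x)).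
  by apply: funext => x; field.
apply: approximableB; [apply: ap|apply: am] => x.
  by rewrite mulr_ge0 ?invr_ge0//; have := ler_norm (- f x); rewrite normrN; lra.
by rewrite mulr_ge0 ?invr_ge0//; have := ler_norm (f x); lra.
Qed.

End Approximation.

Section SteepPolynomials.
Context {R : realType}.
Implicit Types (r t s : R) (n N : nat).

(** With p the midpoint of r and 1 one has r <= p^2, so r^n <= p^n p^n; one factor p^n absorbs n,
    since n (1 - p) p^n <= 1. *)
Lemma natmul_exp_le r n : 0 <= r < 1 -> n%:R * r ^+ n <= 2 / (1 - r) * ((r + 1) / 2) ^+ n.
Proof.
move=> /andP[r0 r1]; pose p := (r + 1) / 2.
have p0 : 0 < p by rewrite /p; lra.
have p1 : p < 1 by rewrite /p; lra.
have rp : r ^+ n <= p ^+ n * p ^+ n.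
  by rewrite -exprMn lerXn2r ?nnegrE ?mulr_ge0 ?(ltW p0)// /p; nra.
have bern : n%:R * (1 - p) * p ^+ n <= 1.
  have H : forall k, k%:R * (1 - p) * p ^+ k <= 1 - p ^+ k.
    elim=> [|k IH]; first by rewrite !mul0r expr0 subrr.
    have : 0 <= p ^+ k by rewrite exprn_ge0 ?ltW.
    rewrite exprS -natr1 => q0.
    have := ler_wpM2l (ltW p0) IH.
    have : 0 <= (1 - p) * (1 - p * p ^+ k).
      apply: mulr_ge0; rewrite subr_ge0 ?ltW// -exprS.
      by apply: exprn_ilt1; rewrite ?ltW.
    move: (p ^+ k) (k%:R : R) => q m.
    by move: (p) => a; clear; lra.
  by apply: le_trans (H n) _; rewrite lerBlDr lerDl exprn_ge0 ?ltW.
have -> : 2 / (1 - r) = (1 - p)^-1 by rewrite /p; field; rewrite /p; lra.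
rewrite -/p -ler_pdivrMl ?invr_gt0 ?subr_gt0// invrK.
have pn0 : 0 <= p ^+ n by rewrite exprn_ge0 ?ltW.
have := ler_wpM2r pn0 bern; rewrite mul1r; apply: le_trans.
have := ler_wpM2l (_ : 0 <= (1 - p) * n%:R) rp.
have c0 : 0 <= (1 - p) * n%:R by rewrite mulr_ge0 ?subr_ge0 // ltW.
by move=> /(_ c0); lra.
Qed.

(** Polynomials tending on [0, 1] to the indicator of t < 1/2. By Bernoulli the limit is governed by
    n 2^n t^n = n (2 t)^n, which tends to 0 or to infinity; the factor n settles the point t =
    1/2. *)
Definition steep n t : R := (1 - t ^+ n) ^+ (n * 2 ^ n).

Lemma steep_ge0_le1 n t : 0 <= t <= 1 -> 0 <= steep n t <= 1.
Proof.
move=> /andP[t0 t1]; have s0 : 0 <= t ^+ n by exact: exprn_ge0.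
have s1 : t ^+ n <= 1 by exact: exprn_ile1.
by rewrite /steep exprn_ge0 ?exprn_ile1 ?subr_ge0// lerBlDr lerDl.
Qed.

Lemma bernoulli s N : 0 <= s <= 1 -> 1 - N%:R * s <= (1 - s) ^+ N.
Proof.
move=> /andP[s0 s1]; elim: N => [|N IH]; first by rewrite mul0r subr0 expr0.
have N0 : 0 <= N%:R * s ^+ 2 :> R by rewrite mulr_ge0 ?sqr_ge0.
rewrite exprS -natr1; have := ler_wpM2l (_ : 0 <= 1 - s) IH.
by rewrite subr_ge0 => /(_ s1); nra.
Qed.

Lemma bernoulli_inv s N : 0 <= s <= 1 -> (1 - s) ^+ N * (1 + N%:R * s) <= 1.
Proof.
move=> /andP[s0 s1]; elim: N => [|N IH]; first by rewrite mul0r addr0 expr0 mulr1.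
rewrite exprS -natr1; apply: le_trans IH.
have : 0 <= (1 - s) ^+ N by rewrite exprn_ge0 ?subr_ge0.
move: (_ ^+ N) => q q0.
have N0 : 0 <= N%:R * s ^+ 2 :> R by rewrite mulr_ge0 ?sqr_ge0.
rewrite -mulrA mulrCA; apply: ler_wpM2l => //.
nra.
Qed.

Lemma steep_cvg t : 0 <= t <= 1 ->
  steep n t @[n --> \oo] --> ((t < 2^-1)%R%:R : R).
Proof.
move=> t01; have /andP[t0 t1] := t01.
have sn n : 0 <= t ^+ n <= 1 by rewrite exprn_ge0// exprn_ile1.
have Nt n : (n * 2 ^ n)%:R * t ^+ n = n%:R * (2 * t) ^+ n.
  by rewrite natrM natrX exprMn mulrA.
have [th|th] := ltP t 2^-1.
  apply: (@squeeze_cvgr _ _ _ _ (fun n => 1 - 2 / (1 - 2 * t) * ((2 * t + 1) / 2) ^+ n) (fun=> 1)).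
  - apply: nearW => n; have /andP[_ ->] := steep_ge0_le1 n t01; rewrite andbT.
    apply: le_trans (bernoulli _ (sn n)); rewrite Nt lerD2l lerN2.
    by apply: natmul_exp_le; lra.
  - rewrite -[X in _ --> X]subr0; apply: cvgB; first exact: cvg_cst.
    rewrite -(mulr0 (2 / (1 - 2 * t))); apply: cvgM; first exact: cvg_cst.
    by apply: cvg_expr; rewrite ger0_norm; lra.
  - exact: cvg_cst.
apply: (@squeeze_cvgr _ _ _ _ (fun=> 0) (fun n => n.+1%:R^-1)).
- apply: nearW => n; have /andP[-> _] := steep_ge0_le1 n t01; rewrite /=.
  have h := bernoulli_inv (n * 2 ^ n) (sn n).
  rewrite -[leRHS]mul1r ler_pdivlMr ?ltr0n//; apply: le_trans h.
  apply: ler_wpM2l; first by have /andP[] := steep_ge0_le1 n t01.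
  rewrite Nt -natr1 addrC lerD2l -[leLHS]mulr1; apply: ler_wpM2l; first exact: ler0n.
  by rewrite exprn_ege1//; lra.
- exact: cvg_cst.
- exact: cvg_harmonic.
Qed.

End SteepPolynomials.

(** * Closure of an algebra of bounded functions *)

Section ApproximationAlgebra.
Context d (T : measurableType d) {R : realType}.
Variables (mu : {measure set T -> \bar R}) (D : set T).
Hypothesis mD : measurable D.
Hypothesis muD : (mu D < +oo)%E.
Variable V : (T -> R) -> Prop.
Hypothesis V_sqi : forall f, V f -> sqi mu D f.
Hypothesis V_cst : forall a, V (fun=> a).
Hypothesis V_D : forall f g, V f -> V g -> V (fun x => f x + g x).
Hypothesis V_M : forall f g, V f -> V g -> V (fun x => f x * g x).
Hypothesis V_bdd : forall f, V f -> exists M, forall x, D x -> `|f x| <= M.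
Implicit Types f g : T -> R.
Let V_Z a f : V f -> V (fun x => a * f x) := V_M (V_cst a).

Lemma ip_bddM_le f g M : measurable_fun D f -> (forall x, D x -> `|f x| <= M) -> sqi mu D g ->
  ip mu D (fun x => f x * g x) (fun x => f x * g x) <= M ^+ 2 * ip mu D g g.
Proof.
move=> mf fM sg; have sfg := sqi_bddM mD mf fM sg.
have -> : M ^+ 2 * ip mu D g g = ip mu D (fun x => M * g x) (fun x => M * g x).
  by rewrite ipZl// ?ipZr//; [rewrite mulrA|exact: sqiZ].
apply: le_ip2 => //; first exact: sqiZ.
move=> x Dx; rewrite !exprMn ler_wpM2r ?sqr_ge0//.
have fx := fM x Dx.
by rewrite -[f x ^+ 2]real_normK ?num_real// ler_sqr ?nnegrE ?(le_trans _ fx).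
Qed.

(** One factor is approximated at a time: g by some h in [V] against the bounded f, then f against
    this fixed bounded h. *)
Lemma approximableM f g : (forall x, D x -> `|f x| <= 1) -> (forall x, D x -> `|g x| <= 1) ->
  approximable mu D V f -> approximable mu D V g -> approximable mu D V (fun x => f x * g x).
Proof.
move=> f1 g1 [sf af] [sg ag]; have mf := sf.1.
apply: (approximable_lim mD V_sqi); first exact: (sqi_bddM mD mf f1 sg).
move=> e e0; have [h Vh gh] := ag _ e0; have sh := V_sqi Vh.
exists (fun x => f x * h x); last first.
  have -> : (fun x => f x * g x - f x * h x) = (fun x => f x * (g x - h x)).
    by apply: funext => x; rewrite mulrBr.
  apply: le_trans (ip_bddM_le mf f1 (sqiB mD sg sh)) _.
  by rewrite expr1n mul1r.
split; first exact: (sqi_bddM mD mf f1 sh).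
move=> e' e'0; have [M hM] := V_bdd Vh.
have M0 : 0 < M ^+ 2 + 1 by rewrite ltr_wpDl ?sqr_ge0.
have [k Vk fk] := af _ (divr_gt0 e'0 M0).
exists (fun x => k x * h x); first exact: V_M.
have -> : (fun x => f x * h x - k x * h x) = (fun x => h x * (f x - k x)).
  by apply: funext => x; ring.
apply: le_trans (ip_bddM_le sh.1 hM (sqiB mD sf (V_sqi Vk))) _.
apply: le_trans (ler_wpM2l (sqr_ge0 M) fk) _.
by rewrite mulrCA ger_pMr// ler_pdivrMr// mul1r lerDl.
Qed.

Lemma V_exp f n : V f -> V (fun x => f x ^+ n).
Proof.
move=> Vf; elim: n => [|n IH]; first by under eq_fun do rewrite expr0.
by under eq_fun do rewrite exprS; exact: V_M.
Qed.

Lemma approximable_pos w : V w -> (forall x, D x -> `|w x| <= 2) ->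
  approximable mu D V (fun x => (0 < w x)%R%:R).
Proof.
move=> Vw w2; have mw := (V_sqi Vw).1.
(* This affine change maps [-2, 2] to [0, 1] and the condition w > 0 to t < 1/2, where the steep
   polynomials jump. *)
pose t x := 4^-1 * (2 + - 1 * w x).
have Vt : V t by apply: V_Z; apply: V_D => //; exact: V_Z.
have t01 x : D x -> 0 <= t x <= 1.
  by move=> /w2; rewrite ler_norml /t => /andP[? ?]; lra.
have Vs n : V (fun x => steep n (t x)).
  apply: V_exp.
  have -> : (fun x => 1 - t x ^+ n) = (fun x => 1 + - 1 * t x ^+ n).
    by apply: funext => x; ring.
  by apply: V_D => //; apply: V_Z; exact: V_exp.
have cs x : D x -> steep n (t x) @[n --> \oo] --> ((0 < w x)%R%:R : R).
  move=> Dx; have := steep_cvg (t01 x Dx).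
  suff -> : (t x < 2^-1) = (0 < w x) by [].
  by rewrite /t; apply/idP/idP; lra.
have ms : measurable_fun D (fun x => (0 < w x)%R%:R : R).
  apply: (measurable_fun_cvg (h := fun n x => steep n (t x))) => //.
  by move=> n; have [] := V_sqi (Vs n).
have ss : sqi mu D (fun x => (0 < w x)%R%:R).
  apply: (sqi_bounded mD muD (M := 1)) => // x _.
  by rewrite ger0_norm ?lern1 ?leq_b1.
apply: (approximable_dom mD V_sqi (F := fun n x => steep n (t x)) (g := fun=> 1)) => //.
- by move=> n; exact: (approximable_V V_sqi (Vs n)).
- exact: integrable_const.
- move=> n x Dx; have := steep_ge0_le1 n (t01 x Dx).
  by case: (0 < w x) => /=; nra.
Qed.

End ApproximationAlgebra.

(** * Trigonometric polynomials on the rectangle *)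

Section Rectangle.
Context {R : realType}.
Implicit Types (f g h : R * R -> R) (F G : R -> R) (m j : nat).

Definition ip2 f g : R := ip (@leb2 R) (@rect R) f g.

Lemma measurable_Ix : measurable (`[0, 2 * pi] : set (measurableTypeR R)).
Proof. exact: measurable_itv. Qed.

Lemma measurable_rect : measurable (@rect R : set (@plane R)).
Proof. exact: measurableX measurable_Ix measurable_I01. Qed.

Lemma leb2X (A B : set (measurableTypeR R)) : measurable A -> measurable B ->
  leb2 (A `*` B) = (lebesgue_measure A * lebesgue_measure B)%E.
Proof. by move=> mA mB; rewrite /leb2/= product_measure1E. Qed.

Lemma leb2_rect_lty : (leb2 (@rect R) < +oo)%E.
Proof.
rewrite (leb2X measurable_Ix measurable_I01).
rewrite !lebesgue_measure_itv/= !lte_fin ltr01 mulr_gt0 ?pi_gt0//.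
by rewrite -!EFinD -EFinM ltry.
Qed.

Lemma measurable_fst_cts (D : set (@plane R)) F : continuous F ->
  measurable_fun D (fun z => F z.1).
Proof.
move=> cF; apply: measurable_funTS; apply: (measurableT_comp _ measurable_fst).
exact: cts_measurable.
Qed.

Lemma measurable_snd_cts (D : set (@plane R)) F : continuous F ->
  measurable_fun D (fun z => F z.2).
Proof.
move=> cF; apply: measurable_funTS; apply: (measurableT_comp _ measurable_snd).
exact: cts_measurable.
Qed.

Inductive trigpoly : (R * R -> R) -> Prop :=
| trig_cos m j : trigpoly (fun z => cos (m%:R * z.1) * cos (wav j * z.2))
| trig_sin m j : trigpoly (fun z => sin (m%:R * z.1) * cos (wav j * z.2))
| trigD f g : trigpoly f -> trigpoly g -> trigpoly (fun z => f z + g z)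
| trigZ a f : trigpoly f -> trigpoly (fun z => a * f z).

Lemma trigpoly_bdd f : trigpoly f -> exists M, forall z, `|f z| <= M.
Proof.
elim=> [m j|m j|{}f g _ [M fM] _ [N gN]|a {}f _ [M fM]].
- by exists 1 => z; rewrite normrM mulr_ile1// ?ler_norml ?cos_geN1 ?cos_le1.
- by exists 1 => z; rewrite normrM mulr_ile1// ?ler_norml ?cos_geN1 ?cos_le1 ?sin_geN1 ?sin_le1.
- by exists (M + N) => z; apply: le_trans (ler_normD _ _) (lerD _ _).
- by exists (`|a| * M) => z; rewrite normrM ler_wpM2l.
Qed.

Lemma trigpoly_measurable (D : set (@plane R)) f : trigpoly f -> measurable_fun D f.
Proof.
elim=> [m j|m j|{}f g _ mf _ mg|a {}f _ mf].
- apply: measurable_funM; first exact: (measurable_fst_cts (@cts_cos_lin _ _)).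
  exact: (measurable_snd_cts (@cts_cos_lin _ _)).
- apply: measurable_funM; first exact: (measurable_fst_cts (@cts_sin_lin _ _)).
  exact: (measurable_snd_cts (@cts_cos_lin _ _)).
- exact: measurable_funD.
- exact: measurable_funM.
Qed.

Lemma trigpoly_sqi f : trigpoly f -> sqi (@leb2 R) (@rect R) f.
Proof.
move=> tf; have [M fM] := trigpoly_bdd tf.
apply: (sqi_bounded measurable_rect leb2_rect_lty (M := M)) => //.
exact: trigpoly_measurable.
Qed.

Lemma trigpoly_cst a : trigpoly (fun=> a).
Proof.
have := trigZ a (trig_cos 0 0).
by under eq_fun do rewrite /wav !mul0r cos0 !mulr1.
Qed.

(* Closure of trigonometric polynomials under products is proved by letting the
   generators act by multiplication. *)
Let mult p := forall f, trigpoly f -> trigpoly (fun z => p z * f z).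

Let multD p q : mult p -> mult q -> mult (fun z => p z + q z).
Proof.
by move=> mp mq f tf; under eq_fun do rewrite mulrDl; apply: trigD; [exact: mp|exact: mq].
Qed.

Let multZ a p : mult p -> mult (fun z => a * p z).
Proof. by move=> mp f tf; under eq_fun do rewrite -mulrA; apply: trigZ; exact: mp. Qed.

Let multM p q : mult p -> mult q -> mult (fun z => p z * q z).
Proof. by move=> mp mq f tf; under eq_fun do rewrite -mulrA; apply: mp; exact: mq. Qed.

Let multB p q : mult p -> mult q -> mult (fun z => p z - q z).
Proof.
move=> mp mq; have := multD mp (multZ (- 1) mq).
by under eq_fun do rewrite mulN1r.
Qed.

Let mult_cos1 : mult (fun z => cos z.1).
Proof.
move=> f; elim=> [m j|m j|{}f g _ tf _ tg|a {}f _ tf].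
- case: m => [|m].
    have := trig_cos 1 j; congr trigpoly; apply: funext => z.
    by rewrite mul1r mul0r cos0 mul1r.
  have := trigZ 2^-1 (trigD (trig_cos m.+2 j) (trig_cos m j)).
  congr trigpoly; apply: funext => z.
  have -> : m.+2%:R * z.1 = m.+1%:R * z.1 + z.1 by rewrite -[m.+2%:R]natr1; ring.
  have -> : m%:R * z.1 = m.+1%:R * z.1 - z.1 by rewrite -[m.+1%:R]natr1; ring.
  by rewrite cosB cosD; field.
- case: m => [|m].
    have := trigZ 0 (trig_cos 0 j); congr trigpoly; apply: funext => z.
    by rewrite !mul0r sin0 mul0r mulr0.
  have := trigZ 2^-1 (trigD (trig_sin m.+2 j) (trig_sin m j)).
  congr trigpoly; apply: funext => z.
  have -> : m.+2%:R * z.1 = m.+1%:R * z.1 + z.1 by rewrite -[m.+2%:R]natr1; ring.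
  have -> : m%:R * z.1 = m.+1%:R * z.1 - z.1 by rewrite -[m.+1%:R]natr1; ring.
  by rewrite sinD sinB; field.
- by under eq_fun do rewrite mulrDr; exact: trigD.
- by under eq_fun do rewrite mulrCA; exact: trigZ.
Qed.

Let mult_sin1 : mult (fun z => sin z.1).
Proof.
move=> f; elim=> [m j|m j|{}f g _ tf _ tg|a {}f _ tf].
- case: m => [|m].
    have := trig_sin 1 j; congr trigpoly; apply: funext => z.
    by rewrite mul1r mul0r cos0 mul1r.
  have := trigZ 2^-1 (trigD (trig_sin m.+2 j) (trigZ (-1) (trig_sin m j))).
  congr trigpoly; apply: funext => z.
  have -> : m.+2%:R * z.1 = m.+1%:R * z.1 + z.1 by rewrite -[m.+2%:R]natr1; ring.
  have -> : m%:R * z.1 = m.+1%:R * z.1 - z.1 by rewrite -[m.+1%:R]natr1; ring.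
  by rewrite sinD sinB; field.
- case: m => [|m].
    have := trigZ 0 (trig_cos 0 j); congr trigpoly; apply: funext => z.
    by rewrite !mul0r sin0 mul0r mulr0.
  have := trigZ 2^-1 (trigD (trig_cos m j) (trigZ (-1) (trig_cos m.+2 j))).
  congr trigpoly; apply: funext => z.
  have -> : m.+2%:R * z.1 = m.+1%:R * z.1 + z.1 by rewrite -[m.+2%:R]natr1; ring.
  have -> : m%:R * z.1 = m.+1%:R * z.1 - z.1 by rewrite -[m.+1%:R]natr1; ring.
  by rewrite cosB cosD; field.
- by under eq_fun do rewrite mulrDr; exact: trigD.
- by under eq_fun do rewrite mulrCA; exact: trigZ.
Qed.

Let mult_cos2 : mult (fun z => cos (wav 1 * z.2)).
Proof.
have w1 j (y : R) : wav j.+1 * y = wav j * y + wav 1 * y.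
  by rewrite /wav -[j.+1%:R]natr1; ring.
move=> f; elim=> [m j|m j|{}f g _ tf _ tg|a {}f _ tf].
- case: j => [|j].
    have := trig_cos m 1; congr trigpoly; apply: funext => z.
    by rewrite [wav 0]mul0r mul0r cos0 mulr1 mulrC.
  have := trigZ 2^-1 (trigD (trig_cos m j.+2) (trig_cos m j)).
  congr trigpoly; apply: funext => z.
  have -> : wav j * z.2 = wav j.+1 * z.2 - wav 1 * z.2 by rewrite w1; ring.
  by rewrite (w1 j.+1) cosB cosD; field.
- case: j => [|j].
    have := trig_sin m 1; congr trigpoly; apply: funext => z.
    by rewrite [wav 0]mul0r mul0r cos0 mulr1 mulrC.
  have := trigZ 2^-1 (trigD (trig_sin m j.+2) (trig_sin m j)).
  congr trigpoly; apply: funext => z.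
  have -> : wav j * z.2 = wav j.+1 * z.2 - wav 1 * z.2 by rewrite w1; ring.
  by rewrite (w1 j.+1) cosB cosD; field.
- by under eq_fun do rewrite mulrDr; exact: trigD.
- by under eq_fun do rewrite mulrCA; exact: trigZ.
Qed.

Let mult_cst a : mult (fun=> a).
Proof. by move=> f; exact: trigZ. Qed.

Let mult_trig1 m : mult (fun z => cos (m%:R * z.1)) /\ mult (fun z => sin (m%:R * z.1)).
Proof.
elim: m => [|m [IHc IHs]].
  have e (a : R) : 0 * a = 0 by rewrite mul0r.
  split; first by under eq_fun do rewrite e cos0; exact: mult_cst.
  by under eq_fun do rewrite e sin0; exact: mult_cst.
have e (a : R) : m.+1%:R * a = m%:R * a + a by rewrite -natr1 mulrDl mul1r.
split; under eq_fun do rewrite e ?cosD ?sinD.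
  exact: (multB (multM IHc mult_cos1) (multM IHs mult_sin1)).
exact: (multD (multM IHs mult_cos1) (multM IHc mult_sin1)).
Qed.

Let mult_trig2 j : mult (fun z => cos (wav j * z.2)).
Proof.
elim/ltn_ind: j => -[_|[_|j IH]].
- have e (a : R) : wav 0 * a = 0 by rewrite /wav !mul0r.
  by under eq_fun do rewrite e cos0; exact: mult_cst.
- exact: mult_cos2.
- have w1 i (y : R) : wav i.+1 * y = wav i * y + wav 1 * y.
    by rewrite /wav -[i.+1%:R]natr1; ring.
  have := multB (multZ 2 (multM mult_cos2 (IH j.+1 (ltnSn _)))) (IH j _).
  move=> /(_ (ltnW (ltnSn _))); congr mult; apply: funext => z.
  have -> : wav j * z.2 = wav j.+1 * z.2 - wav 1 * z.2 by rewrite w1; ring.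
  by rewrite (w1 j.+1) cosB cosD; ring.
Qed.

Lemma trigpolyM f g : trigpoly f -> trigpoly g -> trigpoly (fun z => f z * g z).
Proof.
move=> tf; move: g; suff : mult f by [].
elim: tf => [m j|m j|{}f g _ tf _ tg|a {}f _ tf].
- exact: (multM (mult_trig1 m).1 (mult_trig2 j)).
- exact: (multM (mult_trig1 m).2 (mult_trig2 j)).
- exact: multD.
- exact: multZ.
Qed.

End Rectangle.

Section Density.
Context {R : realType}.
Implicit Types (f g h : R * R -> R) (F G : R -> R) (m j : nat).

Let approx := approximable (@leb2 R) (@rect R) (@trigpoly R).
Let mD := @measurable_rect R.
Let muD := @leb2_rect_lty R.

(** An arc of the circle is where the cosine of the distance to its midpoint exceeds the cosine of
    its half-length; so its indicator is that of positivity of a trigonometric polynomial. *)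
Lemma cos_gt_interval (a x : R) : 0 <= a < 2 * pi -> 0 <= x <= 2 * pi ->
  (cos ((2 * pi - a) / 2) < cos (x - (a + 2 * pi) / 2)) = (a < x < 2 * pi).
Proof.
move=> /andP[a0 a2] /andP[x0 x2]; have p0 := pi_gt0 R.
pose c := (2 * pi - a) / 2; rewrite -/c.
have -> : x - (a + 2 * pi) / 2 = x - 2 * pi + c by rewrite /c; field.
have mem (y : R) : 0 <= y -> y <= pi -> y \in `[0, pi] by move=> *; rewrite in_itv/=; apply/andP.
have cI : c \in `[0, pi] by apply: mem; rewrite /c; lra.
have [xa|xa] := leP x a => /=.
  pose y := x - 2 * pi + c.
  apply/negbTE; rewrite -leNgt -/y.
  have [yp|yp] := leP (- pi) y.
    rewrite -cosN leNgt ltr_cos// -?leNgt; last by apply: mem; rewrite /y /c in yp *; lra.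
    by rewrite /y /c; lra.
  have -> : cos y = cos (y + pi *+ 2) by rewrite cosD2pi.
  rewrite leNgt ltr_cos// -?leNgt; last by apply: mem; rewrite /y /c in yp *; rewrite -mulr_natl; lra.
  by rewrite -mulr_natl /y /c; lra.
have [x2'|x2'] := ltP x (2 * pi); last first.
  apply/negbTE; have -> : x = 2 * pi by lra.
  by rewrite subrr add0r ltxx.
have [y0|y0] := leP 0 (x - 2 * pi + c).
  by rewrite ltr_cos//; [lra|apply: mem => //; rewrite /c; lra].
rewrite -[cos (x - _ + _)]cosN ltr_cos//; [rewrite /c; lra|by apply: mem; move: y0; rewrite /c; lra].
Qed.

Let V_bdd f : trigpoly f -> exists M : R, forall z, (@rect R) z -> `|f z| <= M.
Proof. by move=> /trigpoly_bdd[M fM]; exists M. Qed.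

Let posT := @approximable_pos _ (@plane R) R (@leb2 R) (@rect R) mD muD (@trigpoly R)
  (@trigpoly_sqi R) (@trigpoly_cst R) (@trigD R) (@trigpolyM R).
Let memT := @approximable_V _ (@plane R) R (@leb2 R) (@rect R) (@trigpoly R) (@trigpoly_sqi R).
Let aeT := @approximable_ae _ (@plane R) R (@leb2 R) (@rect R) mD (@trigpoly R) (@trigpoly_sqi R).
Let mulT := @approximableM _ (@plane R) R (@leb2 R) (@rect R) mD (@trigpoly R)
  (@trigpoly_sqi R) (@trigpolyM R) V_bdd.
Let dynT := @approximable_dynkin _ (@plane R) R (@leb2 R) (@rect R) mD muD (@trigpoly R)
  (@trigpoly_sqi R) (@trigpoly_cst R 0) (@trigD R) (@trigZ R).
Let allT := @approximable_all _ (@plane R) R (@leb2 R) (@rect R) mD (@trigpoly R)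
  (@trigpoly_sqi R) (@trigpoly_cst R 0) (@trigD R) (@trigZ R).

Lemma approx_pos w : trigpoly w -> (forall z, rect z -> `|w z| <= 2) ->
  approx (fun z => (0 < w z)%R%:R).
Proof. exact: posT. Qed.

Let approx_cst a : approx (fun=> a).
Proof. by apply: memT; exact: trigpoly_cst. Qed.

Lemma approx_eq f g : (forall z, rect z -> f z = g z) -> measurable_fun (rect : set (@plane R)) g ->
  approx f -> approx g.
Proof.
move=> fg mg af; have [sf _] := af; apply: (aeT _ af).
  split=> //; apply: (eq_integrable mD _ _ _ sf.2) => z /[!inE] Dz /=.
  by rewrite fg.
by apply: aeW => z Dz; rewrite fg.
Qed.

(** Half-lines generate the Borel sets; within [0, 2 pi], and up to a null set, a half-line is
    empty, everything, or an arc ending at 2 pi. *)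
Lemma approx_indic1 (A : set (measurableTypeR R)) : measurable A ->
  approx (fun z => \1_A z.1).
Proof.
move=> mA.
have H := @dynT _ (measurableTypeR R) fst (fun=> 1) _ _ (RGenOInfty.measurableE R) _ _ _ _ _ A mA.
suff : approx (fun z => \1_A z.1 * 1) by congr approx; apply: funext => z; rewrite mulr1.
apply: H.
- by apply: measurable_funTS; exact: measurable_fst.
- move=> _ _ [a ->] [b ->]; exists (Num.max a b).
  rewrite eqEsubset; split=> x; rewrite /= !in_itv/= !andbT gt_max.
    by case=> -> ->.
  by move=> /andP[].
- exact: measurable_cst.
- by move=> z _; rewrite normr1.
- exact: approx_cst.
move=> _ [a ->].
have mi : measurable_fun (rect : set (@plane R)) (fun z => \1_(`]a, +oo[%classic : set (measurableTypeR R)) z.1 * 1 : R).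
  apply: measurable_funM => //; apply: measurable_funTS.
  by apply: (measurableT_comp _ measurable_fst); exact: measurable_indic.
have [a0|a0] := ltP a 0.
  apply: (approx_eq (f := fun=> 1)) => //.
  move=> z [/=]; rewrite in_itv/= => /andP[z0 _] _.
  by rewrite mulr1 indicE mem_set//= in_itv/= andbT (lt_le_trans a0).
have [a2|a2] := leP (2 * pi) a.
  apply: (approx_eq (f := fun=> 0)) => //.
  move=> z [/=]; rewrite in_itv/= => /andP[_ z2] _.
  rewrite mulr1 indicE memNset//= in_itv/= andbT => az.
  by have := lt_le_trans az (le_trans z2 a2); rewrite ltxx.
have a02 : 0 <= a < 2 * pi by rewrite a0.
pose b := (a + 2 * pi) / 2; pose c : R := cos ((2 * pi - a) / 2).
pose w (z : R * R) := cos b * (cos (1%:R * z.1) * cos (wav 0 * z.2))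
   + sin b * (sin (1%:R * z.1) * cos (wav 0 * z.2)) + - c.
have wE z : w z = cos (z.1 - b) - c.
  by rewrite /w /wav !mul0r cos0 !mul1r !mulr1 cosB; ring.
have tw : trigpoly w.
  exact: (trigD (trigD (trigZ _ (trig_cos 1 0)) (trigZ _ (trig_sin 1 0))) (trigpoly_cst _)).
have aw : approx (fun z => (0 < w z)%R%:R).
  apply: approx_pos => // z _; rewrite wE; apply: le_trans (ler_normB _ _) _.
  by rewrite -[leRHS]/(1 + 1) lerD// ler_norml cos_geN1 cos_le1.
apply: (aeT _ aw).
  by apply: (sqi_bounded mD muD (M := 1)) => // z _; rewrite mulr1 indicE ger0_norm ?lern1 ?leq_b1.
(* On the line x = 2 pi, periodicity makes the polynomial nonpositive although the indicator is 1;
   this line is a null set. *)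
exists ([set 2 * pi] `*` setT); split.
- by apply: measurableX => //; exact: measurable_set1.
- rewrite (leb2X (@measurable_set1 R _) measurableT).
  by rewrite lebesgue_measure_set1 mul0e.
- move=> z /= /not_implyP[zr nz]; split=> //=; apply: contrapT => z2; apply: nz.
  have [/= +  _] := zr; rewrite in_itv/= => z02.
  rewrite mulr1 indicE wE subr_gt0 /c cos_gt_interval//.
  have zlt : z.1 < 2 * pi by rewrite lt_neqAle; case/andP: z02 => _ ->; rewrite andbT; apply/eqP.
  rewrite zlt andbT; congr ((nat_of_bool _)%:R); apply/idP/idP; first by rewrite inE/= in_itv/= andbT.
  by move=> az; rewrite inE/= in_itv/= andbT.
Qed.

Lemma approx_indic2 (B : set (measurableTypeR R)) : measurable B ->
  approx (fun z => \1_B z.2).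
Proof.
move=> mB.
have H := @dynT _ (measurableTypeR R) snd (fun=> 1) _ _ (RGenOInfty.measurableE R) _ _ _ _ _ B mB.
suff : approx (fun z => \1_B z.2 * 1) by congr approx; apply: funext => z; rewrite mulr1.
apply: H.
- by apply: measurable_funTS; exact: measurable_snd.
- move=> _ _ [a ->] [b ->]; exists (Num.max a b).
  rewrite eqEsubset; split=> x; rewrite /= !in_itv/= !andbT gt_max.
    by case=> -> ->.
  by move=> /andP[].
- exact: measurable_cst.
- by move=> z _; rewrite normr1.
- exact: approx_cst.
move=> _ [b ->].
have mi : measurable_fun (rect : set (@plane R)) (fun z => \1_(`]b, +oo[%classic : set (measurableTypeR R)) z.2 * 1 : R).
  apply: measurable_funM => //; apply: measurable_funTS.
  by apply: (measurableT_comp _ measurable_snd); exact: measurable_indic.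
have [b0|b0] := ltP b 0.
  apply: (approx_eq (f := fun=> 1)) => //.
  move=> z [_ /=]; rewrite /I01/= in_itv/= => /andP[z0 _].
  by rewrite mulr1 indicE mem_set//= in_itv/= andbT (lt_le_trans b0).
have [b1|b1] := leP 1 b.
  apply: (approx_eq (f := fun=> 0)) => //.
  move=> z [_ /=]; rewrite /I01/= in_itv/= => /andP[_ z2].
  rewrite mulr1 indicE memNset//= in_itv/= andbT => az.
  by have := lt_le_trans az (le_trans z2 b1); rewrite ltxx.
(* The function cos (pi y) decreases strictly on [0, 1], so w > 0 exactly when y > b. *)
pose w (z : R * R) := cos (wav 1 * b) + (-1) * (cos (0%:R * z.1) * cos (wav 1 * z.2)).
have wE z : w z = cos (pi * b) - cos (pi * z.2).
  by rewrite /w /wav !mul0r cos0 !mul1r mulN1r.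
have tw : trigpoly w by exact: (trigD (trigpoly_cst _) (trigZ _ (trig_cos 0 1))).
apply: approx_eq (approx_pos tw _) => //.
  move=> z [_ /=]; rewrite /I01/= in_itv/= => /andP[z0 z1].
  have p0 := pi_gt0 R.
  rewrite mulr1 wE subr_gt0 ltr_cos ?in_itv/= ?mulr_ge0 ?(ltW p0)//=; last 2 first.
  - by rewrite -[leRHS]mulr1 ler_pM2l// ltW.
  - by rewrite -[leRHS]mulr1 ler_pM2l.
  rewrite ltr_pM2l// indicE; congr ((nat_of_bool _)%:R); apply/idP/idP; last by rewrite inE/= in_itv/= andbT.
  by move=> az; rewrite inE/= in_itv/= andbT.
move=> z _; rewrite wE; apply: le_trans (ler_normB _ _) _.
by rewrite -[leRHS]/(1 + 1) lerD// ler_norml cos_geN1 cos_le1.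
Qed.

Lemma approx_indic (A : set (@plane R)) : measurable A -> approx (\1_A : R * R -> R).
Proof.
move=> mA.
have H := @dynT _ (@plane R) id (fun=> 1) _ _ (measurable_prod_measurableType _ _) _ _ _ _ _ A mA.
suff : approx (fun z => \1_A (id z) * 1) by congr approx; apply: funext => z; rewrite mulr1.
apply: H.
- exact: measurable_id.
- move=> _ _ [A1 mA1 [A2 mA2 <-]] [B1 mB1 [B2 mB2 <-]].
  exists (A1 `&` B1); first exact: measurableI.
  exists (A2 `&` B2); first exact: measurableI.
  by rewrite setXI.
- exact: measurable_cst.
- by move=> z _; rewrite normr1.
- exact: approx_cst.
move=> _ [A1 mA1 [A2 mA2 <-]].
have -> : (fun z => \1_(A1 `*` A2) (id z) * 1) = (fun z => \1_A1 z.1 * \1_A2 z.2) :> (R * R -> R).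
  apply: funext => z; rewrite mulr1 !indicE -natrM mulnb; congr (_%:R).
  by rewrite in_setX.
have i1 (B : set R) (x : R) : `|\1_B x| <= 1 :> R.
  by rewrite indicE ger0_norm ?lern1 ?leq_b1.
apply: mulT => //; [exact: approx_indic1|exact: approx_indic2].
Qed.

Lemma trigpoly_dense f : sqi (@leb2 R) (@rect R) f -> forall e, 0 < e ->
  exists2 g, trigpoly g & ip2 (fun z => f z - g z) (fun z => f z - g z) <= e.
Proof.
by move=> sf; have [] := allT approx_indic sf.
Qed.

End Density.

(** * Integrals of products of one-variable functions *)

Section ProductIntegral.
Context {R : realType}.
Implicit Types (F G : R -> R).

Let leb := @lebesgue_measure R.
Let Ix : set (measurableTypeR R) := `[0, 2 * pi].
Let Iy : set (measurableTypeR R) := @I01 R.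

Lemma integralX_full F G : leb.-integrable setT (EFin \o F) -> leb.-integrable setT (EFin \o G) ->
  (@leb2 R).-integrable setT (EFin \o (fun z => F z.1 * G z.2)) /\
  \int[@leb2 R]_z (F z.1 * G z.2) = (\int[leb]_x F x) * (\int[leb]_y G y).
Proof.
move=> iF iG; have /integrableP[mF fF] := iF; have /integrableP[mG fG] := iG.
have mF' : measurable_fun (setT : set (measurableTypeR R)) F by exact/measurable_EFinP.
have mG' : measurable_fun (setT : set (measurableTypeR R)) G by exact/measurable_EFinP.
have mf : measurable_fun (setT : set (@plane R)) (EFin \o (fun z => F z.1 * G z.2)).
  apply/measurable_EFinP; apply: measurable_funM.
    exact: (measurableT_comp mF' measurable_fst).
  exact: (measurableT_comp mG' measurable_snd).
have fin (H : R -> R) : leb.-integrable setT (EFin \o H) ->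
    (\int[leb]_x (H x)%:E)%E = (\int[leb]_x H x)%:E.
  by move=> iH; rewrite /Rintegral fineK//; exact: integrable_fin_num.
have fi : (@leb2 R).-integrable setT (EFin \o (fun z => F z.1 * G z.2)).
  apply/(@integrable12ltyP _ _ _ _ _ leb leb _ mf) => /=.
  have nG := integrable_norm iG.
  under eq_integral => x _.
    under eq_integral do rewrite normrM EFinM.
    rewrite ge0_integralZl//; last exact/measurable_EFinP/measurableT_comp.
    rewrite (fin (fun y => `|G y|))//.
    over.
  rewrite ge0_integralZr//.
  - rewrite (fin (fun y => `|F y|)) -?EFinM ?ltry//.
    exact: (integrable_norm iF).
  - exact/measurable_EFinP/measurableT_comp.
  - by rewrite lee_fin; apply: Rintegral_ge0.
split=> //.
rewrite {1}/Rintegral -(@integral12_prod_meas1 _ _ _ _ _ leb leb _ fi).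
rewrite /fubini_F /=.
under eq_integral => x _.
  under eq_integral do rewrite EFinM.
  rewrite integralZl// fin//.
  over.
by rewrite integralZr// fin// -EFinM.
Qed.

Lemma restrict_rect F G z : ((fun z => F z.1 * G z.2) \_ (@rect R)) z =
  (F \_ Ix) z.1 * (G \_ Iy) z.2.
Proof.
rewrite !patchE /rect in_setX.
by case: (z.1 \in _); case: (z.2 \in _); rewrite /= ?mul0r ?mulr0.
Qed.

Lemma rect_integralX F G : leb.-integrable Ix (EFin \o F) -> leb.-integrable Iy (EFin \o G) ->
  (@leb2 R).-integrable (@rect R) (EFin \o (fun z => F z.1 * G z.2)) /\
  \int[@leb2 R]_(z in @rect R) (F z.1 * G z.2) =
    (\int[leb]_(x in Ix) F x) * (\int[leb]_(y in Iy) G y).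
Proof.
move=> iF iG.
have iF' : leb.-integrable setT (EFin \o (F \_ Ix)).
  rewrite -restrict_EFin; apply/integrable_restrict => //; first exact: measurable_Ix.
  by rewrite setTI.
have iG' : leb.-integrable setT (EFin \o (G \_ Iy)).
  rewrite -restrict_EFin; apply/integrable_restrict => //.
  by rewrite setTI.
have [i e] := integralX_full iF' iG'.
have rE := funext (restrict_rect F G).
split; last by rewrite Rintegral_mkcond rE e -!Rintegral_mkcond.
apply/(@integrable_mkcond _ (@plane R) R (@leb2 R) (@rect R) _ (@measurable_rect R)).
by rewrite restrict_EFin rE.
Qed.

End ProductIntegral.

(** Sine or cosine in x, frequency in x, frequency in y. *)
Notation idx N := (bool * 'I_N * 'I_N)%type.

(** * Complete orthonormal system of the rectangle *)

Section Basis.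
Context {R : realType}.
Implicit Types (f g h : R * R -> R) (F G : R -> R) (m j N : nat).

Definition ipx F G : R := ip (@lebesgue_measure R) `[0, 2 * pi] F G.

Lemma cts_sqix F : continuous F -> sqi (@lebesgue_measure R) `[0, 2 * pi] F.
Proof.
move=> cF; split; first exact: cts_measurable.
by apply: cts_integrable; exact: ctsX.
Qed.

Lemma sqi_prod F G : sqi (@lebesgue_measure R) `[0, 2 * pi] F ->
  sqi (@lebesgue_measure R) I01 G -> sqi (@leb2 R) (@rect R) (fun z => F z.1 * G z.2).
Proof.
move=> [mF iF] [mG iG]; split.
  apply: measurable_funM.
    apply: (measurable_comp (F := `[0, 2 * pi]%classic)) => //.
    - by move=> _ [z [? ?] <-].
    - by apply: measurable_funTS; exact: measurable_fst.
  apply: (measurable_comp (F := @I01 R) (@measurable_I01 R)) => //.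
  - by move=> _ [z [? ?] <-].
  - by apply: measurable_funTS; exact: measurable_snd.
have [+ _] := rect_integralX iF iG.
by congr integrable; apply: funext => z /=; rewrite exprMn.
Qed.

Lemma ip2X F1 G1 F2 G2 : sqi (@lebesgue_measure R) `[0, 2 * pi] F1 ->
  sqi (@lebesgue_measure R) `[0, 2 * pi] F2 ->
  sqi (@lebesgue_measure R) I01 G1 -> sqi (@lebesgue_measure R) I01 G2 ->
  ip2 (fun z => F1 z.1 * G1 z.2) (fun z => F2 z.1 * G2 z.2) = ipx F1 F2 * ip1 G1 G2.
Proof.
move=> sF1 sF2 sG1 sG2.
have [_ <-] := rect_integralX (sqi_mul (@measurable_Ix R) sF1 sF2) (sqi_mul (@measurable_I01 R) sG1 sG2).
by apply: eq_Rintegral => z _; rewrite mulrACA.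
Qed.

Definition xw m : R := if m is 0 then (Num.sqrt (2 * pi))^-1 else (Num.sqrt pi)^-1.
(* xb true 0 = 0: the sine family has no mode 0, and the Gram matrices below have
   a zero diagonal entry there. The sign makes the derivative exchange xb b m and
   xb (~~ b) m up to the factor m or - m. *)
Definition xb (b : bool) m (x : R) : R :=
  if b then - (xw m * sin (m%:R * x)) else xw m * cos (m%:R * x).

Lemma xw_gt0 m : 0 < xw m.
Proof. by case: m => [|m]; rewrite /xw invr_gt0 sqrtr_gt0 ?mulr_gt0 ?pi_gt0. Qed.

Lemma xw_sqr m : xw m ^+ 2 = (if m is 0 then (2 * pi)^-1 else pi^-1).
Proof. by case: m => [|m]; rewrite /xw exprVn sqr_sqrtr ?mulr_ge0 ?pi_ge0. Qed.

Lemma der_xb b m (x : R) : is_derive x 1 (xb b m)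
  ((if b then - m%:R else m%:R) * xb (~~ b) m x).
Proof.
case: b; rewrite /xb/=.
  by apply: (is_derive_eq (derN (derZ _ (der_sin_lin _ _)))); ring.
by apply: (is_derive_eq (derZ _ (der_cos_lin _ _))); ring.
Qed.

Lemma cts_xb b m : continuous (xb b m).
Proof. exact: (der_continuous (der_xb b m)). Qed.

Lemma ipx_cos m : \int[lebesgue_measure]_(x in `[0, 2 * pi]) cos (m%:R * x) =
  2 * pi * (m == 0)%:R :> R.
Proof.
have p0 : 0 <= 2 * pi :> R by rewrite mulr_ge0 ?pi_ge0.
case: m => [|m].
  have d0 (y : R) : is_derive y 1 (fun y : R => y) (cos (0%:R * y)).
    by rewrite mul0r cos0; exact: der_id.
  by rewrite (FTC2 p0 d0) ?subr0 ?mulr1//; exact: cts_cos_lin.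
have n0 : m.+1%:R != 0 :> R by rewrite pnatr_eq0.
have d0 (y : R) : is_derive y 1 (fun y : R => m.+1%:R^-1 * sin (m.+1%:R * y)) (cos (m.+1%:R * y)).
  by apply: (is_derive_eq (derZ _ (der_sin_lin _ _))); rewrite mulKf.
rewrite (FTC2 p0 d0); last exact: cts_cos_lin.
rewrite mulr0 sin0 mulr0 subr0 /= mulr0.
have -> : m.+1%:R * (2 * pi) = wav (m.+1 * 2)%N :> R by rewrite /wav natrM mulrA.
by rewrite sin_wav mulr0.
Qed.

Lemma ipx_sin m : \int[lebesgue_measure]_(x in `[0, 2 * pi]) sin (m%:R * x) = 0 :> R.
Proof.
have p0 : 0 <= 2 * pi :> R by rewrite mulr_ge0 ?pi_ge0.
case: m => [|m].
  by under eq_Rintegral do rewrite mul0r sin0; rewrite /Rintegral integral0.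
have n0 : m.+1%:R != 0 :> R by rewrite pnatr_eq0.
have d0 (y : R) : is_derive y 1 (fun y : R => - m.+1%:R^-1 * cos (m.+1%:R * y)) (sin (m.+1%:R * y)).
  apply: (is_derive_eq (derZ _ (der_cos_lin _ _))).
  by rewrite mulrNN mulKf.
rewrite (FTC2 p0 d0); last exact: cts_sin_lin.
have -> : m.+1%:R * (2 * pi) = wav m.+1 + wav m.+1 :> R by rewrite /wav; ring.
have := cos2Dsin2 (wav m.+1 : R).
rewrite cosD sin_wav mul0r subr0 expr0n addr0 -expr2 => ->.
by rewrite mulr0 cos0 subrr.
Qed.

Let int_cos m n : (\int[lebesgue_measure]_(x in `[0, 2 * pi])
    (2^-1 * cos (m%:R * x) + 2^-1 * cos (n%:R * x)) : R) =
  pi * (m == 0)%:R + pi * (n == 0)%:R.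
Proof.
have ic k : (@lebesgue_measure R).-integrable `[0, 2 * pi] (EFin \o (fun x => 2^-1 * cos (k%:R * x))).
  by apply: cts_integrable; apply: ctsZ; exact: cts_cos_lin.
have ik k : (@lebesgue_measure R).-integrable `[0, 2 * pi] (EFin \o (fun x => cos (k%:R * x))).
  by apply: cts_integrable; exact: cts_cos_lin.
rewrite RintegralD//.
by rewrite !RintegralZl// !ipx_cos; field.
Qed.

Lemma ipx_cos_cos m n : ipx (fun x => cos (m%:R * x)) (fun x => cos (n%:R * x)) =
  pi * ((m == n)%:R + (m + n == 0)%N%:R).
Proof.
wlog nm : m n / (n <= m)%N.
  move=> H; have [|/ltnW] := leqP n m; first exact: H.
  by move=> /H; rewrite /ipx ipC eq_sym addnC.
rewrite mulrDr -(subnK nm).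
have -> : (m - n + n == n)%N = (m - n == 0)%N by rewrite -[X in _ == X]add0n eqn_add2r.
rewrite -int_cos subnK//; apply: eq_Rintegral => x _.
by rewrite natrD natrB// mulrBl mulrDl cosB cosD; field.
Qed.

Lemma ipx_sin_sin m n : ipx (fun x => sin (m%:R * x)) (fun x => sin (n%:R * x)) =
  pi * ((m == n)%:R - (m + n == 0)%N%:R).
Proof.
have sc k : sqi (@lebesgue_measure R) `[0, 2 * pi] (fun x => cos (k%:R * x)).
  by apply: cts_sqix; exact: cts_cos_lin.
wlog nm : m n / (n <= m)%N.
  move=> H; have [|/ltnW] := leqP n m; first exact: H.
  by move=> /H; rewrite /ipx ipC eq_sym addnC.
have e : ipx (fun x => sin (m%:R * x)) (fun x => sin (n%:R * x)) =
    ipx (fun x => cos ((m - n)%:R * x)) (fun=> 1) -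
    ipx (fun x => cos (m%:R * x)) (fun x => cos (n%:R * x)).
  rewrite /ipx /ip -RintegralB//; last 2 first.
  - by apply: sqi_mul => //; apply: cts_sqix; exact: cts_cst.
  - by apply: sqi_mul.
  by apply: eq_Rintegral => x _; rewrite natrB// mulrBl cosB; ring.
rewrite e ipx_cos_cos.
have -> : ipx (fun x => cos ((m - n)%:R * x)) (fun=> 1) = 2 * pi * (m == n)%:R.
  rewrite /ipx /ip; under eq_Rintegral do rewrite mulr1.
  by rewrite ipx_cos subn_eq0 eqn_leq nm andbT.
ring.
Qed.

Lemma ipx_sin_cos m n : ipx (fun x => sin (m%:R * x)) (fun x => cos (n%:R * x)) = 0.
Proof.
have int_sin k l a b : (\int[lebesgue_measure]_(x in `[0, 2 * pi])
    (a * sin (k%:R * x) + b * sin (l%:R * x)) : R) = 0.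
  have ik i : (@lebesgue_measure R).-integrable `[0, 2 * pi] (EFin \o (fun x => sin (i%:R * x))).
    by apply: cts_integrable; exact: cts_sin_lin.
  have ic i c : (@lebesgue_measure R).-integrable `[0, 2 * pi] (EFin \o (fun x => c * sin (i%:R * x))).
    by apply: cts_integrable; apply: ctsZ; exact: cts_sin_lin.
  rewrite RintegralD//.
  by rewrite !RintegralZl// !ipx_sin; ring.
have [nm|/ltnW nm] := leqP n m.
  rewrite -(int_sin (m + n)%N (m - n)%N 2^-1 2^-1); apply: eq_Rintegral => x _.
  by rewrite natrD natrB// mulrBl mulrDl sinB sinD; field.
rewrite -(int_sin (m + n)%N (n - m)%N 2^-1 (- 2^-1)); apply: eq_Rintegral => x _.
by rewrite natrD natrB// mulrBl mulrDl sinB sinD; field.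
Qed.

Lemma xb_orthonormal b m c n : ipx (xb b m) (xb c n) =
  [&& b == c, m == n & ~~ (b && (m == 0%N))]%:R.
Proof.
have sc k : sqi (@lebesgue_measure R) `[0, 2 * pi] (fun x => cos (k%:R * x)).
  by apply: cts_sqix; exact: cts_cos_lin.
have ss k : sqi (@lebesgue_measure R) `[0, 2 * pi] (fun x => sin (k%:R * x)).
  by apply: cts_sqix; exact: cts_sin_lin.
have mx := @measurable_Ix R.
have p0 : pi != 0 :> R by rewrite gt_eqF ?pi_gt0.
have w2 : xw m * xw m = xw m ^+ 2 by rewrite expr2.
case: b; case: c; rewrite /xb /ipx /=.
- have -> : (fun x => - (xw m * sin (m%:R * x))) = (fun x => - xw m * sin (m%:R * x)).
    by apply: funext => x; rewrite mulNr.
  have -> : (fun x => - (xw n * sin (n%:R * x))) = (fun x => - xw n * sin (n%:R * x)).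
    by apply: funext => x; rewrite mulNr.
  rewrite ipZl// ?ipZr//; [|exact: sqiZ].
  rewrite -/(ipx _ _) ipx_sin_sin addn_eq0; have [<-|] := eqVneq m n; last first.
    by case: m {w2} => [|m]; case: n => [|n]//=; rewrite subrr !mulr0.
  rewrite mulrA mulrNN w2 xw_sqr; case: m {w2} => [|m] /=; first by rewrite subrr !mulr0.
  by rewrite subr0 mulr1 mulVf.
- have -> : (fun x => - (xw m * sin (m%:R * x))) = (fun x => - xw m * sin (m%:R * x)).
    by apply: funext => x; rewrite mulNr.
  rewrite ipZl// ?ipZr//; [|exact: sqiZ].
  by rewrite -/(ipx _ _) ipx_sin_cos !mulr0.
- have -> : (fun x => - (xw n * sin (n%:R * x))) = (fun x => - xw n * sin (n%:R * x)).
    by apply: funext => x; rewrite mulNr.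
  rewrite ipZl// ?ipZr//; [|exact: sqiZ].
  by rewrite ipC -/(ipx _ _) ipx_sin_cos !mulr0.
- rewrite ipZl// ?ipZr//; [|exact: sqiZ].
  rewrite -/(ipx _ _) ipx_cos_cos addn_eq0 andbT; have [<-|] := eqVneq m n; last first.
    by case: m {w2} => [|m]; case: n => [|n]//=; rewrite addr0 !mulr0.
  rewrite mulrA w2 xw_sqr; case: m {w2} => [|m] /=; last by rewrite addr0 mulr1 mulVf.
  by rewrite (_ : 1 + 1 = 2)// (mulrC pi) mulVf// mulf_neq0.
Qed.

Definition bas b m j : R * R -> R := fun z => xb b m z.1 * cosb j z.2.

Lemma sqi_bas b m j : sqi (@leb2 R) (@rect R) (bas b m j).
Proof. by apply: sqi_prod; [apply: cts_sqix; exact: cts_xb|apply: cts_sqi; exact: cts_cosb]. Qed.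

Lemma bas_orthonormal b m j c n l : ip2 (bas b m j) (bas c n l) =
  [&& b == c, m == n, j == l & ~~ (b && (m == 0%N))]%:R.
Proof.
have sx d k : sqi (@lebesgue_measure R) `[0, 2 * pi] (xb d k) by apply: cts_sqix; exact: cts_xb.
have sc k : sqi (@lebesgue_measure R) I01 (cosb k) by apply: cts_sqi; exact: cts_cosb.
rewrite /bas ip2X//.
rewrite xb_orthonormal cosb_orthonormal -natrM mulnb; congr ((nat_of_bool _)%:R).
by rewrite -!andbA (andbC (~~ _)).
Qed.

Definition basi N (i : idx N) := bas i.1.1 i.1.2 i.2.

Lemma basi_orthonormal N (i k : idx N) : ip2 (basi i) (basi k) =
  ((i == k) && ~~ (i.1.1 && (i.1.2 == 0 :> nat)))%:R.
Proof.
case: i k => [[b m] j] [[c n] l]; rewrite bas_orthonormal /=.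
congr ((nat_of_bool _)%:R); rewrite !xpair_eqE -!(inj_eq val_inj)/= -!andbA.
by [].
Qed.

Lemma trigpoly_span f : trigpoly f -> exists N0, forall N, (N0 <= N)%N ->
  exists a : idx N -> R, f = (fun z => \sum_i a i * basi i z).
Proof.
have w0 m : xw m != 0 by rewrite gt_eqF ?xw_gt0.
have c0 j : cosw j != 0 :> R.
  by case: j => [|j]; rewrite /cosw ?oner_eq0// gt_eqF// sqrtr_gt0.
elim=> [m j|m j|{}f g _ [N1 H1] _ [N2 H2]|a {}f _ [N1 H1]].
- exists (maxn m j).+1 => N; rewrite gtn_max => /andP[mN jN].
  exists (fun i => (i == (false, Ordinal mN, Ordinal jN))%:R * ((xw m)^-1 / cosw j)).
  apply: funext => z; rewrite (bigD1 (false, Ordinal mN, Ordinal jN))//= eqxx big1 ?addr0.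
    by rewrite /basi /bas /xb /cosb /=; field; rewrite w0 c0.
  by move=> i /negPf ->; rewrite !mul0r.
- exists (maxn m j).+1 => N; rewrite gtn_max => /andP[mN jN].
  exists (fun i => (i == (true, Ordinal mN, Ordinal jN))%:R * (- (xw m)^-1 / cosw j)).
  apply: funext => z; rewrite (bigD1 (true, Ordinal mN, Ordinal jN))//= eqxx big1 ?addr0.
    by rewrite /basi /bas /xb /cosb /=; field; rewrite w0 c0.
  by move=> i /negPf ->; rewrite !mul0r.
- exists (maxn N1 N2) => N; rewrite geq_max => /andP[/H1[a ->] /H2[b ->]].
  exists (fun i => a i + b i); apply: funext => z.
  by rewrite -big_split; apply: eq_bigr => i _; rewrite mulrDl.
- exists N1 => N /H1[b ->]; exists (fun i => a * b i); apply: funext => z.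
  by rewrite mulr_sumr; apply: eq_bigr => i _; rewrite mulrA.
Qed.

Lemma bas_bessel N f : sqi (@leb2 R) (@rect R) f ->
  \sum_(i : idx N) ip2 f (basi i) ^+ 2 <= ip2 f f.
Proof.
apply: (@bessel _ _ _ _ _ (@measurable_rect R) _ (fun i : idx N => ~~ (i.1.1 && (i.1.2 == 0 :> nat)))).
- by move=> i; exact: sqi_bas.
- exact: basi_orthonormal.
Qed.

Lemma bas_complete f : sqi (@leb2 R) (@rect R) f -> forall e, 0 < e ->
  exists N0, forall N, (N0 <= N)%N ->
  ip2 f f - \sum_(i : idx N) ip2 f (basi i) ^+ 2 <= e.
Proof.
move=> sf e e0; have [g /trigpoly_span[N0 H] fg] := trigpoly_dense sf e0.
exists N0 => N /H[a ga]; apply: le_trans fg; rewrite ga.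
apply: (@proj_min _ _ _ _ _ (@measurable_rect R) _ (fun i : idx N => ~~ (i.1.1 && (i.1.2 == 0 :> nat)))) => //.
- by move=> i; exact: sqi_bas.
- exact: basi_orthonormal.
Qed.

(** Completeness on the rectangle is applied to the normalised constant in x times g(y): only the
    coefficients of x-mode 0 survive, and they are the cosine coefficients of g. *)
Lemma cosb_complete : cos_complete R.
Proof.
move=> g cg e e0; have p0 := pi_gt0 R.
have s1 : sqi (@lebesgue_measure R) `[0, 2 * pi] (xb false 0) by apply: cts_sqix; exact: cts_xb.
have sg := cts_sqi cg.
have sc j : sqi (@lebesgue_measure R) I01 (cosb j) by apply: cts_sqi; exact: cts_cosb.
have sf : sqi (@leb2 R) (@rect R) (fun z => xb false 0 z.1 * g z.2) by exact: sqi_prod.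
have [J /(_ J (leqnn _))] := bas_complete sf e0.
rewrite ip2X// xb_orthonormal (_ : [&& _, _ & _] = true)// mul1r => H.
exists J; apply: le_trans H; rewrite lerD2l lerN2.
rewrite (eq_bigr (fun i : idx J => ([&& false == i.1.1 & 0%N == i.1.2])%:R * ip1 g (cosb i.2) ^+ 2)); last first.
  move=> i _; rewrite /basi /bas ip2X//; last by apply: cts_sqix; exact: cts_xb.
  rewrite xb_orthonormal exprMn andbT /=; congr (_ * _).
  by case: (_ && _); rewrite ?expr1n ?expr0n.
case: J => [|J].
  by rewrite [X in X <= _]big1 ?big_ord0// => -[[b m] j] _; case: m.
rewrite -(pair_bigA _ (fun (p : bool * 'I_J.+1) (j : 'I_J.+1) => (((false == p.1) && (0%N == p.2))%:R * ip1 g (cosb j) ^+ 2)))/=.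
rewrite (bigD1 (false, ord0))//= [X in _ + X]big1 ?addr0.
  by apply: ler_sum => j _; rewrite mul1r.
move=> [b m] /=; rewrite xpair_eqE => nm; apply: big1 => j _.
by rewrite eq_sym (eq_sym _ (m : nat)) (negPf nm) mul0r.
Qed.

End Basis.

(** * From the resolvent to decay in time *)

Section TimeStep.
Context {R : realType}.

Lemma segment_covering (t0 t1 : R) (P : nat -> R -> Prop) :
  (forall t, t0 <= t <= t1 -> \forall t' \near t & n \near \oo, P n t') ->
  exists N, forall t, t0 <= t <= t1 -> P N t.
Proof.
move=> H; have /compact_near_coveringP := @segment_compact R t0 t1.
move=> /(_ nat \oo P _)[]; first by move=> t /=; rewrite in_itv/=; exact: H.
move=> N _ /(_ N (leqnn N)) PN; exists N => t tI; apply: PN.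
by rewrite /= in_itv.
Qed.

Lemma segment_unif_continuous (I : finType) (t0 t1 e : R) (f : I -> R -> R) : 0 < e ->
  (forall i t, t0 <= t <= t1 -> {for t, continuous (f i)}) ->
  exists N, forall t, t0 <= t <= t1 -> forall i s, `|s - t| <= N.+1%:R^-1 -> `|f i s - f i t| <= e.
Proof.
move=> e0 cf.
apply: (@segment_covering t0 t1 (fun N t => forall i s, `|s - t| <= N.+1%:R^-1 -> `|f i s - f i t| <= e)) => t tI.
suff H i : \forall t' \near t & n \near \oo,
    forall s, `|s - t'| <= n.+1%:R^-1 -> `|f i s - f i t'| <= e.
  exact: (@filter_forall _ I (fun i (x : R * nat) =>
    forall s, `|s - x.1| <= x.2.+1%:R^-1 -> `|f i s - f i x.1| <= e) (filter_prod (nbhs t) \oo) _ H).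
have /cvgrPdist_le/(_ _ (divr_gt0 e0 (ltr0n _ 2 : 0 < 2))) := cf i t tI.
rewrite -nbhs_nearE => /nbhs_ballP[d /= d0 Hd].
have d2 : 0 < d / 2 by rewrite divr_gt0.
exists (ball t (d / 2), [set n | n.+1%:R^-1 < d / 2]).
  split; first exact: nbhsx_ballx.
  by have := @cvg_harmonic R => /cvgrPdist_lt/(_ _ d2); apply: filterS => n /=;
    rewrite sub0r normrN ger0_norm// invr_ge0.
move=> [t' n] [/= t't nd] s st'.
have h1 := Hd t'; have h2 := Hd s; rewrite /ball/= in t't h1 h2.
have a1 : `|f i t - f i t'| <= e / 2 by apply: h1; apply: lt_trans t't _; rewrite ltr_pdivrMr// ltr_pMr// ltr1n.
have a2 : `|f i t - f i s| <= e / 2.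
  apply: h2; have -> : t - s = (t - t') - (s - t') by ring.
  apply: le_lt_trans (ler_normB _ _) _; rewrite [ltRHS](splitr d) ltr_leD//.
  by apply: le_trans st' (ltW nd).
have -> : f i s - f i t' = (f i t - f i t') - (f i t - f i s) by ring.
by apply: le_trans (ler_normB _ _) _; rewrite [leRHS](splitr e) lerD.
Qed.

Lemma tent_lipschitz (M i : nat) : (i < M)%N ->
  (minn i.+1 (M - i.+1) <= (minn i (M - i)).+1)%N /\
  (minn i (M - i) <= (minn i.+1 (M - i.+1)).+1)%N.
Proof. lia. Qed.

Lemma tent_le (K i : nat) : (minn i (K * 4 - i) <= K * 2)%N.
Proof. lia. Qed.

(** Discrete Leibniz rule for the weight c times x: residual of the equation, oscillation of the
    derivative, and slope of the weight (at most 1) times x. *)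
Lemma tent_step (tau c c' x x' al a g e : R) : 0 < tau -> x' = x + tau * al ->
  `|al - a| <= e -> `|c' - c| <= tau ->
  ((c' * x' - c * x) / tau + c' * g) ^+ 2 <=
  3 * (c' ^+ 2 * (a + g) ^+ 2 + c' ^+ 2 * e ^+ 2 + x ^+ 2).
Proof.
move=> t0 -> ale cc; pose s := (c' - c) / tau.
have -> : (c' * (x + tau * al) - c * x) / tau + c' * g =
    c' * (a + g) + c' * (al - a) + s * x by rewrite /s; field; rewrite gt_eqF.
have s1 : s ^+ 2 <= 1.
  by rewrite -real_normK ?num_real// exprn_ile1// /s normrM normfV (gtr0_norm t0) ler_pdivrMr// mul1r.
have e2 : (al - a) ^+ 2 <= e ^+ 2.
  by rewrite -real_normK ?num_real// ler_sqr ?nnegrE ?(le_trans _ ale).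
have h1 : (c' * (al - a)) ^+ 2 <= c' ^+ 2 * e ^+ 2 by rewrite exprMn ler_wpM2l ?sqr_ge0.
have h2 : (s * x) ^+ 2 <= x ^+ 2 by rewrite exprMn ler_piMl ?sqr_ge0.
rewrite -exprMn; move: (c' * (a + g)) (c' * (al - a)) (s * x) h1 h2 => A B C h1 h2.
have := sqr_ge0 (A - B); have := sqr_ge0 (B - C); have := sqr_ge0 (A - C).
by move: h1 h2; rewrite !expr2; clear; lra.
Qed.

Variables (J : finType) (b : J -> R) (U : J -> J -> R) (Psi : R).
Hypothesis rb : resolvent_bound b U Psi.
Hypothesis Psi0 : 0 <= Psi.

Lemma galrZ c (p q : J -> R) j :
  galr b U (fun l => c * p l) (fun l => c * q l) j = c * galr b U p q j.
Proof.
rewrite /galr mulrBr mulr_sumr mulrCA; congr (_ - _).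
by apply: eq_bigr => l _; rewrite mulrCA.
Qed.

Lemma galiZ c (p q : J -> R) j :
  gali b U (fun l => c * p l) (fun l => c * q l) j = c * gali b U p q j.
Proof.
rewrite /gali mulrDr mulr_sumr mulrCA; congr (_ + _).
by apply: eq_bigr => l _; rewrite mulrCA.
Qed.

Lemma der_mvt (f f' : R -> R) (t0 t1 s t : R) : t0 <= s -> s < t -> t <= t1 ->
  (forall r, t0 <= r <= t1 -> is_derive r 1 f (f' r)) ->
  exists2 c, s <= c <= t & f t = f s + (t - s) * f' c.
Proof.
move=> ts st tt df.
have dI r : s <= r <= t -> is_derive r 1 f (f' r).
  by move=> /andP[sr rt]; apply: df; rewrite (le_trans ts sr) (le_trans rt tt).
have [||c] := @MVT R f f' s t st.
- by move=> r; rewrite in_itv/= => /andP[/ltW sr /ltW rt]; apply: dI; rewrite sr.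
- apply: derivable_within_continuous => r; rewrite in_itv/= => rI.
  exact: (@ex_derive _ _ _ _ _ _ _ (dI r rI)).
- rewrite in_itv/= => /andP[sc ct] E; exists c; first by rewrite !ltW.
  by rewrite mulrC -E; ring.
Qed.

(* The solution, weighted by a tent function of time so as to vanish at both ends,
   is sampled on a fine grid and extended periodically to use discrete_resolvent. *)
Lemma time_step (t0 T eta lo hi : R) (p q a c : J -> R -> R) :
  0 < T -> 0 <= lo ->
  (forall j t, t0 <= t <= t0 + T -> is_derive t 1 (p j) (a j t)) ->
  (forall j t, t0 <= t <= t0 + T -> is_derive t 1 (q j) (c j t)) ->
  (forall j t, t0 <= t <= t0 + T -> {for t, continuous (a j)}) ->
  (forall j t, t0 <= t <= t0 + T -> {for t, continuous (c j)}) ->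
  (forall t, t0 <= t <= t0 + T ->
    \sum_j ((a j t + galr b U (p^~ t) (q^~ t) j) ^+ 2 +
            (c j t + gali b U (p^~ t) (q^~ t) j) ^+ 2) <= eta) ->
  (forall t, t0 <= t <= t0 + T -> lo <= \sum_j (p j t ^+ 2 + q j t ^+ 2) <= hi) ->
  Psi * T ^+ 2 * lo <= 120 * hi + 30 * T ^+ 2 * eta.
Proof.
move=> T0 lo0 dp dq ca cc Heta Hlh.
apply/ler_addgt0Pr => ep ep0.
(* The final estimate contains 30 T^2 eps, which this choice makes equal to the allowed error [ep];
   [e] is the oscillation per component that produces [eps]. *)
pose eps := ep / (30 * T ^+ 2).
have T2 : 0 < 30 * T ^+ 2 by rewrite mulr_gt0 ?exprn_gt0.
have eps0 : 0 < eps by rewrite divr_gt0.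
pose e := Num.sqrt (eps / (2 * #|J|%:R + 1)).
have J0 : 0 < 2 * #|J|%:R + 1 :> R by rewrite ltr_wpDl// mulr_ge0.
have e0 : 0 < e by rewrite sqrtr_gt0 divr_gt0.
have eE : \sum_(j : J) (e ^+ 2 + e ^+ 2) <= eps.
  rewrite sumr_const -mulr_natl sqr_sqrtr; last by rewrite ltW// divr_gt0.
  have -> : #|xpredT : pred J|%:R * (eps / (2 * #|J|%:R + 1) + eps / (2 * #|J|%:R + 1)) =
      eps * (2 * #|J|%:R / (2 * #|J|%:R + 1)) by field; rewrite gt_eqF.
  by rewrite ger_pMr// ler_pdivrMr// mul1r lerDl.
have [N1 HN1] := segment_unif_continuous e0 ca.
have [N2 HN2] := segment_unif_continuous e0 cc.
have [K [K0 KN1 KN2]] : exists K : nat, [/\ (0 < K)%N, T / (K * 4)%:R <= N1.+1%:R^-1 &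
    T / (K * 4)%:R <= N2.+1%:R^-1].
  pose K := (Num.truncn (T * (maxn N1 N2).+1%:R)).+1.
  have TK : T * (maxn N1 N2).+1%:R < K%:R by exact: truncnS_gt.
  have H N : (N <= maxn N1 N2)%N -> T / (K * 4)%:R <= N.+1%:R^-1.
    move=> Nm; rewrite ler_pdivrMr ?ltr0n// mulrC -ler_pdivrMr ?invr_gt0 ?ltr0n// invrK.
    have : T * N.+1%:R <= T * (maxn N1 N2).+1%:R by rewrite ler_pM2l// ler_nat.
    have : K%:R <= (K * 4)%:R :> R by rewrite ler_nat leq_pmulr.
    by move: TK; lra.
  by exists K; split=> //; apply: H; rewrite leq_max leqnn ?orbT.
(* Four blocks of K steps: the tent is at least T / 4 on the two middle blocks, which give the lower
   bound, and at most T / 2 everywhere. *)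
pose M := (K * 4)%N; pose tau := T / M%:R.
have M0 : (0 < M)%N by rewrite muln_gt0 K0.
have tau0 : 0 < tau by rewrite divr_gt0// ltr0n.
have Mtau : M%:R * tau = T by rewrite /tau mulrCA divff ?mulr1// pnatr_eq0 -lt0n.
pose chi (i : nat) : R := (minn i (M - i))%:R * tau.
pose tt (i : nat) : R := t0 + i%:R * tau.
have ttI i : (i <= M)%N -> t0 <= tt i <= t0 + T.
  move=> iM; rewrite /tt lerDl mulr_ge0 ?(ltW tau0)//= lerD2l -Mtau ler_pM2r// ler_nat.
  exact.
have chi0 : chi 0%N = 0 by rewrite /chi min0n mul0r.
have chiM : chi M = 0 by rewrite /chi subnn minn0 mul0r.
have chi_lip i : (i < M)%N -> `|chi i.+1 - chi i| <= tau.
  move=> iM; rewrite /chi -mulrBl normrM (gtr0_norm tau0) ler_piMl ?(ltW tau0)//.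
  have H (x y : nat) : (x <= y.+1)%N -> (y <= x.+1)%N -> `|x%:R - y%:R| <= 1 :> R.
    rewrite -(ler_nat R) -(ler_nat R y) -!natr1 ler_norml => ? ?; lra.
  by have [h1 h2] := tent_lipschitz iM; apply: H.
have chi_le i : (i <= M)%N -> chi i ^+ 2 <= T ^+ 2 / 4.
  move=> iM; have c0 : 0 <= chi i by rewrite mulr_ge0 ?(ltW tau0).
  have c1 : chi i <= T / 2.
    have -> : T / 2 = (K * 2)%:R * tau.
      by rewrite -Mtau /M !natrM; field.
    by rewrite ler_pM2r// ler_nat; exact: tent_le.
  have -> : T ^+ 2 / 4 = (T / 2) ^+ 2 by field.
  by rewrite ler_sqr ?nnegrE// (le_trans c0).
pose P j i := chi i * p j (tt i); pose Q j i := chi i * q j (tt i).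
have := discrete_resolvent M P Q tau0 rb.
have low : (2 * K%:R) * (T ^+ 2 / 16) * lo <=
    \sum_(i < M.+1) \sum_j (P j i ^+ 2 + Q j i ^+ 2).
  have -> : \sum_(i < M.+1) \sum_j (P j i ^+ 2 + Q j i ^+ 2) =
      \sum_(0 <= i < M.+1) \sum_j (P j i ^+ 2 + Q j i ^+ 2) by rewrite big_mkord.
  have nn i : 0 <= \sum_j (P j i ^+ 2 + Q j i ^+ 2).
    by apply: sumr_ge0 => j _; rewrite addr_ge0 ?sqr_ge0.
  rewrite (@big_cat_nat _ _ _ K)//=; last by rewrite /M; clear; lia.
  rewrite (@big_cat_nat _ _ _ (K * 3) K)//=; [|by clear; lia|by rewrite /M; clear; lia].
  apply: le_trans (_ : \sum_(K <= i < K * 3) (T ^+ 2 / 16 * lo) <= _).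
    rewrite sumr_const_nat (_ : (K * 3 - K)%N = (2 * K)%N); last by clear; lia.
    by rewrite -[X in _ <= X]mulr_natl natrM !mulrA.
  apply: le_trans (_ : \sum_(K <= i < K * 3) \sum_j (P j i ^+ 2 + Q j i ^+ 2) <= _); last first.
    by rewrite addrCA lerDl addr_ge0// sumr_ge0.
  rewrite big_nat_cond [leRHS]big_nat_cond; apply: ler_sum => i; rewrite andbT => /andP[Ki iK].
  have iM : (i <= M)%N by rewrite /M; clear -iK; lia.
  have -> : \sum_j (P j i ^+ 2 + Q j i ^+ 2) =
      chi i ^+ 2 * \sum_j (p j (tt i) ^+ 2 + q j (tt i) ^+ 2).
    by rewrite mulr_sumr; apply: eq_bigr => j _; rewrite /P /Q; ring.
  apply: ler_pM => //; first by rewrite divr_ge0 ?sqr_ge0.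
    have -> : T ^+ 2 / 16 = (T / 4) ^+ 2 by field.
    have -> : T / 4 = K%:R * tau by rewrite -Mtau /M natrM; field.
    have Kt : 0 <= K%:R * tau by rewrite mulr_ge0 ?(ltW tau0).
    have Kc : K%:R * tau <= chi i.
      by rewrite /chi ler_pM2r// ler_nat leq_min Ki /M; clear -iK; lia.
    by rewrite ler_sqr// nnegrE (le_trans Kt).
  by have /andP[] := Hlh _ (ttI i iM).
have up : \sum_(i < M.+1) \sum_j
    (((P j i - P j (cpred M i)) / tau + galr b U (P^~ i) (Q^~ i) j) ^+ 2 +
     ((Q j i - Q j (cpred M i)) / tau + gali b U (P^~ i) (Q^~ i) j) ^+ 2) <=
    (5 * K%:R) * (3 * (T ^+ 2 / 4 * (eta + eps) + hi)).
  have eta0 : 0 <= eta.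
    apply: le_trans (Heta _ (ttI 0%N (leq0n _))); apply: sumr_ge0 => j _.
    by rewrite addr_ge0 ?sqr_ge0.
  have hi0 : 0 <= hi.
    by have /andP[h1 h2] := Hlh _ (ttI 0%N (leq0n _)); apply: le_trans (le_trans lo0 h1) h2.
  have B0 : 0 <= 3 * (T ^+ 2 / 4 * (eta + eps) + hi).
    by rewrite mulr_ge0// addr_ge0// mulr_ge0 ?divr_ge0 ?sqr_ge0// addr_ge0// ltW.
  apply: le_trans (_ : \sum_(i < M.+1) 3 * (T ^+ 2 / 4 * (eta + eps) + hi) <= _); last first.
    rewrite sumr_const card_ord -[X in X <= _]mulr_natl ler_wpM2r//.
    by rewrite -natrM ler_nat /M; clear -K0; lia.
  apply: ler_sum => -[[|i] /= iM] _.
    (* At index 0 the cyclic predecessor is the last index; the tent vanishes at both, so the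
       wrap-around difference contributes nothing. *)
    rewrite big1// => j _; rewrite /P /Q.
    have -> : galr b U (fun l => chi 0 * p l (tt 0)) (fun l => chi 0 * q l (tt 0)) j = 0.
      by rewrite galrZ chi0 mul0r.
    have -> : gali b U (fun l => chi 0 * p l (tt 0)) (fun l => chi 0 * q l (tt 0)) j = 0.
      by rewrite galiZ chi0 mul0r.
    by rewrite chi0 chiM !mul0r subrr mul0r addr0 expr0n addr0.
  rewrite ltnS in iM; have iM' := ltnW iM.
  have sti : tt i < tt i.+1 by rewrite /tt ltrD2l ltr_pM2r// ltr_nat.
  have dti : tt i.+1 - tt i = tau by rewrite /tt -natr1; ring.
  have /andP[ti0 ti1] := ttI i iM'; have /andP[tj0 tj1] := ttI i.+1 iM.
  have near_t r N : tau <= N.+1%:R^-1 -> tt i <= r <= tt i.+1 -> `|r - tt i.+1| <= N.+1%:R^-1.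
    move=> tN /andP[r1 r2]; apply: le_trans tN; rewrite -dti distrC ger0_norm ?subr_ge0//.
    by rewrite lerD2l lerN2.
  have bd j : ((P j i.+1 - P j i) / tau + galr b U (P^~ i.+1) (Q^~ i.+1) j) ^+ 2 +
     ((Q j i.+1 - Q j i) / tau + gali b U (P^~ i.+1) (Q^~ i.+1) j) ^+ 2 <=
     3 * (chi i.+1 ^+ 2 * ((a j (tt i.+1) + galr b U (p^~ (tt i.+1)) (q^~ (tt i.+1)) j) ^+ 2 +
            (c j (tt i.+1) + gali b U (p^~ (tt i.+1)) (q^~ (tt i.+1)) j) ^+ 2) +
          chi i.+1 ^+ 2 * (e ^+ 2 + e ^+ 2) + (p j (tt i) ^+ 2 + q j (tt i) ^+ 2)).
    have [r1 r1I E1] := der_mvt ti0 sti tj1 (dp j).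
    have [r2 r2I E2] := der_mvt ti0 sti tj1 (dq j).
    rewrite dti in E1 E2.
    have n1 := HN1 _ (ttI i.+1 iM) j _ (near_t r1 _ KN1 r1I).
    have n2 := HN2 _ (ttI i.+1 iM) j _ (near_t r2 _ KN2 r2I).
    have h1 := tent_step (galr b U (p^~ (tt i.+1)) (q^~ (tt i.+1)) j) tau0 E1 n1 (chi_lip i iM).
    have h2 := tent_step (gali b U (p^~ (tt i.+1)) (q^~ (tt i.+1)) j) tau0 E2 n2 (chi_lip i iM).
    rewrite /P /Q galrZ galiZ.
    by apply: le_trans (lerD h1 h2) _; rewrite le_eqVlt; apply/orP; left; apply/eqP; ring.
  apply: le_trans (ler_sum _ (fun j _ => bd j)) _.
  rewrite -mulr_sumr !big_split/= -!mulr_sumr -!big_split/=.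
  have H1 := Heta _ (ttI i.+1 iM); have /andP[_ H2] := Hlh _ (ttI i iM').
  rewrite ler_pM2l// lerD// mulrDr lerD//.
    by apply: ler_pM => //; [exact: sqr_ge0|apply: sumr_ge0 => j _; rewrite addr_ge0 ?sqr_ge0|exact: chi_le].
  apply: ler_pM => //; [exact: sqr_ge0|apply: sumr_ge0 => j _; rewrite addr_ge0 ?sqr_ge0//|exact: chi_le].
(* There are 2 K terms of weight T^2 / 16 below and at most 5 K terms above, from 4 K + 1 <= 5 K;
   multiplying by 8 / K yields the constants 120 and 30. *)
move=> main; have := le_trans (ler_wpM2l Psi0 low) (le_trans main up).
have Kp : 0 < K%:R :> R by rewrite ltr0n.
have epsE : 30 * T ^+ 2 * eps = ep by rewrite /eps mulrCA divff ?mulr1// gt_eqF.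
have -> : Psi * (2 * K%:R * (T ^+ 2 / 16) * lo) = K%:R * (Psi * T ^+ 2 * lo / 8) by field.
have -> : 5 * K%:R * (3 * (T ^+ 2 / 4 * (eta + eps) + hi)) =
  K%:R * ((120 * hi + 30 * T ^+ 2 * eta + 30 * T ^+ 2 * eps) / 8) by field.
by rewrite ler_pM2l// epsE ler_pM2r ?invr_gt0.
Qed.

End TimeStep.

(** * Galerkin coefficients of a real weak solution *)

Section Flow.
Context {R : realType}.
Implicit Types (m j N : nat) (b : bool) (s t e : R).

Lemma sum_idx N (F : idx N -> R) :
  \sum_i F i = \sum_m \sum_l (F (false, m, l) + F (true, m, l)).
Proof.
rewrite (eq_bigr (fun i => F (i.1.1, i.1.2, i.2))); last by move=> [[b m] l].
rewrite -(pair_bigA _ (fun (p : bool * 'I_N) l => F (p.1, p.2, l)))/=.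
rewrite -(pair_bigA _ (fun (b : bool) (m : 'I_N) => \sum_l F (b, m, l)))/= big_bool/= -big_split/=.
by apply: eq_bigr => m _; rewrite -big_split; apply: eq_bigr => l _; rewrite addrC.
Qed.

Lemma sum_idx_ge N (m : 'I_N) (F : idx N -> R) : (forall i, 0 <= F i) ->
  \sum_l (F (false, m, l) + F (true, m, l)) <= \sum_i F i.
Proof.
move=> F0; rewrite sum_idx [X in _ <= X](bigD1 m)//= lerDl; apply: sumr_ge0 => k _.
by apply: sumr_ge0 => l _; rewrite addr_ge0.
Qed.

Lemma sum_idx_mode N (m : 'I_N) (F : idx N -> R) :
  (forall b k l, k != m -> F (b, k, l) = 0) ->
  \sum_i F i = \sum_l (F (false, m, l) + F (true, m, l)).
Proof.
move=> F0; rewrite sum_idx [LHS](bigD1 m)//= [X in _ + X]big1 ?addr0// => k km.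
by apply: big1 => l _; rewrite !F0// addr0.
Qed.

Lemma bas_true0 j : @bas R true 0 j = fun=> 0.
Proof. by apply: funext => z; rewrite /bas /xb mul0r sin0 mulr0 oppr0 mul0r. Qed.

Lemma cts_within_sum (I : Type) (D : set R) (r : seq I) (F : I -> R -> R) :
  (forall i, {within D, continuous (F i)}) -> {within D, continuous (fun t => \sum_(i <- r) F i t)}.
Proof.
move=> cF; elim: r => [|i r IH] x.
  by under eq_fun do rewrite big_nil; exact: cvg_cst.
by under eq_fun do rewrite big_cons; apply: cvgD; [exact: cF|exact: IH].
Qed.

Lemma cts_at_lincomb (f g : R -> R) (a b t : R) : {for t, continuous f} ->
  {for t, continuous g} -> {for t, continuous (fun s => a * f s - b * g s)}.
Proof.
move=> cf cg; apply: (@cvgB _ _ _ _ _ (fun s => a * f s) (fun s => b * g s)).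
  by apply: (@cvgM _ _ _ _ (fun=> a) f); [exact: cvg_cst|exact: cf].
by apply: (@cvgM _ _ _ _ (fun=> b) g); [exact: cvg_cst|exact: cg].
Qed.

Variables (v : R -> R) (Vm nu nu' : R) (h : R -> R * R -> R).
Hypothesis cv : continuous v.
Hypothesis vV : forall y, `|v y| <= Vm.

Definition sg b m : R := if b then - m%:R else m%:R.
Definition coef b m j t := ip2 (h t) (bas b m j).
Definition fcoef b m j t := ip2 (h t) (fun z => v z.2 * bas b m j z).
(* nu' = nu for the full Laplacian, nu' = 0 for the hypoelliptic equation. *)
Definition damp m j := nu * wav j ^+ 2 + nu' * m%:R ^+ 2.

(** The equation tested against the basis alone. For fixed m, write p and q for the vectors of
    cosine and sine coefficients; since v acts within an x-mode, up to truncation p' = m U q - damp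
    p and q' = - m U p - damp q, so p + i q solves the complex system of [galr] and [gali]. *)
Record weak_flow : Prop := WeakFlow {
  flow_sqi : forall t, 0 <= t -> sqi (@leb2 R) (@rect R) (h t);
  flow_cts : forall t, 0 <= t -> forall e, 0 < e -> \forall s \near t, 0 <= s ->
    ip2 (fun z => h s z - h t z) (fun z => h s z - h t z) <= e;
  flow_der : forall b m j t, 0 < t ->
    is_derive t 1 (coef b m j) (sg b m * fcoef (~~ b) m j t - damp m j * coef b m j t)
}.

Hypothesis nu0 : 0 <= nu.
Hypothesis nu'0 : 0 <= nu'.
Hypothesis wf : weak_flow.

Let mD := @measurable_rect R.

Lemma sqi_vM (g : R * R -> R) : sqi (@leb2 R) (@rect R) g ->
  sqi (@leb2 R) (@rect R) (fun z => v z.2 * g z).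
Proof.
by apply: (@sqi_bddM _ (@plane R) R (@leb2 R) (@rect R) mD (fun z => v z.2) g Vm (measurable_snd_cts cv)).
Qed.

Let sb b m j := @sqi_bas R b m j.
Let svb b m j : sqi (@leb2 R) (@rect R) (fun z => v z.2 * bas b m j z) := sqi_vM (sb b m j).

Definition energy m N t := \sum_(j < N) (coef false m j t ^+ 2 + coef true m j t ^+ 2).
Definition tail N t := ip2 (h t) (h t) - \sum_(i : idx N) ip2 (h t) (basi i) ^+ 2.
Definition proj N t : R * R -> R := fun z => \sum_(i : idx N) ip2 (h t) (basi i) * basi i z.

Let basi_sqi N (i : idx N) : sqi (@leb2 R) (@rect R) (basi i) := sb _ _ _.

Lemma sqi_proj N t : sqi (@leb2 R) (@rect R) (proj N t).
Proof. by apply: sqi_lincomb => // i; exact: basi_sqi. Qed.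

Lemma tailE N t : 0 <= t ->
  tail N t = ip2 (fun z => h t z - proj N t z) (fun z => h t z - proj N t z).
Proof.
move=> t0; symmetry; apply: (@dist_proj _ _ _ _ _ mD _ (fun i : idx N => ~~ (i.1.1 && (i.1.2 == 0 :> nat)))).
- by move=> i; exact: basi_sqi.
- exact: basi_orthonormal.
- exact: flow_sqi.
Qed.

Lemma tail_ge0 N t : 0 <= t -> 0 <= tail N t.
Proof. by move=> t0; rewrite tailE// ip_ge0. Qed.

Definition res b m j N t := ip2 (fun z => h t z - proj N t z) (fun z => v z.2 * bas b m j z).

(** Multiplication by v(y) preserves parity and frequency in x, so the projected part involves one
    row of [Umat] only; the rest is the truncation error [res]. *)
Lemma fcoef_split b m N (j : 'I_N) t : 0 <= t -> (m < N)%N ->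
  fcoef b m j t = \sum_(l < N) Umat v j l * coef b m l t + res b m j N t.
Proof.
move=> t0 mN; have st := flow_sqi wf t0.
rewrite /res /ip2 ipBl//; last exact: sqi_proj.
rewrite /fcoef /ip2.
suff -> : ip (@leb2 R) (@rect R) (proj N t) (fun z => v z.2 * bas b m j z) =
    \sum_(l < N) Umat v j l * coef b m l t by rewrite addrC subrK.
rewrite ipC ip_lincomb//.
have sx c k : sqi (@lebesgue_measure R) `[0, 2 * pi] (xb c k) by apply: cts_sqix; exact: cts_xb.
have sc k : sqi (@lebesgue_measure R) I01 (cosb k) by apply: cts_sqi; exact: cts_cosb.
have svc k : sqi (@lebesgue_measure R) I01 (fun y => v y * cosb k y).
  by apply: cts_sqi; apply: ctsM => //; exact: cts_cosb.
have e (i : idx N) : ip (@leb2 R) (@rect R) (fun z => v z.2 * bas b m j z) (basi i) =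
    [&& b == i.1.1, m == i.1.2 & ~~ (b && (m == 0%N))]%:R * Umat v j i.2.
  rewrite -xb_orthonormal /Umat -ip2X//; apply: eq_ip => // z _.
  by rewrite /bas mulrCA.
rewrite (eq_bigr _ (fun i _ => congr1 _ (e i))).
rewrite (sum_idx_mode (m := Ordinal mN)); last first.
  by move=> c k l /=; rewrite -(inj_eq val_inj)/= eq_sym => /negPf ->; rewrite andbF mul0r mulr0.
apply: eq_bigr => l _ /=; rewrite !eqxx/= /coef /basi /=.
case: b {e} => /=; last by rewrite mul0r mulr0 addr0 mul1r mulrC.
rewrite !mul0r mulr0 add0r; case: m mN => [|m] mN /=; last by rewrite mul1r mulrC.
by rewrite bas_true0 /ip2 ipC ip0l mul0r mulr0.
Qed.

(** The errors are the coefficients of v (h - proj h), so Bessel sums them. *)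
Lemma res_bessel m N t : 0 <= t -> (m < N)%N ->
  \sum_(j < N) (res false m j N t ^+ 2 + res true m j N t ^+ 2) <= Vm ^+ 2 * tail N t.
Proof.
move=> t0 mN; have st := flow_sqi wf t0.
pose g z := h t z - proj N t z.
have sg : sqi (@leb2 R) (@rect R) g by apply: sqiB => //; exact: sqi_proj.
have -> : \sum_(j < N) (res false m j N t ^+ 2 + res true m j N t ^+ 2) =
    \sum_(j < N) (ip2 (fun z => v z.2 * g z) (basi (false, Ordinal mN, j)) ^+ 2 +
                  ip2 (fun z => v z.2 * g z) (basi (true, Ordinal mN, j)) ^+ 2).
  apply: eq_bigr => j _; rewrite /basi /=; congr (_ ^+ 2 + _ ^+ 2);
    by apply: eq_Rintegral => z _; rewrite /g; ring.
apply: le_trans (sum_idx_ge (Ordinal mN)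
  (F := fun i => ip2 (fun z => v z.2 * g z) (basi i) ^+ 2) (fun i => sqr_ge0 _)) _.
apply: le_trans (bas_bessel N (sqi_vM sg)) _.
rewrite tailE//.
exact: (@ip_bddM_le _ (@plane R) R (@leb2 R) (@rect R) mD (fun z => v z.2) g Vm (measurable_snd_cts cv)).
Qed.

Lemma energy_le m N t : 0 <= t -> (m < N)%N -> energy m N t <= ip2 (h t) (h t).
Proof.
move=> t0 mN; apply: le_trans (bas_bessel N (flow_sqi wf t0)).
exact: (sum_idx_ge (Ordinal mN) (fun i => sqr_ge0 (ip2 (h t) (basi i)))).
Qed.

Lemma energy_mode m N t : 0 <= t -> (m < N)%N ->
  (forall b k l, k != m -> coef b k l t = 0) ->
  ip2 (h t) (h t) = energy m N t + tail N t.
Proof.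
move=> t0 mN H; rewrite /tail (sum_idx_mode (m := Ordinal mN)).
  by rewrite addrC subrK.
move=> b k l km; have -> : ip2 (h t) (basi (b, k, l)) = 0.
  by apply: H; rewrite -(inj_eq val_inj) in km.
by rewrite expr0n.
Qed.

Lemma norm_bound T : exists H : R, 0 <= H /\ forall t, 0 <= t <= T -> ip2 (h t) (h t) <= H.
Proof.
suff [N HN] : exists N, forall t, 0 <= t <= T -> 0 <= t -> ip2 (h t) (h t) <= N%:R.
  by exists N%:R; split=> // t tT; apply: HN => //; case/andP: tT.
apply: segment_covering => t /andP[t0 _].
have st := flow_sqi wf t0.
exists ([set s | 0 <= s -> ip2 (fun z => h s z - h t z) (fun z => h s z - h t z) <= 1],
  [set n | 2 + 2 * ip2 (h t) (h t) <= n%:R]).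
  split; first exact: (flow_cts wf t0 ltr01).
  exact: nbhs_infty_ger.
move=> [s n] /= [hs hn] s0; apply: le_trans hn.
have ss := flow_sqi wf s0.
have := ip_sqrD_le mD (sqiB mD ss st) st.
have -> : (fun z => h s z - h t z + h t z) = h s by apply: funext => z; rewrite subrK.
by have := hs s0; rewrite /ip2; lra.
Qed.

(** Near t, the tail at time s is at most the squared distance from h(s) to the projection of h(t),
    which is small by continuity of h and completeness at time t; compactness makes the rank
    uniform. *)
Lemma tail_unif T e : 0 < e -> exists N0, forall N, (N0 <= N)%N ->
  forall t, 0 <= t <= T -> tail N t <= e.
Proof.
move=> e0; suff [N0 H] : exists N0, forall t, 0 <= t <= T ->
    forall N, (N0 <= N)%N -> 0 <= t -> tail N t <= e.
  by exists N0 => N NN t tT; apply: H => //; case/andP: tT.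
apply: segment_covering => t /andP[t0 _].
have st := flow_sqi wf t0.
have e4 : 0 < e / 4 by rewrite divr_gt0.
have [N0 HN0] := bas_complete st e4.
exists ([set s | 0 <= s -> ip2 (fun z => h s z - h t z) (fun z => h s z - h t z) <= e / 4],
  [set n | (N0 <= n)%N]).
  split; first exact: (flow_cts wf t0 e4).
  by exists N0.
move=> [s n] /= [hs hn] N nN s0.
have ss := flow_sqi wf s0.
have h1 := HN0 N (leq_trans hn nN).
have h2 : tail N s <= ip2 (fun z => h s z - proj N t z) (fun z => h s z - proj N t z).
  apply: (@proj_min _ _ _ _ _ mD _ (fun i : idx N => ~~ (i.1.1 && (i.1.2 == 0 :> nat)))) => //.
  exact: basi_orthonormal.
apply: le_trans h2 _.
have := ip_sqrD_le mD (sqiB mD ss st) (sqiB mD st (sqi_proj N t)).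
have -> : (fun z => h s z - h t z + (h t z - proj N t z)) = (fun z => h s z - proj N t z).
  by apply: funext => z; ring.
have h3 : tail N t <= e / 4 by [].
rewrite tailE// in h3.
have := hs s0; rewrite /ip2 in h3 *; move: h3.
move: (ip _ _ _ _) (ip _ _ _ _) (ip _ _ _ _) => x y z; lra.
Qed.

Lemma pairing_cts (g : R * R -> R) t : sqi (@leb2 R) (@rect R) g -> 0 <= t ->
  {within `[0, +oo[, continuous (fun s => ip2 (h s) g)} /\
  (0 < t -> {for t, continuous (fun s => ip2 (h s) g)}).
Proof.
move=> sg t0.
have near_t (r : R) : 0 <= r -> forall e, 0 < e -> \forall s \near r, 0 <= s ->
    `|ip2 (h r) g - ip2 (h s) g| <= e.
  move=> r0 e e0; pose G := ip2 g g + 1.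
  have G0 : 0 < G by rewrite /G ltr_wpDl// ip_ge0.
  have eG : 0 < e ^+ 2 / G by rewrite divr_gt0// exprn_gt0.
  apply: filterS (flow_cts wf r0 eG) => s H s0; have {}H := H s0.
  have sr := flow_sqi wf r0; have ss := flow_sqi wf s0.
  rewrite distrC -ler_sqr ?nnegrE ?(ltW e0)// real_normK ?num_real// /ip2 -ipBl//.
  apply: le_trans (ip_CS mD (sqiB mD ss sr) sg) _.
  rewrite -[leRHS](divfK (lt0r_neq0 G0)); apply: ler_pM => //; [exact: ip_ge0|exact: ip_ge0|].
  by rewrite /G /ip2 lerDl.
split.
  apply/subspace_continuousP => r /=; rewrite in_itv/= andbT => r0.
  apply/cvgrPdist_le => e e0; rewrite near_withinE.
  by apply: filterS (near_t r r0 e e0) => s H /=; rewrite in_itv/= andbT; exact: H.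
move=> t1; apply/cvgrPdist_le => e e0.
near=> s; have s0 : 0 <= s by near: s; apply: filterS (lt_nbhsr t1) => s /ltW.
by move: s0; near: s; exact: near_t.
Unshelve. all: by end_near. Qed.

Lemma Umat_sym N (j l : 'I_N) : Umat v j l = Umat v l j.
Proof. by apply: ip1_swap => y; rewrite mulrAC. Qed.

Lemma der_energy m N t : 0 < t ->
  is_derive t 1 (energy m N) (\sum_(j < N)
    (2 * coef false m j t * (m%:R * fcoef true m j t - damp m j * coef false m j t) +
     2 * coef true m j t * (- m%:R * fcoef false m j t - damp m j * coef true m j t))).
Proof.
move=> t0; apply: der_sum => j; apply: derD.
  by apply: (is_derive_eq (derX 1 (flow_der wf false m j t0))); rewrite expr1.
by apply: (is_derive_eq (derX 1 (flow_der wf true m j t0))); rewrite expr1.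
Qed.

(** The symmetric matrix of v exchanges no energy between the cosine and sine parts; only truncation
    errors remain. *)
Lemma flow_exchange m N t : 0 <= t -> (m < N)%N ->
  \sum_(j < N) (coef false m j t * fcoef true m j t - coef true m j t * fcoef false m j t) =
  \sum_(j < N) (coef false m j t * res true m j N t - coef true m j t * res false m j N t).
Proof.
move=> t0 mN.
rewrite (eq_bigr (fun j : 'I_N => (coef false m j t * res true m j N t - coef true m j t * res false m j N t) +
  (\sum_(l < N) (coef false m j t * coef true m l t * Umat v j l) -
   \sum_(l < N) (coef true m j t * coef false m l t * Umat v j l)))); last first.
  move=> j _; rewrite !(fcoef_split _ _ t0 mN) !mulrDr !mulr_sumr.
  rewrite (eq_bigr (fun l : 'I_N => coef false m j t * coef true m l t * Umat v j l)); last by move=> l _; ring.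
  rewrite [in X in _ - X](eq_bigr (fun l : 'I_N => coef true m j t * coef false m l t * Umat v j l)); last by move=> l _; ring.
  by ring.
rewrite big_split/= -[RHS]addr0; congr (_ + _).
rewrite sumrB [X in X - _]exchange_big/=; apply/eqP; rewrite subr_eq0; apply/eqP.
apply: eq_bigr => j _; apply: eq_bigr => l _.
by rewrite Umat_sym mulrC (mulrC (coef true _ _ _)) mulrC.
Qed.

Lemma energy_growth m N t (s : R) : 0 <= t -> (m < N)%N -> 0 < s ->
  \sum_(j < N)
    (2 * coef false m j t * (m%:R * fcoef true m j t - damp m j * coef false m j t) +
     2 * coef true m j t * (- m%:R * fcoef false m j t - damp m j * coef true m j t)) <=
  m%:R * (s * ip2 (h t) (h t) + Vm ^+ 2 * tail N t / s).
Proof.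
move=> t0 mN s0.
have d0 j : 0 <= damp m j by rewrite addr_ge0// mulr_ge0 ?sqr_ge0.
apply: le_trans (_ : 2 * m%:R * \sum_(j < N)
    (coef false m j t * fcoef true m j t - coef true m j t * fcoef false m j t) <= _).
  rewrite mulr_sumr; apply: ler_sum => j _.
  have := mulr_ge0 (d0 j) (sqr_ge0 (coef false m j t)).
  have := mulr_ge0 (d0 j) (sqr_ge0 (coef true m j t)).
  by move: (damp _ _) (coef _ _ _ _) (coef _ _ _ _) (fcoef _ _ _ _) (fcoef _ _ _ _) => D a b c d; lra.
rewrite flow_exchange// -mulrA mulrCA ler_wpM2l// mulr_sumr.
apply: le_trans (_ : \sum_(j < N) (s * (coef false m j t ^+ 2 + coef true m j t ^+ 2) +
   (res false m j N t ^+ 2 + res true m j N t ^+ 2) / s) <= _).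
  apply: ler_sum => j _.
  have H (a b : R) : 2 * (a * b) <= s * a ^+ 2 + b ^+ 2 / s.
    rewrite -subr_ge0 (_ : _ - _ = (s * a - b) ^+ 2 / s); last by field; rewrite gt_eqF.
    by rewrite divr_ge0 ?sqr_ge0// ltW.
  have h1 := H (coef false m j t) (res true m j N t).
  have h2 := H (- coef true m j t) (res false m j N t).
  by move: h1 h2; rewrite sqrrN; lra.
rewrite big_split/= -mulr_sumr -mulr_suml; apply: lerD.
  by apply: ler_wpM2l; [exact: ltW|exact: energy_le].
by apply: ler_wpM2r; [rewrite invr_ge0 ltW|exact: res_bessel].
Qed.

Lemma energy_cts m N : {within `[0, +oo[, continuous (energy m N)}.
Proof.
have H b j : {within `[0, +oo[, continuous (coef b m j)} := (pairing_cts (sb b m j) (lexx 0)).1.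
have -> : energy m N = (fun t => \sum_(j < N)
    (coef false m j t * coef false m j t + coef true m j t * coef true m j t)).
  by apply: funext => t; apply: eq_bigr => j _; rewrite !expr2.
by apply: cts_within_sum => j x; apply: cvgD; apply: cvgM; exact: H.
Qed.

(** Each mode has nonincreasing energy in the limit of large N: damping is dropped, and the
    remaining growth is due to truncation alone. *)
Lemma mode_energy m s t e : 0 <= s <= t -> 0 < e -> exists N0, forall N, (N0 <= N)%N ->
  energy m N t <= energy m N s + e.
Proof.
move=> /andP[s0]; rewrite le_eqVlt => /predU1P[<- e0|st e0].
  by exists 0%N => N _; rewrite lerDl ltW.
have [H [H0 HH]] := norm_bound t.
pose L := (m%:R + 1) * (t - s).
have L0 : 0 < L by rewrite mulr_gt0 ?subr_gt0// ltr_wpDl.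
have H1 : 0 < H + 1 by rewrite ltr_wpDl.
have V1 : 0 < Vm ^+ 2 + 1 by rewrite ltr_wpDl// sqr_ge0.
(* The length L times each of the two error terms is e / 2: [sig] settles the one with the norm,
   then [ep] the one with the tail. *)
pose sig := e / (2 * L * (H + 1)).
have sig0 : 0 < sig by rewrite divr_gt0// mulr_gt0// mulr_gt0.
pose ep := sig * e / (2 * L * (Vm ^+ 2 + 1)).
have ep0 : 0 < ep.
  by apply: divr_gt0; [exact: mulr_gt0|rewrite mulr_gt0// mulr_gt0].
have [N1 HN1] := tail_unif t ep0.
exists (maxn N1 m.+1) => N; rewrite geq_max => /andP[N1N mN].
have cE : {within `[s, t], continuous (energy m N)}.
  apply: (continuous_subspaceW _ (@energy_cts m N)) => x /=; rewrite !in_itv/= andbT.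
  by move=> /andP[sx _]; exact: le_trans sx.
have px x : x \in `]s, t[%R -> 0 < x.
  by rewrite in_itv/= => /andP[sx _]; exact: le_lt_trans sx.
have [c cst E] := MVT st (fun x xst => der_energy m N (px x xst)) cE.
have c0 := px c cst; move: cst; rewrite in_itv/= => /andP[sc ct].
rewrite addrC -lerBlDr E.
have h1 := energy_growth (ltW c0) mN sig0.
have cI : 0 <= c <= t by rewrite !ltW.
apply: le_trans (ler_wpM2r (_ : 0 <= t - s) h1) _; first by rewrite subr_ge0 ltW.
have h2 : sig * ip2 (h c) (h c) + Vm ^+ 2 * tail N c / sig <= sig * (H + 1) + (Vm ^+ 2 + 1) * ep / sig.
  apply: lerD; first by rewrite ler_pM2l// (le_trans (HH c cI))// lerDl.
  rewrite ler_pM2r ?invr_gt0//; apply: ler_pM.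
  - exact: sqr_ge0.
  - exact/tail_ge0/ltW.
  - by rewrite lerDl.
  - exact: HN1.
apply: le_trans (_ : L * (sig * (H + 1) + (Vm ^+ 2 + 1) * ep / sig) <= _).
  rewrite mulrAC; apply: ler_pM => //.
  - by rewrite mulr_ge0// subr_ge0 ltW.
  - apply: addr_ge0; first by apply: mulr_ge0; [exact: ltW|exact: ip_ge0].
    apply: divr_ge0; last exact: ltW.
    by apply: mulr_ge0; [exact: sqr_ge0|exact/tail_ge0/ltW].
  - by rewrite ler_wpM2r ?subr_ge0 ?(ltW st)// lerDl.
have -> : L * (sig * (H + 1) + (Vm ^+ 2 + 1) * ep / sig) = e.
  by rewrite /ep /sig; field; rewrite !gt_eqF.
by [].
Qed.

Variable k : nat.
Hypothesis k0 : (0 < k)%N.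
Hypothesis h_mode : forall b m j, m != k -> coef b m j 0 = 0.

(** A mode without initial energy stays empty; this provides the invariance of the k-th mode with no
    appeal to uniqueness of weak solutions. *)
Lemma coef_mode b m j t : 0 <= t -> m != k -> coef b m j t = 0.
Proof.
move=> t0 mk; apply/eqP; rewrite -sqrf_eq0; apply/eqP/le_anti; rewrite sqr_ge0 andbT.
apply/ler_addgt0Pr => e e0; rewrite add0r.
have tt : (0 : R) <= 0 <= t by rewrite lexx t0.
have [N0 H] := mode_energy m tt e0.
have {}H := H (maxn N0 j.+1) (leq_maxl _ _).
have jN : (j < maxn N0 j.+1)%N by rewrite leq_max leqnn orbT.
have E0 : energy m (maxn N0 j.+1) 0 = 0.
  by apply: big1 => l _; rewrite !h_mode// expr0n addr0.
rewrite E0 add0r in H; apply: le_trans H.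
rewrite /energy (bigD1 (Ordinal jN))//=; apply: le_trans (_ : coef false m j t ^+ 2 + coef true m j t ^+ 2 <= _).
  by case: b; rewrite ?lerDl ?lerDr sqr_ge0.
by rewrite lerDl; apply: sumr_ge0 => l _; rewrite addr_ge0 ?sqr_ge0.
Qed.

Lemma norm_energy N t : 0 <= t -> (k < N)%N -> ip2 (h t) (h t) = energy k N t + tail N t.
Proof. by move=> t0 kN; apply: energy_mode => // b m j mk; exact: coef_mode. Qed.

Lemma norm_nonincreasing s t : 0 <= s <= t -> ip2 (h t) (h t) <= ip2 (h s) (h s).
Proof.
move=> st; have /andP[s0 s1] := st; have t0 := le_trans s0 s1.
apply/ler_addgt0Pr => e e0; have e2 : 0 < e / 2 by rewrite divr_gt0.
have [N1 H1] := mode_energy k st e2.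
have [N2 H2] := tail_unif t e2.
pose N := maxn (maxn N1 N2) k.+1.
have kN : (k < N)%N by rewrite leq_max leqnn orbT.
have {}H1 := H1 N (leq_trans (leq_maxl _ _) (leq_maxl _ _)).
have tI : 0 <= t <= t by rewrite t0 lexx.
have {}H2 := H2 N (leq_trans (leq_maxr _ _) (leq_maxl _ _)) t tI.
have h3 := energy_le s0 kN.
by rewrite (norm_energy t0 kN); move: H1 H2 h3; lra.
Qed.

(** The time estimate is applied on [s + T, s + 2 T]: the delay keeps it in t > 0, where the
    coefficients are differentiable. Monotonicity of the norm supplies the two bounds, by the
    initial and the final norm. *)
Lemma decay_step (Psi T : R) (J0 : nat) s : 0 <= Psi -> 0 < T ->
  (forall J, (J0 <= J)%N ->
    resolvent_bound (fun j : 'I_J => damp k j) (fun j l : 'I_J => k%:R * @Umat R J v j l) Psi) ->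
  0 <= s ->
  Psi * T ^+ 2 * ip2 (h (s + T + T)) (h (s + T + T)) <= 120 * ip2 (h s) (h s).
Proof.
move=> P0 T0 rb s0; pose t0 := s + T.
have t00 : 0 < t0 by rewrite /t0 ltr_wpDl.
set X := ip2 (h (t0 + T)) _; set Y := ip2 (h s) _.
have YX : 0 <= X by exact: ip_ge0.
apply/ler_addgt0Pr => e e0.
pose C := Psi * T ^+ 2 + 30 * T ^+ 2 * (k%:R ^+ 2 * Vm ^+ 2) + 1.
have PT : 0 <= Psi * T ^+ 2 by rewrite mulr_ge0 ?sqr_ge0.
have kT : 0 <= 30 * T ^+ 2 * (k%:R ^+ 2 * Vm ^+ 2).
  by rewrite mulr_ge0 ?sqr_ge0// mulr_ge0 ?sqr_ge0.
have C0 : 0 < C by rewrite /C ltr_wpDl// addr_ge0.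
pose ep := e / C; have ep0 : 0 < ep by rewrite divr_gt0.
have [N1 H1] := tail_unif (t0 + T) ep0.
pose N := maxn (maxn N1 J0) k.+1.
have kN : (k < N)%N by rewrite leq_max leqnn orbT.
have NJ : (J0 <= N)%N by rewrite (leq_trans (leq_maxr N1 _)) ?leq_maxl.
have {}H1 := H1 N (leq_trans (leq_maxl _ _) (leq_maxl _ _)).
have tI t : t0 <= t <= t0 + T -> 0 < t /\ 0 <= t <= t0 + T.
  by move=> /andP[a b]; have t1 := lt_le_trans t00 a; rewrite (ltW t1).
(* The truncated energy misses at most [ep] of the norm, which is at least X on the window; the
   maximum keeps the lower bound nonnegative. *)
pose lo := Num.max 0 (X - ep).
have cvg_coef b j t : 0 < t -> {for t, continuous (coef b k j)}.
  by move=> t1; exact: (pairing_cts (sb b k j) (ltW t1)).2.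
have cvg_fcoef b j t : 0 < t -> {for t, continuous (fcoef b k j)}.
  by move=> t1; exact: (pairing_cts (svb b k j) (ltW t1)).2.
have := @time_step R 'I_N (fun j : 'I_N => damp k j) (fun j l : 'I_N => k%:R * @Umat R N v j l) Psi
  (rb N NJ) P0 t0 T (k%:R ^+ 2 * Vm ^+ 2 * ep) lo Y (fun j : 'I_N => coef false k j) (fun j : 'I_N => coef true k j)
  (fun (j : 'I_N) t => k%:R * fcoef true k j t - damp k j * coef false k j t)
  (fun (j : 'I_N) t => - k%:R * fcoef false k j t - damp k j * coef true k j t) T0.
have lo0 : 0 <= lo by rewrite le_max lexx.
move=> /(_ lo0) H.
have {H} : Psi * T ^+ 2 * lo <= 120 * Y + 30 * T ^+ 2 * (k%:R ^+ 2 * Vm ^+ 2 * ep).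
  apply: H.
  - by move=> j t /tI[t1 _]; exact: flow_der.
  - by move=> j t /tI[t1 _]; exact: flow_der.
  - by move=> j t /tI[t1 _]; apply: cts_at_lincomb; [exact: cvg_fcoef|exact: cvg_coef].
  - by move=> j t /tI[t1 _]; apply: cts_at_lincomb; [exact: cvg_fcoef|exact: cvg_coef].
  - move=> t /tI[t1 tt].
    apply: le_trans (_ : k%:R ^+ 2 * \sum_(j < N) (res false k j N t ^+ 2 + res true k j N t ^+ 2) <= _).
      rewrite mulr_sumr; apply: ler_sum => j _.
      rewrite /galr /gali !(fcoef_split _ _ (ltW t1) kN).
      have e1 b : \sum_(l < N) k%:R * Umat v j l * coef b k l t = k%:R * \sum_(l < N) Umat v j l * coef b k l t.
        by rewrite mulr_sumr; apply: eq_bigr => l _; rewrite mulrA.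
      by rewrite !e1 le_eqVlt; apply/orP; left; apply/eqP; ring.
    rewrite -mulrA ler_wpM2l ?sqr_ge0//.
    apply: le_trans (res_bessel (ltW t1) kN) _; rewrite ler_wpM2l ?sqr_ge0//.
    exact: H1.
  - move=> t tt; have [t1 t2] := tI t tt; have /andP[ta tb] := tt.
    rewrite -/(energy k N t); apply/andP; split; last first.
      apply: le_trans (energy_le (ltW t1) kN) _; apply: norm_nonincreasing.
      by rewrite s0 (le_trans _ ta)// lerDl ltW.
    have En0 : 0 <= energy k N t by apply: sumr_ge0 => j _; rewrite addr_ge0 ?sqr_ge0.
    rewrite ge_max En0 /=.
    have h1 : X <= ip2 (h t) (h t) by apply: norm_nonincreasing; rewrite (ltW t1).
    have h2 := H1 t t2; rewrite (norm_energy (ltW t1) kN) in h1.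
    by move: h1 h2; lra.
have hlo : X - ep <= lo by rewrite le_max lexx orbT.
have := ler_wpM2l PT hlo.
have eE : C * ep = e by rewrite /ep mulrCA divff ?mulr1// gt_eqF.
rewrite -eE /C; move: ep0; clear -PT.
move: (Psi * T ^+ 2) (30 * T ^+ 2) (k%:R ^+ 2 * Vm ^+ 2) (Psi * T ^+ 2 * lo) => a b c d.
by lra.
Qed.

End Flow.

Section Decay.
Context {R : realType}.

(** After division by k, the shift a becomes part of an admissible mu. The x-diffusion enters the
    estimate here and only increases mu. *)
Lemma resolvent_bound_scale (J : finType) (b : J -> R) (U : J -> J -> R) (P k a : R) :
  0 < k -> 0 <= a -> resolvent_bound b U P ->
  resolvent_bound (fun j => k * b j + a) (fun j l => k * U j l) (k ^+ 2 * P).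
Proof.
move=> k0 a0 H mu lam p q mu0.
have m0 : 0 <= (mu + a) / k by rewrite divr_ge0 ?addr_ge0// ltW.
have := ler_wpM2l (sqr_ge0 k) (H _ (lam / k) p q m0).
rewrite mulrA => /le_trans; apply; rewrite mulr_sumr; apply: ler_sum => j _.
have kn : k != 0 by rewrite gt_eqF.
have e (f : J -> R) : \sum_l k * U j l * f l = k * \sum_l U j l * f l.
  by rewrite mulr_sumr; apply: eq_bigr => l _; rewrite mulrA.
rewrite /galr /gali !e le_eqVlt; apply/orP; left; apply/eqP.
by field.
Qed.

Lemma flow_decay (v : R -> R) (Vm nu nu' lam : R) (h : R -> R * R -> R) (k J0 : nat) (t : R) :
  continuous v -> (forall y, `|v y| <= Vm) -> 0 <= nu -> 0 <= nu' ->
  weak_flow v nu nu' h -> (forall b m j, m != k -> coef h b m j 0 = 0) ->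
  0 < lam ->
  (forall J, (J0 <= J)%N -> resolvent_bound (fun j : 'I_J => damp nu nu' k j)
    (fun j l : 'I_J => k%:R * @Umat R J v j l) (lam ^+ 2)) ->
  0 <= t -> ip2 (h t) (h t) <= 2 * expR (- (lam / 88 * t)) * ip2 (h 0) (h 0).
Proof.
move=> cv vV nu0 nu'0 wf hk lam0 rb t0.
(* Then lam^2 T^2 = 484 and 120 / 484 < 1/2 <= exp (-1/2): the squared norm loses a factor exp
   (-1/2) over each period 2 T = 44 / lam, which is the rate lam / 88. *)
pose T := 22 / lam; have T0 : 0 < T by rewrite divr_gt0.
pose N s := ip2 (h s) (h s); have N0 s : 0 <= N s by exact: ip_ge0.
have mono s r : 0 <= s <= r -> N r <= N s.
  exact: (norm_nonincreasing cv vV nu0 nu'0 wf hk).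
pose P := T + T; have P0 : 0 < P by rewrite addr_gt0.
have eh : 2^-1 <= expR (- 2^-1) :> R.
  by apply: le_trans (expR_ge1Dx _); lra.
have step s : 0 <= s -> N (s + P) <= expR (- 2^-1) * N s.
  move=> s0; have := decay_step cv vV nu0 nu'0 wf hk (sqr_ge0 lam) T0 rb s0.
  have -> : lam ^+ 2 * T ^+ 2 = 484 by rewrite /T; field; rewrite gt_eqF.
  rewrite -addrA -/P -/(N _) -/(N _) => H.
  have : 2^-1 * N s <= expR (- 2^-1) * N s by rewrite ler_wpM2r.
  by have := N0 s; move: H; lra.
have iter n : N (n%:R * P) <= expR (- (n%:R / 2)) * N 0.
  elim: n => [|n IH]; first by rewrite !mul0r oppr0 expR0 mul1r.
  rewrite -natr1 mulrDl mul1r; apply: le_trans (step _ _) _.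
    by rewrite mulr_ge0// ltW.
  rewrite mulrDl mul1r opprD expRD (mulrC (expR (- (n%:R / 2)))) -mulrA.
  by rewrite ler_wpM2l// expR_ge0.
pose n := Num.truncn (t / P).
have tP : 0 <= t / P by rewrite divr_ge0// ltW.
have /andP[n1 n2] := truncn_itv tP.
have nt : n%:R * P <= t by rewrite -ler_pdivlMr.
have nP0 : 0 <= n%:R * P by rewrite mulr_ge0// ltW.
rewrite -/(N t) -/(N 0); apply: le_trans (mono _ _ (_ : 0 <= n%:R * P <= t)) _.
  by rewrite nP0.
apply: le_trans (iter n) _; apply: ler_wpM2r; first exact: N0.
(* The prefactor 2 pays for the last incomplete period, worth at most exp (1/2). *)
have e2 : expR 2^-1 <= 2 :> R.
  rewrite -[leRHS]invrK -[leLHS]invrK lef_pV2 ?posrE ?invr_gt0 ?expR_gt0//.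
  by rewrite -expRN.
apply: le_trans (_ : expR 2^-1 * expR (- (lam / 88 * t)) <= _); last first.
  by rewrite ler_wpM2r// expR_ge0.
rewrite -expRD ler_expR.
have -> : lam / 88 * t = t / P / 2 by rewrite /P /T; field; rewrite gt_eqF.
by move: n2; rewrite -natr1 -/n; lra.
Qed.

End Decay.

(** * Solution semigroups *)

Section ProductFunctions.
Context {R : realType}.
Implicit Types (F G : R -> R) (z : R * R).

Definition tensor F G : R * R -> R := fun z => F z.1 * G z.2.

Lemma tensor_cts F G : continuous F -> continuous G -> continuous (tensor F G).
Proof.
move=> cF cG z; apply: (@cvgM _ _ _ _ (fun z : R * R => F z.1) (fun z : R * R => G z.2)).
  by apply: (cvg_comp _ _ cvg_fst); exact: cF.
by apply: (cvg_comp _ _ cvg_snd); exact: cG.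
Qed.

Lemma der_tensor1 F G a z : is_derive z.1 1 F a -> is_derive z ((1, 0) : R * R) (tensor F G) (a * G z.2).
Proof.
move=> dF; have dq : h^-1 *: ((F \o shift z.1) (h *: (1 : R)) - F z.1) @[h --> (0 : R)^'] --> a.
  by have [/cvg_ex[l dl] <-] := dF; rewrite /derive (cvg_lim _ dl).
have q : h^-1 *: ((tensor F G \o shift z) (h *: ((1, 0) : R * R)) - tensor F G z) @[h --> (0 : R)^']
    --> a * G z.2.
  have -> : (fun h : R => h^-1 *: ((tensor F G \o shift z) (h *: ((1, 0) : R * R)) - tensor F G z)) =
      (fun h => h^-1 *: ((F \o shift z.1) (h *: (1 : R)) - F z.1) * G z.2).
    apply: funext => h; rewrite /tensor /shift /= scaler0 add0r -mulrBl.
    by rewrite /GRing.scale/= mulrA.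
  by apply: cvgM => //; exact: cvg_cst.
by apply: DeriveDef; [apply/cvg_ex; exists (a * G z.2)|exact: cvg_lim q].
Qed.

Lemma der_tensor2 F G a z : is_derive z.2 1 G a -> is_derive z ((0, 1) : R * R) (tensor F G) (F z.1 * a).
Proof.
move=> dG; have dq : h^-1 *: ((G \o shift z.2) (h *: (1 : R)) - G z.2) @[h --> (0 : R)^'] --> a.
  by have [/cvg_ex[l dl] <-] := dG; rewrite /derive (cvg_lim _ dl).
have q : h^-1 *: ((tensor F G \o shift z) (h *: ((0, 1) : R * R)) - tensor F G z) @[h --> (0 : R)^']
    --> F z.1 * a.
  have -> : (fun h : R => h^-1 *: ((tensor F G \o shift z) (h *: ((0, 1) : R * R)) - tensor F G z)) =
      (fun h => F z.1 * (h^-1 *: ((G \o shift z.2) (h *: (1 : R)) - G z.2))).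
    apply: funext => h; rewrite /tensor /shift /= scaler0 add0r -mulrBr.
    by rewrite /GRing.scale/= mulrCA.
  by apply: cvgM => //; exact: cvg_cst.
by apply: DeriveDef; [apply/cvg_ex; exists (F z.1 * a)|exact: cvg_lim q].
Qed.

Lemma dx_tensor F G F' : (forall x : R, is_derive x 1 F (F' x)) -> dx (tensor F G) = tensor F' G.
Proof. by move=> dF; apply: funext => z; rewrite /dx; have [_ ->] := der_tensor1 G (dF z.1). Qed.

Lemma dy_tensor F G G' : (forall x : R, is_derive x 1 G (G' x)) -> dy (tensor F G) = tensor F G'.
Proof. by move=> dG; apply: funext => z; rewrite /dy; have [_ ->] := der_tensor2 F (dG z.2). Qed.

Lemma C1_tensor F G F' G' : (forall x : R, is_derive x 1 F (F' x)) ->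
  (forall x : R, is_derive x 1 G (G' x)) -> continuous F' -> continuous G' ->
  C1_plane (tensor F G).
Proof.
move=> dF dG cF' cG'; have cF := der_continuous dF; have cG := der_continuous dG.
split; first exact: tensor_cts.
- by move=> z; have [] := der_tensor1 G (dF z.1).
- by move=> z; have [] := der_tensor2 F (dG z.2).
- by rewrite (dx_tensor _ dF); exact: tensor_cts.
- by rewrite (dy_tensor _ dG); exact: tensor_cts.
Qed.

Lemma C2_tensor F G F' G' F2 G2 : (forall x : R, is_derive x 1 F (F' x)) ->
  (forall x : R, is_derive x 1 G (G' x)) -> (forall x : R, is_derive x 1 F' (F2 x)) ->
  (forall x : R, is_derive x 1 G' (G2 x)) -> continuous F2 -> continuous G2 ->
  C2_plane (tensor F G).
Proof.
move=> dF dG dF' dG' cF2 cG2.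
have cF' := der_continuous dF'; have cG' := der_continuous dG'.
split; first exact: (C1_tensor dF dG).
- by rewrite (dx_tensor _ dF); exact: (C1_tensor dF' dG).
- by rewrite (dy_tensor _ dG); exact: (C1_tensor dF dG').
Qed.

Implicit Types (b : bool) (m j : nat).

Lemma der_xb1 b m (x : R) : is_derive x 1 (xb b m) (sg b m * xb (~~ b) m x).
Proof. exact: der_xb. Qed.

Lemma der_xb2 b m (x : R) :
  is_derive x 1 (fun x => sg b m * xb (~~ b) m x) (- m%:R ^+ 2 * xb b m x).
Proof.
apply: (is_derive_eq (derZ _ (der_xb1 (~~ b) m x))); rewrite negbK /sg.
by case: b => /=; ring.
Qed.

Lemma der_cosb2 j (y : R) : is_derive y 1 (fun y => - (wav j * sinb j y)) (- wav j ^+ 2 * cosb j y).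
Proof.
by apply: (is_derive_eq (derN (derZ _ (der_sinb j y)))); ring.
Qed.

Lemma xb_periodic b m (x : R) : xb b m (x + 2 * pi) = xb b m x.
Proof.
have e : m%:R * (2 * pi) = (pi *+ 2) *+ m :> R by rewrite !mulr_natl.
rewrite /xb mulrDr e.
by rewrite (periodicn (@sinD2pi R)) (periodicn (@cosD2pi R)).
Qed.

Lemma bas_tensor b m j : bas b m j = tensor (xb b m) (@cosb R j).
Proof. by []. Qed.

Lemma test_fun_bas b m j : test_fun (@bas R b m j).
Proof.
rewrite bas_tensor; split.
- apply: (C2_tensor (der_xb1 b m) (der_cosb j) (der_xb2 b m) (der_cosb2 j)).
  + by apply: ctsZ; exact: cts_xb.
  + by apply: ctsZ; exact: cts_cosb.
- by move=> x y; rewrite /tensor /= xb_periodic.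
- by move=> x; rewrite (dy_tensor _ (der_cosb j)) /tensor /= sinb0 !(mulr0, oppr0).
- by move=> x; rewrite (dy_tensor _ (der_cosb j)) /tensor /= sinb1 !(mulr0, oppr0).
Qed.

Lemma dx_bas b m j : dx (@bas R b m j) = fun z => sg b m * bas (~~ b) m j z.
Proof.
by rewrite bas_tensor (dx_tensor _ (der_xb1 b m)); apply: funext => z; rewrite /tensor /bas mulrA.
Qed.

Lemma dxx_bas b m j : dx (dx (@bas R b m j)) = fun z => - m%:R ^+ 2 * bas b m j z.
Proof.
rewrite bas_tensor (dx_tensor _ (der_xb1 b m)) (dx_tensor _ (der_xb2 b m)).
by apply: funext => z; rewrite /tensor /=; ring.
Qed.

Lemma dyy_bas b m j : dy (dy (@bas R b m j)) = fun z => - wav j ^+ 2 * bas b m j z.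
Proof.
rewrite bas_tensor (dy_tensor _ (der_cosb j)) (dy_tensor _ (der_cosb2 j)).
by apply: funext => z; rewrite /tensor /=; ring.
Qed.

Lemma adj_full_bas (u : R -> R) nu b m j z : adj_full u nu (bas b m j) z =
  sg b m * (u z.2 * bas (~~ b) m j z) - damp nu nu m j * bas b m j z.
Proof. by rewrite /adj_full dxx_bas dyy_bas dx_bas /damp; ring. Qed.

Lemma adj_hypo_bas (u : R -> R) nu b m j z : adj_hypo u nu (bas b m j) z =
  sg b m * (u z.2 * bas (~~ b) m j z) - damp nu 0 m j * bas b m j z.
Proof. by rewrite /adj_hypo dyy_bas dx_bas /damp; ring. Qed.

End ProductFunctions.

Lemma ae_sub d (T : measurableType d) (R : realType) (mu : {measure set T -> \bar R})
    (P Q : T -> Prop) : (forall z, P z -> Q z) ->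
  {ae mu, forall z, P z} -> {ae mu, forall z, Q z}.
Proof. by move=> PQ; apply: filterS. Qed.

Lemma ae_eq_ip d (T : measurableType d) (R : realType) (mu : {measure set T -> \bar R})
    (D : set T) (f g h : T -> R) : measurable D ->
  measurable_fun D f -> measurable_fun D g -> measurable_fun D h ->
  {ae mu, forall z, D z -> f z = g z} -> ip mu D f h = ip mu D g h.
Proof.
move=> mD mf mg mh fg; rewrite /ip /Rintegral; congr fine.
apply: ae_eq_integral => //.
- by apply/measurable_EFinP; exact: measurable_funM.
- by apply/measurable_EFinP; exact: measurable_funM.
- by apply: filterS fg => z H Dz; rewrite H.
Qed.

(** * Real and imaginary parts in the complex norm *)

Section SquareNorm.
Context {R : realType}.
Implicit Types f g : R * R -> R[i].

Definition re f : R * R -> R := fun z => complex.Re (f z).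
Definition im f : R * R -> R := fun z => complex.Im (f z).
Definition sqnorm f : R := ip2 (re f) (re f) + ip2 (im f) (im f).
Definition sqi2 f := sqi (@leb2 R) (@rect R) (re f) /\ sqi (@leb2 R) (@rect R) (im f).

Lemma L2normE f : L2norm f =
  ((\int[@leb2 R]_(z in @rect R) (re f z ^+ 2 + im f z ^+ 2)%:E) `^ 2^-1)%E.
Proof.
rewrite /L2norm unlock; congr (_ `^ _)%E; rewrite [RHS]integral_mkcond.
apply: eq_integral => z _; rewrite /patch; case: ifPn => _ /=.
  rewrite /re /im; case: (f z) => a b /=.
  by rewrite ger0_norm ?sqrtr_ge0// powR_mulrn ?sqrtr_ge0// sqr_sqrtr// addr_ge0 ?sqr_ge0.
by rewrite normr0 powR0// pnatr_eq0.
Qed.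

Lemma sqi2_norm f : sqi2 f -> L2norm f = (Num.sqrt (sqnorm f))%:E.
Proof.
move=> [sr si]; have mD := @measurable_rect R.
have e : (\int[@leb2 R]_(z in @rect R) (re f z ^+ 2 + im f z ^+ 2)%:E = (sqnorm f)%:E)%E.
  have ii := integrableD mD sr.2 si.2.
  rewrite /sqnorm /ip2 /ip -RintegralD//; [|exact: sqi_mul..].
  rewrite /Rintegral fineK.
    by apply: eq_integral => z _; rewrite !expr2.
  by apply: integrable_fin_num => //; apply: integrableD => //; exact: sqi_mul.
rewrite L2normE e poweR_EFin powR12_sqrt//.
by rewrite addr_ge0// ip_ge0.
Qed.

Lemma L2_sqi2 f : L2 f -> sqi2 f.
Proof.
move=> [mr mi]; rewrite L2normE => /lty_poweRy; rewrite invr_eq0 pnatr_eq0 => /(_ isT) fin.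
have mD := @measurable_rect R.
have ms : measurable_fun (@rect R : set (@plane R)) (fun z => re f z ^+ 2 + im f z ^+ 2).
  by apply: measurable_funD; apply: measurable_funX.
have ii : (@leb2 R).-integrable (@rect R) (EFin \o (fun z => re f z ^+ 2 + im f z ^+ 2)).
  apply/integrableP; split; first exact/measurable_EFinP.
  apply: le_lt_trans fin; rewrite le_eqVlt; apply/orP; left; apply/eqP.
  by apply: eq_integral => z _; rewrite /= ger0_norm// addr_ge0 ?sqr_ge0.
split; split=> //.
  apply: (le_integrable mD _ _ ii); first by apply/measurable_EFinP; exact: measurable_funX.
  by move=> z _ /=; rewrite lee_fin !ger0_norm ?addr_ge0 ?sqr_ge0// lerDl sqr_ge0.
apply: (le_integrable mD _ _ ii); first by apply/measurable_EFinP; exact: measurable_funX.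
by move=> z _ /=; rewrite lee_fin !ger0_norm ?addr_ge0 ?sqr_ge0// lerDr sqr_ge0.
Qed.

Lemma sqi2_L2 f : sqi2 f -> L2 f.
Proof. by move=> sf; have [sr si] := sf; split; [exact: sr.1|exact: si.1|rewrite sqi2_norm// ltry]. Qed.

End SquareNorm.

(** * Integrals along x of a square integrable function *)

Section Slices.
Context {R : realType}.
Variable g : R * R -> R.
Hypothesis sg : sqi (@leb2 R) (@rect R) g.

Let leb := @lebesgue_measure R.
Let Ix : set (measurableTypeR R) := `[0, 2 * pi].
Let mIx : measurable Ix := @measurable_Ix R.
Let mI01 : measurable (@I01 R : set (measurableTypeR R)) := @measurable_I01 R.
(** Extension by zero, which gives access to the Fubini and Tonelli theorems on the whole
    product. *)
Let G := g \_ (@rect R).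
Let S (y : R) : \bar R := (\int[leb]_x (G (x, y) ^+ 2)%:E)%E.

Definition slice (y : R) : R := \int[leb]_(x in Ix) g (x, y).

Let mG : measurable_fun (setT : set (@plane R)) G.
Proof. by apply/(measurable_restrictT _ (@measurable_rect R)); exact: sg.1. Qed.

Let GE x y : Ix x -> I01 y -> G (x, y) = g (x, y).
Proof. by move=> xI yI; rewrite /G patchE mem_set. Qed.

Let G0 x y : ~ Ix x -> G (x, y) = 0.
Proof. by move=> xI; rewrite /G patchE memNset// => -[]. Qed.

Let mGx y : measurable_fun (setT : set (measurableTypeR R)) (fun x => G (x, y)).
Proof. exact: (measurableT_comp mG (measurable_pair2 y)). Qed.

Let S_ge0 y : (0 <= S y)%E.
Proof. by apply: integral_ge0 => x _; rewrite lee_fin sqr_ge0. Qed.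

Let ivl_len : \int[leb]_(x in Ix) (1 * 1 : R) = 2 * pi.
Proof.
have := @ipx_cos R 0; rewrite eqxx [X in _ = X]mulr1 => <-.
by apply: eq_Rintegral => x _; rewrite mul0r cos0 mulr1.
Qed.

(** Cauchy-Schwarz on one horizontal line, stated in the extended reals because [S y] may be
    infinite for exceptional y. *)
Lemma slice_sqr_le y : I01 y -> ((slice y ^+ 2)%:E <= (2 * pi)%:E * S y)%E.
Proof.
move=> yI; have p0 : 0 < 2 * pi :> R by rewrite mulr_gt0 ?pi_gt0.
have [Sy|Sy] := eqVneq (S y) +oo%E.
  by rewrite Sy gt0_muley ?lte_fin// leey.
have Sfin : S y \is a fin_num by rewrite ge0_fin_numE// ltey.
have iT : leb.-integrable setT (EFin \o (fun x => G (x, y) ^+ 2)).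
  apply/integrableP; split; first by apply/measurable_EFinP; exact: measurable_funX.
  under eq_integral do rewrite /= ger0_norm ?sqr_ge0//.
  by rewrite ltey.
have ss : sqi leb Ix (fun x => G (x, y)).
  split; first exact: measurable_funTS.
  by apply: (integrableS measurableT) => //.
have s1 : sqi leb Ix (fun=> 1).
  by apply: cts_sqix; exact: cts_cst.
have CS := ip_CS mIx ss s1.
have -> : slice y = ip leb Ix (fun x => G (x, y)) (fun=> 1).
  by apply: eq_Rintegral => x /[!inE] xI; rewrite mulr1 GE.
apply: le_trans (_ : (ip leb Ix (fun x => G (x, y)) (fun x => G (x, y)) * (2 * pi))%:E <= _)%E.
  by rewrite lee_fin -ivl_len.
rewrite -(fineK Sfin) -EFinM lee_fin mulrC ler_pM2l//.
rewrite /ip /Rintegral; apply: fine_le => //.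
- apply: integrable_fin_num => //; exact: sqi_mul.
- under eq_integral do rewrite -expr2.
  apply: ge0_subset_integral => //.
    by apply/measurable_EFinP; exact: measurable_funX.
  by move=> x _; rewrite lee_fin sqr_ge0.
Qed.

Let iG : (@leb2 R).-integrable setT (EFin \o G).
Proof.
have s1 := sqi_cst (@measurable_rect R) (@leb2_rect_lty R) 1.
have := sqi_mul (@measurable_rect R) sg s1.
under [X in integrable _ _ (_ \o X) -> _]eq_fun do rewrite mulr1.
move/(@integrable_mkcond _ (@plane R) R (@leb2 R) (@rect R) _ (@measurable_rect R)).
by rewrite restrict_EFin.
Qed.

Lemma measurable_slice : measurable_fun (@I01 R : set (measurableTypeR R)) slice.
Proof.
have mF : measurable_fun (@I01 R : set (measurableTypeR R)) (fubini_G leb (EFin \o G)).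
  by apply: measurable_funTS; exact: (@measurable_fubini_G _ _ _ _ _ leb leb _ iG).
have := measurableT_comp (fine_measurable measurableT) mF.
apply: eq_measurable_fun => y /[!inE] yI.
rewrite /= /slice /fubini_G -/(Rintegral leb setT (fun x => G (x, y))) [RHS]Rintegral_mkcond.
apply: eq_Rintegral => x _; rewrite patchE; case: ifPn => [|/negP].
  by rewrite inE => xI; rewrite GE.
by rewrite inE; exact: G0.
Qed.

Lemma slice_bound : sqi leb (@I01 R) slice /\ ip1 slice slice <= 2 * pi * ip2 g g.
Proof.
have p0 : 0 <= 2 * pi :> R by rewrite mulr_ge0 ?pi_ge0.
have mG2 : measurable_fun (setT : set (@plane R)) (EFin \o (fun z => G z ^+ 2)).
  by apply/measurable_EFinP; exact: measurable_funX.
have G2 (z : @plane R) : (0 <= (G z ^+ 2 : R)%:E)%E by rewrite lee_fin sqr_ge0.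
have mS : measurable_fun (setT : set (measurableTypeR R)) S.
  exact: (@measurable_fun_fubini_tonelli_G _ _ _ _ _ leb _ mG2 G2).
have ig := sqi_mul (@measurable_rect R) sg sg.
have IS : (\int[leb]_y S y = (ip2 g g)%:E)%E.
  rewrite -(@fubini_tonelli2 _ _ _ _ _ leb leb _ mG2 G2) /ip2 /ip /Rintegral fineK.
    rewrite [RHS]integral_mkcond; apply: eq_integral => z _.
    rewrite /= /G !patchE; case: ifPn => _; first by rewrite expr2.
    exact: (congr1 EFin (@expr0n R 2)).
  by apply: integrable_fin_num => //; exact: measurable_rect.
have msl2 : measurable_fun (@I01 R : set (measurableTypeR R)) (EFin \o (fun y => slice y ^+ 2)).
  by apply/measurable_EFinP; apply: measurable_funX; exact: measurable_slice.
have H : (\int[leb]_(y in @I01 R) (slice y ^+ 2)%:E <= (2 * pi * ip2 g g)%:E)%E.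
  apply: le_trans (_ : \int[leb]_(y in @I01 R) ((2 * pi)%:E * S y) <= _)%E.
    apply: ge0_le_integral => //.
    - by move=> y _; rewrite lee_fin sqr_ge0.
    - by apply: measurable_funeM; exact: measurable_funTS.
    - exact: slice_sqr_le.
  rewrite ge0_integralZl//; last exact: measurable_funTS.
  rewrite [X in (_ <= X)%E]EFinM -IS; apply: lee_wpmul2l; first by rewrite lee_fin.
  exact: ge0_subset_integral.
have isl : leb.-integrable (@I01 R) (EFin \o (fun y => slice y ^+ 2)).
  apply/integrableP; split=> //; under eq_integral do rewrite /= ger0_norm ?sqr_ge0//.
  by apply: le_lt_trans H _; rewrite ltry.
split; first by split=> //; exact: measurable_slice.
rewrite -lee_fin; apply: le_trans H; rewrite /ip1 /ip /Rintegral fineK.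
  by rewrite le_eqVlt; apply/orP; left; apply/eqP; apply: eq_integral => y _; rewrite expr2.
under eq_integral do rewrite -expr2.
exact: integrable_fin_num.
Qed.

End Slices.

(** * Projection on a Fourier mode in x *)

Section Projection.
Context {R : realType}.
Variables (k : int) (K : nat).
Hypothesis kK : `|k|%N = K.
Hypothesis K0 : (0 < K)%N.
Implicit Types (a b : R -> R) (f : R * R -> R[i]).

Let ck (x : R) : R := cos (k%:~R * x).
Let sk (x : R) : R := sin (k%:~R * x).
(** The Fourier coefficient uses the signed frequency, the real basis its absolute value; the sign
    only affects the sine. *)
Let sgk : R := if 0 <= k then 1 else -1.

Let kE : k%:~R = sgk * K%:R :> R.
Proof.
rewrite /sgk -kK; case: k => n /=; first by rewrite mul1r.
by rewrite mulN1r.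
Qed.

Let ckE x : ck x = cos (K%:R * x).
Proof. by rewrite /ck kE /sgk; case: ifP => _; rewrite ?mul1r// mulN1r mulNr cosN. Qed.

Let skE x : sk x = sgk * sin (K%:R * x).
Proof. by rewrite /sk kE /sgk; case: ifP => _; rewrite ?mul1r// !mulN1r mulNr sinN. Qed.

Let cck : continuous ck. Proof. exact: cts_cos_lin. Qed.
Let csk : continuous sk. Proof. exact: cts_sin_lin. Qed.
Let sck := cts_sqix cck.
Let ssk := cts_sqix csk.
Let mD := @measurable_rect R.

Let sgk2 : sgk * sgk = 1.
Proof. by rewrite /sgk; case: ifP => _; rewrite ?mulr1// mulrNN mulr1. Qed.

Let ck_ck : ipx ck ck = pi.
Proof.
rewrite (_ : ck = fun x => cos (K%:R * x)); last exact: funext ckE.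
by rewrite ipx_cos_cos eqxx addn_eq0 gtn_eqF// addr0 mulr1.
Qed.

Let ssinK : sqi (@lebesgue_measure R) `[0, 2 * pi] (fun x => sin (K%:R * x)).
Proof. by apply: cts_sqix; exact: cts_sin_lin. Qed.

Let sk_sk : ipx sk sk = pi.
Proof.
rewrite (_ : sk = fun x => sgk * sin (K%:R * x)); last exact: funext skE.
rewrite /ipx ipZl// ?ipZr//; last exact: sqiZ.
rewrite -/(ipx _ _) mulrA sgk2 mul1r ipx_sin_sin eqxx addn_eq0 gtn_eqF//.
by rewrite subr0 mulr1.
Qed.

Let ck_sk : ipx ck sk = 0.
Proof.
rewrite (_ : ck = fun x => cos (K%:R * x)); last exact: funext ckE.
rewrite (_ : sk = fun x => sgk * sin (K%:R * x)); last exact: funext skE.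
rewrite /ipx ipZr//; last by apply: cts_sqix; exact: cts_cos_lin.
by rewrite ipC -/(ipx _ _) ipx_sin_cos mulr0.
Qed.

Let wK : xw K != 0 :> R. Proof. by rewrite gt_eqF ?xw_gt0. Qed.

Lemma ck_xb c m : m != K -> ipx ck (xb c m) = 0.
Proof.
move=> mK; rewrite (_ : ck = fun x => (xw K)^-1 * xb false K x); last first.
  by apply: funext => x; rewrite ckE /xb mulKf.
have sx d n : sqi (@lebesgue_measure R) `[0, 2 * pi] (xb d n) by apply: cts_sqix; exact: cts_xb.
rewrite /ipx ipZl// -/(ipx _ _) xb_orthonormal (eq_sym K) (negPf mK) /= andbF.
by rewrite mulr0.
Qed.

Lemma sk_xb c m : m != K -> ipx sk (xb c m) = 0.
Proof.
move=> mK; rewrite (_ : sk = fun x => - sgk * (xw K)^-1 * xb true K x); last first.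
  by apply: funext => x; rewrite skE /xb; field.
have sx d n : sqi (@lebesgue_measure R) `[0, 2 * pi] (xb d n) by apply: cts_sqix; exact: cts_xb.
rewrite /ipx ipZl// -/(ipx _ _) xb_orthonormal (eq_sym K) (negPf mK) /= andbF.
by rewrite mulr0.
Qed.

Definition single_mode a b : R * R -> R := fun z => ck z.1 * a z.2 + sk z.1 * b z.2.

Section SingleMode.
Variables (a b : R -> R).
Hypothesis sa : sqi (@lebesgue_measure R) I01 a.
Hypothesis sb : sqi (@lebesgue_measure R) I01 b.

Lemma sqi_single_mode : sqi (@leb2 R) (@rect R) (single_mode a b).
Proof. by apply: sqiD => //; exact: sqi_prod. Qed.

Lemma single_mode_norm : ip2 (single_mode a b) (single_mode a b) = pi * (ip1 a a + ip1 b b).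
Proof.
have sA := sqi_prod sck sa; have sB := sqi_prod ssk sb.
have := ip_sqrD mD sA sB; rewrite -!/(ip2 _ _) !ip2X// ck_ck sk_sk ck_sk => ->.
by rewrite mul0r mulr0 addr0 mulrDr.
Qed.

Lemma single_mode_coef c m j : m != K -> ip2 (single_mode a b) (bas c m j) = 0.
Proof.
move=> mK; have sA := sqi_prod sck sa; have sB := sqi_prod ssk sb.
have sx d n : sqi (@lebesgue_measure R) `[0, 2 * pi] (xb d n) by apply: cts_sqix; exact: cts_xb.
have sc i : sqi (@lebesgue_measure R) I01 (cosb i) by apply: cts_sqi; exact: cts_cosb.
rewrite /ip2 ipDl//; last exact: sqi_bas.
by rewrite /bas -!/(ip2 _ _) !ip2X// ck_xb// sk_xb// !mul0r addr0.
Qed.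

End SingleMode.

Let ip1_scale c (s : R -> R) : sqi (@lebesgue_measure R) I01 s ->
  ip1 (fun y => c * s y) (fun y => c * s y) = c ^+ 2 * ip1 s s.
Proof.
move=> ss; have mI := @measurable_I01 R.
by rewrite /ip1 ipZl// ?ipZr//; [rewrite mulrA expr2|exact: sqiZ].
Qed.

Let mode_algebra (p A B : R) : p != 0 ->
  p * ((2 * p)^-1 ^+ 2 * A + (2 * p)^-1 ^+ 2 * B) +
  p * ((2 * p)^-1 ^+ 2 * B + (2 * p)^-1 ^+ 2 * A) = (A + B) / (2 * p).
Proof. by move=> p0; field. Qed.

Section ProjMode.
Variable f : R * R -> R[i].
Hypothesis sf : sqi2 f.

(** With [g2], the real and imaginary parts of f exp(- i k x); their normalised means in x, [a] and
    [b], form the Fourier coefficient. *)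
Let g1 z := re f z * ck z.1 + im f z * sk z.1.
Let g2 z := im f z * ck z.1 - re f z * sk z.1.
Let a y := (2 * pi)^-1 * slice g1 y.
Let b y := (2 * pi)^-1 * slice g2 y.

Let fourierE y : fourier k f y = Complex (a y) (b y).
Proof.
rewrite /fourier /a /b /slice; congr (Complex (_ * _) (_ * _)); apply: eq_Rintegral => x _;
  rewrite /g1 /g2 /re /im /ck /sk; case: (f (x, y)) => p q /=; rewrite cosN sinN; ring.
Qed.

Lemma re_proj : re (proj_mode k f) = single_mode a (fun y => - b y).
Proof.
by apply: funext => z; rewrite /re /proj_mode fourierE /single_mode /ck /sk /=; ring.
Qed.

Lemma im_proj : im (proj_mode k f) = single_mode b a.
Proof.
by apply: funext => z; rewrite /im /proj_mode fourierE /single_mode /ck /sk /=; ring.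
Qed.

Let scM (F : R -> R) (g : R * R -> R) : continuous F -> (forall x, `|F x| <= 1) ->
  sqi (@leb2 R) (@rect R) g -> sqi (@leb2 R) (@rect R) (fun z => g z * F z.1).
Proof.
move=> cF F1 sg; have := @sqi_bddM _ (@plane R) R (@leb2 R) (@rect R) mD
  (fun z => F z.1) g 1 (measurable_fst_cts cF) (fun z _ => F1 z.1) sg.
by under eq_fun do rewrite mulrC.
Qed.

Let ck1 x : `|ck x| <= 1. Proof. by rewrite ler_norml cos_geN1 cos_le1. Qed.
Let sk1 x : `|sk x| <= 1. Proof. by rewrite ler_norml sin_geN1 sin_le1. Qed.

Let sg1 : sqi (@leb2 R) (@rect R) g1.
Proof. by have [sr si] := sf; apply: sqiD => //; apply: scM. Qed.
Let sg2 : sqi (@leb2 R) (@rect R) g2.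
Proof. by have [sr si] := sf; apply: sqiB => //; apply: scM. Qed.

Let sa : sqi (@lebesgue_measure R) I01 a.
Proof. by apply: sqiZ; [exact: measurable_I01|have [] := slice_bound sg1]. Qed.
Let sb : sqi (@lebesgue_measure R) I01 b.
Proof. by apply: sqiZ; [exact: measurable_I01|have [] := slice_bound sg2]. Qed.
Let sNb : sqi (@lebesgue_measure R) I01 (fun y => - b y).
Proof. by apply: sqiN => //; exact: measurable_I01. Qed.

Lemma sqi2_proj : sqi2 (proj_mode k f).
Proof. by split; rewrite ?re_proj ?im_proj; exact: sqi_single_mode. Qed.

Lemma proj_coef c m j : m != K -> ip2 (re (proj_mode k f)) (bas c m j) = 0 /\
  ip2 (im (proj_mode k f)) (bas c m j) = 0.
Proof. by move=> mK; rewrite re_proj im_proj; split; exact: single_mode_coef. Qed.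

(** Multiplication by exp(- i k x) preserves the norm, and the factor 2 pi lost on slices is
    recovered from the normalisation of the mean. *)
Lemma sqnorm_proj : sqnorm (proj_mode k f) <= sqnorm f.
Proof.
have p0 : 0 < 2 * pi :> R by rewrite mulr_gt0 ?pi_gt0.
have mI := @measurable_I01 R.
rewrite /sqnorm re_proj im_proj !single_mode_norm//.
have [sl1 n1] := slice_bound sg1; have [sl2 n2] := slice_bound sg2.
have Nb : ip1 (fun y => - b y) (fun y => - b y) = ip1 b b.
  by apply: eq_Rintegral => y _; rewrite mulrNN.
have na : ip1 a a = (2 * pi)^-1 ^+ 2 * ip1 (slice g1) (slice g1).
  exact: ip1_scale.
have nb : ip1 b b = (2 * pi)^-1 ^+ 2 * ip1 (slice g2) (slice g2).
  exact: ip1_scale.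
have [sr si] := sf.
have -> : ip2 (re f) (re f) + ip2 (im f) (im f) = ip2 g1 g1 + ip2 g2 g2.
  rewrite /ip2 /ip -!RintegralD//; [|exact: sqi_mul..].
  apply: eq_Rintegral => z _; rewrite /g1 /g2.
  have : ck z.1 ^+ 2 + sk z.1 ^+ 2 = 1 by exact: cos2Dsin2.
  move: (ck _) (sk _) (re _ _) (im _ _) => c s x y cs.
  by rewrite -[LHS]mulr1 -cs; ring.
rewrite Nb na nb.
have h := lerD n1 n2; rewrite -mulrDr in h.
have -> : pi * ((2 * pi)^-1 ^+ 2 * ip1 (slice g1) (slice g1) +
    (2 * pi)^-1 ^+ 2 * ip1 (slice g2) (slice g2)) +
  pi * ((2 * pi)^-1 ^+ 2 * ip1 (slice g2) (slice g2) +
    (2 * pi)^-1 ^+ 2 * ip1 (slice g1) (slice g1)) =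
  (ip1 (slice g1) (slice g1) + ip1 (slice g2) (slice g2)) / (2 * pi).
  by apply: mode_algebra; rewrite gt_eqF ?pi_gt0.
by rewrite ler_pdivrMr// mulrC.
Qed.

End ProjMode.

End Projection.

(** * From the semigroup to the operator norm *)

Section SemigroupFlow.
Context {R : realType}.
Implicit Types (f : R * R -> R[i]) (b : bool) (m j : nat).
Variables (A : (R * R -> R) -> R * R -> R) (S : R -> (R * R -> R[i]) -> R * R -> R[i]).
Variables (v : R -> R) (Vm nu nu' : R).
Hypothesis AS : solution_semigroup A S.
Hypothesis cv : continuous v.
Hypothesis vV : forall y, `|v y| <= Vm.
Hypothesis nu0 : 0 <= nu.
Hypothesis nu'0 : 0 <= nu'.
Hypothesis A_bas : forall b m j z, rect z -> A (bas b m j) z =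
  sg b m * (v z.2 * bas (~~ b) m j z) - damp nu nu' m j * bas b m j z.

Let mD := @measurable_rect R.

Lemma pairing_adj (h : R * R -> R) b m j : sqi (@leb2 R) (@rect R) h ->
  pairing h (A (bas b m j)) =
  sg b m * ip2 h (fun z => v z.2 * bas (~~ b) m j z) - damp nu nu' m j * ip2 h (bas b m j).
Proof.
move=> sh; have sb c := @sqi_bas R c m j.
have sv c : sqi (@leb2 R) (@rect R) (fun z => v z.2 * bas c m j z) by exact: (sqi_vM cv vV).
transitivity (ip2 h (fun z => sg b m * (v z.2 * bas (~~ b) m j z) - damp nu nu' m j * bas b m j z)).
  by apply: eq_ip => // z /A_bas.
rewrite /ip2 ipBr//; [|exact: sqiZ..].
by rewrite !ipZr.
Qed.

Lemma semigroup_near f (t e : R) : L2 f -> 0 <= t -> 0 < e -> \forall s \near t, 0 <= s ->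
  sqnorm (fun z => S s f z - S t f z) <= e.
Proof.
move=> Lf t0 e0; have se : 0 < Num.sqrt e by rewrite sqrtr_gt0.
have := semigroup_continuous AS Lf t0.
move=> /fine_cvgP[_ /cvgrPdist_le/(_ _ se)]; rewrite near_withinE.
apply: filterS => s H s0; have := H s0; rewrite /= sub0r normrN.
have ss : sqi2 (fun z => S s f z - S t f z).
  have [a1 a2] := L2_sqi2 (semigroup_L2 AS s0 Lf).
  have [b1 b2] := L2_sqi2 (semigroup_L2 AS t0 Lf).
  split.
    have -> : re (fun z => S s f z - S t f z) = (fun z => re (S s f) z - re (S t f) z).
      by apply: funext => z; rewrite /re; case: (S s f z) => ? ?; case: (S t f z).
    exact: sqiB.
  have -> : im (fun z => S s f z - S t f z) = (fun z => im (S s f) z - im (S t f) z).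
    by apply: funext => z; rewrite /im; case: (S s f z) => ? ?; case: (S t f z).
  exact: sqiB.
rewrite sqi2_norm//= ger0_norm ?sqrtr_ge0// ler_sqrt//.
exact: ltW.
Qed.

Lemma re_flow f : L2 f -> weak_flow v nu nu' (fun t => re (S t f)).
Proof.
move=> Lf; split.
- by move=> t t0; have [] := L2_sqi2 (semigroup_L2 AS t0 Lf).
- move=> t t0 e e0; apply: filterS (semigroup_near Lf t0 e0) => s H /H.
  apply: le_trans; rewrite /sqnorm.
  have -> : re (fun z => S s f z - S t f z) = (fun z => re (S s f) z - re (S t f) z).
    by apply: funext => z; rewrite /re; case: (S s f z) => ? ?; case: (S t f z).
  by rewrite lerDl ip_ge0.
- move=> b m j t t0; have [H _] := semigroup_weak AS Lf (test_fun_bas b m j) t0.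
  apply: (is_derive_eq H); apply: pairing_adj.
  by have [] := L2_sqi2 (semigroup_L2 AS (ltW t0) Lf).
Qed.

Lemma im_flow f : L2 f -> weak_flow v nu nu' (fun t => im (S t f)).
Proof.
move=> Lf; split.
- by move=> t t0; have [] := L2_sqi2 (semigroup_L2 AS t0 Lf).
- move=> t t0 e e0; apply: filterS (semigroup_near Lf t0 e0) => s H /H.
  apply: le_trans; rewrite /sqnorm.
  have -> : im (fun z => S s f z - S t f z) = (fun z => im (S s f) z - im (S t f) z).
    by apply: funext => z; rewrite /im; case: (S s f z) => ? ?; case: (S t f z).
  by rewrite lerDr ip_ge0.
- move=> b m j t t0; have [_ H] := semigroup_weak AS Lf (test_fun_bas b m j) t0.
  apply: (is_derive_eq H); apply: pairing_adj.
  by have [] := L2_sqi2 (semigroup_L2 AS (ltW t0) Lf).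
Qed.

(** [S 0 f] equals f only almost everywhere on the rectangle, so initial data are compared through
    integrals. *)
Lemma ip2_start f (g : R * R -> R) : L2 f -> sqi (@leb2 R) (@rect R) g ->
  ip2 (re (S 0 f)) g = ip2 (re f) g /\ ip2 (im (S 0 f)) g = ip2 (im f) g.
Proof.
move=> Lf sg; have [sr si] := L2_sqi2 Lf.
have [s0r s0i] := L2_sqi2 (semigroup_L2 AS (lexx 0) Lf).
have ae := semigroup_0 AS Lf.
split; apply: ae_eq_ip => //.
- exact: s0r.1.
- exact: sr.1.
- exact: sg.1.
- by apply: (@ae_sub _ (@plane R) R (@leb2 R) _ _ _ ae) => z H Dz; rewrite /re H.
- exact: s0i.1.
- exact: si.1.
- exact: sg.1.
- by apply: (@ae_sub _ (@plane R) R (@leb2 R) _ _ _ ae) => z H Dz; rewrite /im H.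
Qed.

Lemma sqnorm_start f : L2 f -> sqnorm (S 0 f) = sqnorm f.
Proof.
move=> Lf; have [sr si] := L2_sqi2 Lf.
have [s0r s0i] := L2_sqi2 (semigroup_L2 AS (lexx 0) Lf).
rewrite /sqnorm (ip2_start Lf s0r).1 (ip2_start Lf s0i).2.
have C x y : @ip2 R x y = ip2 y x by exact: ipC.
rewrite (C (re f)) (C (im f)).
by rewrite (ip2_start Lf sr).1 (ip2_start Lf si).2.
Qed.

Lemma opnorm_decay (k : int) (K J0 : nat) (lam t : R) :
  `|k|%N = K -> (0 < K)%N -> 0 < lam ->
  (forall J, (J0 <= J)%N -> resolvent_bound (fun j : 'I_J => damp nu nu' K j)
    (fun j l : 'I_J => K%:R * @Umat R J v j l) (lam ^+ 2)) ->
  0 <= t ->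
  (opnorm (fun f => S t (proj_mode k f)) <= (2 * expR (- (lam / 176 * t)))%:E)%E.
Proof.
move=> kK K0 lam0 rb t0; apply: ub_ereal_sup => _ [f [Lf f1] <-].
have sf := L2_sqi2 Lf; have sP := sqi2_proj k sf; have LP := sqi2_L2 sP.
have sqf : sqnorm f <= 1.
  move: f1; rewrite sqi2_norm// lee_fin => f1.
  have s0 : 0 <= sqnorm f by rewrite addr_ge0// ip_ge0.
  by rewrite -(sqr_sqrtr s0) expr_le1 ?sqrtr_ge0.
have modes b m j : m != K -> ip2 (re (S 0 (proj_mode k f))) (bas b m j) = 0 /\
    ip2 (im (S 0 (proj_mode k f))) (bas b m j) = 0.
  move=> mK; have [-> ->] := ip2_start LP (@sqi_bas R b m j).
  exact: (proj_coef kK sf b j mK).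
have h1 := @flow_decay R v Vm nu nu' lam _ K J0 t cv vV nu0 nu'0 (re_flow LP)
  (fun b m j mK => (modes b m j mK).1) lam0 rb t0.
have h2 := @flow_decay R v Vm nu nu' lam _ K J0 t cv vV nu0 nu'0 (im_flow LP)
  (fun b m j mK => (modes b m j mK).2) lam0 rb t0.
have Lt := semigroup_L2 AS t0 LP.
rewrite sqi2_norm; last exact: L2_sqi2.
rewrite lee_fin -[leRHS]ger0_norm ?mulr_ge0 ?expR_ge0// -sqrtr_sqr ler_wsqrtr//.
apply: le_trans (lerD h1 h2) _; rewrite -mulrDr -/(sqnorm _) (sqnorm_start LP).
(* Passing from the squared norm to the norm halves the rate, from lam / 88 to lam / 176. *)
have e2 : expR (- (lam / 88 * t)) = expR (- (lam / 176 * t)) ^+ 2.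
  by rewrite expr2 -expRD; congr expR; field.
rewrite e2 exprMn; have := sqr_ge0 (expR (- (lam / 176 * t))).
have := le_trans (sqnorm_proj kK K0 sf) sqf.
have : 0 <= sqnorm (proj_mode k f) by rewrite addr_ge0// ip_ge0.
by move: (sqnorm _) (expR _ ^+ 2) => a b a0 a1 b0; nra.
Qed.

End SemigroupFlow.

(** * Continuous extension of the profile *)

Section ClampedProfile.
Context {R : realType}.
Variables (u : R -> R) (n0 : nat).
Hypothesis hu : shear_profile u n0.

Definition clamp (y : R) : R := Num.max 0 (Num.min y 1).
(* Outside [0, 1] the profile u is an arbitrary function. *)
Definition clamped : R -> R := fun y => u (clamp y).

Lemma clamp_I01 y : I01 (clamp y).
Proof.
by rewrite /I01 /= in_itv/= /clamp le_max lexx /= ge_max ler01 ge_min lexx orbT.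
Qed.

Lemma clamp_id y : I01 y -> clamp y = y.
Proof. by rewrite /I01 /= in_itv/= /clamp => /andP[y0 y1]; rewrite min_l// max_r. Qed.

Lemma clamp_lip y z : `|clamp y - clamp z| <= `|y - z|.
Proof.
rewrite /clamp !maxEle !minEle.
by do ?case: ifP; move=> *; rewrite ?subrr ?normr0 ?normr_ge0 //; rewrite ler_norml; apply/andP; split;
  (have := ler_norm (y - z); have := ler_norm (z - y); rewrite (distrC z y)); lra.
Qed.

Lemma clamped_cts : continuous clamped.
Proof.
have [[der _] _ _ _] := hu.
apply/continuous_subspace_setT.
apply: continuous_expansion => t _.
have dt : derivable01 u (clamp t) := der 0%N (ltn0Sn _) _ (clamp_I01 t).
have [d d0 H] := derivable01_expansion dt ltr01.
exists (`|deriv01 u (clamp t)| + 1), d => // s _ st.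
have cs := clamp_lip s t.
have {}H := H _ (clamp_I01 s) (le_lt_trans cs st).
apply: le_trans (_ : (`|deriv01 u (clamp t)| + 1) * `|clamp s - clamp t| <= _); last first.
  by rewrite ler_wpM2l// addr_ge0.
rewrite mulrDl -normrM /clamped; apply: le_trans (lerD (lexx _) H).
rewrite [X in `|X| <= _](_ : _ = deriv01 u (clamp t) * (clamp s - clamp t) +
  (u (clamp s) - u (clamp t) - deriv01 u (clamp t) * (clamp s - clamp t))); last by ring.
exact: ler_normD.
Qed.

Lemma clamped_bound : exists M, forall y, `|clamped y| <= M.
Proof.
have cn : continuous (fun y => `|clamped y|).
  by move=> y; apply: cvg_norm; exact: clamped_cts.
have [c _ H] := EVT_max (ler01 : 0 <= 1 :> R) (continuous_subspaceT cn).
exists `|clamped c| => y; have := H (clamp y) (clamp_I01 y).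
by rewrite {1}/clamped clamp_id//; exact: clamp_I01.
Qed.

Lemma clamped_growth n c s : growth_cover u n c s -> growth_cover clamped n c s.
Proof.
move=> [H1 H2]; split=> // a aS y z ya za; have [Iy Hy] := H1 a aS y z ya za.
have [Iz _] := H1 a aS z y za ya.
by split=> //; rewrite /clamped !clamp_id.
Qed.

End ClampedProfile.

(** With kappa = nu / |k|, the numerator of the rate is |k| kappa^((n+1)/(n+3)); for kappa <= 1 the
    two logarithms have a nonnegative sum, so the denominator is at least 1. *)
Lemma decay_rate_le (R : realType) (n0 : nat) (nu : R) (k : int) (n : nat) :
  n = maxn n0 1 -> 0 < nu -> k <> 0 -> nu / `|k|%N%:R <= 1 ->
  decay_rate n0 nu k <= `|k|%N%:R * ((nu / `|k|%N%:R) `^ n.+3%:R^-1) ^+ n.+1.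
Proof.
move=> nE nu0 /eqP k0 kap1; rewrite /decay_rate -nE.
have K0 : (0 < `|k|)%N by rewrite absz_gt0.
have Kp : 0 < `|k|%N%:R :> R by rewrite ltr0n.
move: (`|k|%N%:R : R) Kp (K0) kap1 => K Kp _ kap1.
pose kap := nu / K; have kap0 : 0 < kap by rewrite divr_gt0.
have nuE : nu = kap * K by rewrite /kap divfK// gt_eqF.
have n3 : n%:R + 3 = n.+3%:R :> R by rewrite -natrD addn3.
have n1 : n%:R + 1 = n.+1%:R :> R by rewrite natr1.
have n30 : n.+3%:R != 0 :> R by rewrite pnatr_eq0.
have -> : (kap `^ n.+3%:R^-1) ^+ n.+1 = kap `^ (n.+1%:R / n.+3%:R).
  by rewrite -powR_mulrn ?powR_ge0// -powRrM mulrC.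
have lnk : 0 <= ln K + ln nu^-1.
  rewrite -lnM ?posrE ?invr_gt0// ln_ge0//.
  by rewrite ler_pdivlMr// mul1r; move: kap1; rewrite ler_pdivrMr// mul1r.
have den : 1 <= (1 + ln K + ln nu^-1) ^+ 2.
  by rewrite -addrA exprn_ege1// lerDl.
have -> : nu `^ ((n%:R + 1) / (n%:R + 3)) * K `^ (2 / (n%:R + 3)) = K * kap `^ (n.+1%:R / n.+3%:R).
  rewrite n3 n1 {1}nuE powRM ?ltW// -mulrA -powRD; last by rewrite gt_eqF// implybT.
  have -> : n.+1%:R / n.+3%:R + 2 / n.+3%:R = 1 :> R.
    by rewrite -mulrDl -natrD addn2 divff.
  by rewrite powRr1 ?ltW// mulrC.
rewrite ler_pdivrMr ?(lt_le_trans ltr01)// ler_peMr//.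
by rewrite mulr_ge0 ?powR_ge0 ?ltW.
Qed.

Theorem theorem1p3 (R : realType) (u : R -> R) (n0 : nat)
  (hu : shear_profile u n0) :
  exists eps C kappa0 : R,
    [/\ 0 < eps < 1, 1 <= C & 0 < kappa0 < 1] /\
    forall (nu : R) (k : int), 0 < nu -> k <> 0 ->
      nu * (`|k|%N%:R)^-1 <= kappa0 ->
      (forall S : R -> (R * R -> R[i]) -> R * R -> R[i],
         solution_semigroup (adj_full u nu) S ->
         forall t : R, 0 <= t ->
           (opnorm (fun f => S t (proj_mode k f))
              <= (C * expR (- (eps * decay_rate n0 nu k * t)))%:E)%E) /\
      (forall S : R -> (R * R -> R[i]) -> R * R -> R[i],
         solution_semigroup (adj_hypo u nu) S ->
         forall t : R, 0 <= t ->
           (opnorm (fun f => S t (proj_mode k f))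
              <= (C * expR (- (eps * decay_rate n0 nu k * t)))%:E)%E).
Proof.
pose n := maxn n0 1; pose v := clamped u.
have cv : continuous v := clamped_cts hu.
have [M vM] := clamped_bound hu.
have [c c0 [s /clamped_growth Gs]] := growth_coverP hu (leq_maxl n0 1).
have v0 y : y <= 0 -> v y = v 0.
  by move=> y0; rewrite /v /clamped /clamp; congr u; rewrite !max_l ?ge_min ?lexx ?y0.
have v1 y : 1 <= y -> v y = v 1.
  by move=> y1; rewrite /v /clamped /clamp (min_r y1) minxx.
have [th th0 Hth] := galerkin_resolvent (@cosb_complete R) cv v0 v1 vM c0 Gs.
(* [th / 176] is the constant produced by the operator norm estimate; the minimum with 1/2 places it
   below 1. *)
have e0 : 0 < Num.min 2^-1 (th / 176) by rewrite lt_min invr_gt0 ltr0n divr_gt0.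
exists (Num.min 2^-1 (th / 176)), 2, 2^-1; split.
  split; [|by rewrite ler1n|by rewrite invr_gt0 ltr0n invf_lt1 ?ltr1n].
  by rewrite e0 gt_min invf_lt1 ?ltr1n.
move=> nu k nu0 k0 kap1; pose K := `|k|%N.
have K0 : (0 < K)%N by rewrite absz_gt0; exact/eqP.
have Kp : 0 < K%:R :> R by rewrite ltr0n.
have kapp : 0 < nu / K%:R by rewrite divr_gt0.
have kap1' : nu / K%:R <= 1 by apply: le_trans kap1 _; rewrite invf_le1 ?ler1n.
(* The balance of scales: [d ^+ n.+3] is the reduced viscosity nu / |k| of the Galerkin resolvent
   bound. *)
pose d := (nu / K%:R) `^ n.+3%:R^-1.
have d0 : 0 < d by rewrite powR_gt0.
have d1 : d <= 1.
  have -> : 1 = 1 `^ n.+3%:R^-1 :> R by rewrite powR1.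
  by rewrite ge0_ler_powR ?nnegrE ?invr_ge0 ?(ltW kapp).
have dE : d ^+ n.+3 = nu / K%:R.
  by rewrite -powR_mulrn ?powR_ge0// -powRrM mulVf ?pnatr_eq0// powRr1// ltW.
have d01 : 0 < d <= 1 by rewrite d0 d1.
have [J0 HJ] := Hth d d01.
pose lam := K%:R * (th * d ^+ n.+1).
have lam0 : 0 < lam by rewrite !mulr_gt0// exprn_gt0.
(* One bound for both equations: nu' = nu for the full Laplacian and nu' = 0 for the hypoelliptic
   one, the term nu' K^2 being the shift absorbed by mu. *)
have rb nu' : 0 <= nu' -> forall J, (J0 <= J)%N ->
    resolvent_bound (fun j : 'I_J => damp nu nu' K j) (fun j l : 'I_J => K%:R * @Umat R J v j l) (lam ^+ 2).
  move=> nu'0 J /HJ rbJ.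
  have a0 : 0 <= nu' * K%:R ^+ 2 by rewrite mulr_ge0 ?sqr_ge0.
  have := resolvent_bound_scale Kp a0 rbJ; rewrite (_ : K%:R ^+ 2 * _ = lam ^+ 2).
    congr resolvent_bound; apply: funext => j.
    by rewrite /damp dE mulrA (mulrC K%:R) divfK ?gt_eqF.
  by rewrite /lam -exprMn.
have rate t : 0 <= t -> 2 * expR (- (lam / 176 * t)) <=
    2 * expR (- (Num.min 2^-1 (th / 176) * decay_rate n0 nu k * t)).
  move=> t0; rewrite ler_pM2l// ler_expR lerN2 ler_wpM2r//.
  have h := decay_rate_le (erefl n) nu0 k0 kap1'.
  have -> : lam / 176 = th / 176 * (K%:R * d ^+ n.+1) by rewrite /lam; ring.
  apply: le_trans (ler_wpM2l (ltW e0) h) _.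
  apply: ler_wpM2r; first by rewrite mulr_ge0 ?exprn_ge0 ?ltW.
  by rewrite ge_min lexx orbT.
have uv z : rect z -> u z.2 = v z.2.
  by move=> [_ zI]; rewrite /v /clamped clamp_id.
split=> S AS t t0.
- have A_bas b m j z : rect z -> adj_full u nu (bas b m j) z =
      sg b m * (v z.2 * bas (~~ b) m j z) - damp nu nu m j * bas b m j z.
    by move=> zr; rewrite adj_full_bas uv.
  apply: le_trans (opnorm_decay AS cv vM (ltW nu0) (ltW nu0) A_bas (erefl K) K0 lam0 (rb nu (ltW nu0)) t0) _.
  by rewrite lee_fin; exact: rate.
- have A_bas b m j z : rect z -> adj_hypo u nu (bas b m j) z =
      sg b m * (v z.2 * bas (~~ b) m j z) - damp nu 0 m j * bas b m j z.
    by move=> zr; rewrite adj_hypo_bas uv.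
  apply: le_trans (opnorm_decay AS cv vM (ltW nu0) (lexx 0) A_bas (erefl K) K0 lam0 (rb 0 (lexx 0)) t0) _.
  by rewrite lee_fin; exact: rate.
Qed.
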